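(* Let $P_0\supset P_1\supset\cdots\supset P_8$ be the $\mathrm{SO}$-Bott chain starting with $P_0=\mathrm{SO}_{16n}$ and $\tilde P_0\supset\tilde P_1\supset\cdots\supset\tilde P_8$ the $\mathrm{U}$-Bott chain starting with $\tilde P_0=\mathrm{U}_{16n}$, constructed with the same base points $J_0=I,J_1,\dots,J_8$, $J_k\in P_k$. Let $\tau:\mathrm{U}_{16n}\to\mathrm{U}_{16n}$, $\tau(X)=\overline X$, be complex conjugation. (1) For every $k\in\{0,1,\dots,8\}$ the space $\tilde P_k$ is $\tau$-invariant and $$P_k=(\tilde P_k^{\tau})_{J_k},$$ the connected component containing $J_k$ of the fixed point set of $\tau$ in $\tilde P_k$; in particular $P_k\subset\tilde P_k$. (2) These vertical inclusions $P_k\subset\tilde P_k$ and the horizontal inclusions $P_{k+1}\subset P_k$, $\tilde P_{k+1}\subset\tilde P_k$ of the two Bott chains form a commutative ladder diagram, i.e. for every $k\in\{0,\dots,7\}$ the compositions $P_{k+1}\subset P_k\subset\tilde P_k$ and $P_{k+1}\subset\tilde P_{k+1}\subset\tilde P_k$ coincide. (3) For every $\ell\in\{0,1,\dots,7\}$ the square formed by the canonical maps $\jmath_{\ell+1}:P_{\ell+1}\to\Omega(P_\ell;J_\ell,-J_\ell)$ and $\tilde\jmath_{\ell+1}:\tilde P_{\ell+1}\to\Omega(\tilde P_\ell;J_\ell,-J_\ell)$ and the inclusions $P_{\ell+1}\subset\tilde P_{\ell+1}$, $\Omega(P_\ell;J_\ell,-J_\ell)\subset\Omega(\tilde P_\ell;J_\ell,-J_\ell)$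 commutes, i.e. $\tilde\jmath_{\ell+1}|_{P_{\ell+1}}$ equals $\jmath_{\ell+1}$ followed by the inclusion of path spaces.
   Context: Notation. For a map $\sigma:A\to A$, $A^\sigma$ is its fixed point set; for $a$ in a space $A$, $A_a$ is the connected component of $A$ containing $a$. Centrioles. For a compact connected Riemannian symmetric space $P$ let $s_x$ be the geodesic symmetry at $x$. For $o\in P$, a pole of $(P,o)$ is a point $p\ne o$ with $s_p=s_o$. If $p$ is a pole, the centrosome $C_p(P,o)$ is the set of midpoints of geodesics in $P$ from $o$ to $p$; its connected components are the centrioles of $(P,o)$ relative to $p$. A centriole containing a midpoint of a shortest geodesic segment from $o$ to $p$ is called an s-centriole (it then consists only of midpoints of such shortest segments). $\mathrm{SO}$-Bott chain. $n\ge1$ is an integer, $P_0=\mathrm{SO}_{16n}$ with the bi-invariant metric $\langle X,Y\rangle=-\mathrm{tr}(XY)$, $J_0=I$. $P_1$ is one of the two connected components of $\{J\in\mathrm{SO}_{16n}: J^2=-I\}$; inductively, having picked $J_k\in P_k$ ($1\le k\le 7$), $P_{k+1}$ is the top-dimensional connected component of $\{J\in P_k: JJ_k=-J_kJ\}$ (for $k=7$: any one of the two components, which are diffeomorphic). Finally $J_8\in P_8$. Each $P_k$ is totally geodesic in $\mathrm{SO}_{16n}$ and carries the submanifold metric; for $k\leq 7$, $-J_k\in P_k$ is a pole of $(P_k,J_k)$, and $P_{k+1}$ is an s-centriole of $(P_k,J_k)$ relative to $-J_k$. $\mathrm{U}$-Bott chain. $\tilde P_0=\mathrm{U}_{16n}$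 with the bi-invariant metric $\langle X,Y\rangle=-\mathrm{tr}(XY)$; for $0\le k\le7$, $\tilde P_{k+1}$ is the top-dimensional s-centriole of $(\tilde P_k,J_k)$ relative to the pole $-J_k$ (with $J_0=I$). Here the base points $J_k$ are those chosen for the $\mathrm{SO}$-chain (one has $J_k\in P_k\subset\tilde P_k$, so this makes sense). Each $\tilde P_k$ carries the submanifold metric; $\tilde P_k$ is isometric to a Grassmannian $\mathrm{G}_q(\mathbb C^{2q})$ for $k$ odd and to a unitary group for $k$ even (up to scaling the metric). Path spaces. $\Omega(M;p,q)$ is the space of piecewise smooth paths $\gamma:[0,1]\to M$ from $p$ to $q$. If $Q$ is an s-centriole of $(P,o)$ relative to the pole $p$, the canonical map $Q\to\Omega(P;o,p)$ sends $x\in Q$ to the unique shortest geodesic segment $[0,1]\to P$ from $o$ to $p$ with midpoint $x$. The maps $\jmath_{\ell+1}$, $\tilde\jmath_{\ell+1}$ are these canonical maps for $P_{\ell+1}\subset P_\ell$ and $\tilde P_{\ell+1}\subset\tilde P_\ell$. *)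

(* Defs.v *)
From HB Require Import structures.
From mathcomp Require Import all_boot all_order all_algebra.
From mathcomp Require Import complex.
From mathcomp Require Import all_classical all_reals all_analysis.

Set Implicit Arguments.
Unset Strict Implicit.
Unset Printing Implicit Defensive.

Import Order.TTheory GRing.Theory Num.Theory.
Import numFieldNormedType.Exports.
Import numFieldTopology.Exports.

Local Open Scope classical_set_scope.
Local Open Scope ring_scope.
Local Open Scope complex_scope.

(* All spaces are subsets of the real vector space of complex matrices. The
   topology of [R[i]] is found by the library on its alias [R[i]^o]. *)
Definition component (R : realType) (N : nat) (A : set 'M[R[i]]_N)
    (x : 'M[R[i]]_N) : set 'M[R[i]]_N :=
  @connected_component 'M[R[i]^o]_N A x.

Definition component_of (R : realType) (N : nat)
    (A Q : set 'M[R[i]]_N) : Prop :=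
  exists2 x, A x & Q = component A x.

(* Real inner product on matrices. On tangent vectors [X *m A], [X *m B] to the
   unitary group at X it is the bi-invariant metric -tr(AB): see
   [frob_biinvariant]. *)
Definition frob (R : realType) (N : nat) (V W : 'M[R[i]]_N) : R :=
  complex.Re (\tr ((map_mx Num.conj V)^T *m W)).

Lemma frob_biinvariant (R : realType) (N : nat) (X A B : 'M[R[i]]_N) :
  X \is unitarymx -> (map_mx Num.conj A)^T = - A ->
  frob (X *m A) (X *m B) = complex.Re (- \tr (A *m B)).
Proof.
move=> /unitarymxP hX hA; rewrite /frob map_mxM trmx_mul hA.
have hX' : (map_mx Num.conj X)^T *m X = 1%:M.
  by apply: mulmx1C; move: hX; rewrite map_trmx => hX; rewrite -hX.
by rewrite -mulmxA (mulmxA _ X) hX' mul1mx mulNmx linearN.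
Qed.

(* Real and imaginary parts of all entries are C^oo on the whole real line. *)
Definition smooth (R : realType) (N : nat) (c : R -> 'M[R[i]]_N) : Prop :=
  forall (i j : 'I_N) (k : nat) (t : R),
    derivable (derive1n k (fun s : R => complex.Re (c s i j))) t 1 /\
    derivable (derive1n k (fun s : R => complex.Im (c s i j))) t 1.

Definition velocity (R : realType) (N : nat) (c : R -> 'M[R[i]]_N) (t : R) :
    'M[R[i]]_N :=
  \matrix_(i, j) (derive1 (fun s : R => complex.Re (c s i j)) t
                  +i* derive1 (fun s : R => complex.Im (c s i j)) t).

Definition tangent (R : realType) (N : nat) (P : set 'M[R[i]]_N)
    (x : 'M[R[i]]_N) : set 'M[R[i]]_N :=
  [set v | exists c : R -> 'M[R[i]]_N,
     [/\ smooth c, forall t, P (c t), c 0 = x & velocity c 0 = v]].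

(* Every tangent space of Q has a real basis with d elements. *)
Definition mfd_dim (R : realType) (N : nat) (Q : set 'M[R[i]]_N) (d : nat) :
    Prop :=
  forall x, Q x -> exists b : 'I_d -> 'M[R[i]]_N, forall v,
    tangent Q x v <->
    exists! r : 'rV[R]_d, v = \sum_(i < d) (r 0 i)%:C *: b i.

Definition top_dimensional (R : realType) (N : nat)
    (F : set 'M[R[i]]_N -> Prop) (Q : set 'M[R[i]]_N) : Prop :=
  F Q /\ exists2 d, mfd_dim Q d &
    forall Q' d', F Q' -> mfd_dim Q' d' -> (d' <= d)%N.

(* The Levi-Civita connection of a submanifold P of a Euclidean space is the
   tangential part of the flat derivative, so a curve in P is a geodesic iff
   its acceleration is normal to P. Only compact P occur, hence every geodesic
   segment extends to a geodesic defined on the whole of R. *)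
Definition geodesic (R : realType) (N : nat) (P : set 'M[R[i]]_N)
    (c : R -> 'M[R[i]]_N) : Prop :=
  [/\ smooth c, forall t, P (c t) &
      forall t v, tangent P (c t) v -> frob (velocity (velocity c) t) v = 0].

(* The segment is the restriction of c to [0, 1]; its midpoint is [c 2^-1]. *)
Definition geodesic_from_to (R : realType) (N : nat) (P : set 'M[R[i]]_N)
    (o p : 'M[R[i]]_N) (c : R -> 'M[R[i]]_N) : Prop :=
  [/\ geodesic P c, c 0 = o & c 1 = p].

Definition curve_length (R : realType) (N : nat) (c : R -> 'M[R[i]]_N) :
    \bar R :=
  (\int[lebesgue_measure]_(t in `[0%R, 1%R])
     (Num.sqrt (frob (velocity c t) (velocity c t)))%:E)%E.

Definition shortest_geodesic (R : realType) (N : nat) (P : set 'M[R[i]]_N)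
    (o p : 'M[R[i]]_N) (c : R -> 'M[R[i]]_N) : Prop :=
  geodesic_from_to P o p c /\
  forall c', geodesic_from_to P o p c' ->
    (curve_length c <= curve_length c')%E.

(* s restricts to the geodesic symmetry of P at x. As P is compact and
   connected, this determines s on P. *)
Definition geodesic_symmetry (R : realType) (N : nat) (P : set 'M[R[i]]_N)
    (x : 'M[R[i]]_N) (s : 'M[R[i]]_N -> 'M[R[i]]_N) : Prop :=
  (forall y, P y -> P (s y)) /\
  forall c, geodesic P c -> c 0 = x -> forall t, s (c t) = c (- t).

Definition pole (R : realType) (N : nat) (P : set 'M[R[i]]_N)
    (o p : 'M[R[i]]_N) : Prop :=
  [/\ P o, P p, p <> o &
      exists2 s, geodesic_symmetry P o s & geodesic_symmetry P p s].

Definition centrosome (R : realType) (N : nat) (P : set 'M[R[i]]_N)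
    (o p : 'M[R[i]]_N) : set 'M[R[i]]_N :=
  [set x | exists2 c, geodesic_from_to P o p c & c 2^-1 = x].

Definition s_centriole (R : realType) (N : nat) (P : set 'M[R[i]]_N)
    (o p : 'M[R[i]]_N) (Q : set 'M[R[i]]_N) : Prop :=
  [/\ pole P o p, component_of (centrosome P o p) Q &
      exists2 c, shortest_geodesic P o p c & Q (c 2^-1)].

Definition unit_interval (R : realType) : Type := {t : R | 0 <= t <= 1}.

Definition restrict01 (R : realType) (N : nat) (c : R -> 'M[R[i]]_N) :
    unit_interval R -> 'M[R[i]]_N :=
  fun t => c (sval t).

(* The subdivision is 0 < s_0 < ... < s_(m-1) = 1; the i-th piece of w is the
   restriction of the smooth curve [c i]. *)
Definition piecewise_smooth (R : realType) (N : nat)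
    (w : unit_interval R -> 'M[R[i]]_N) : Prop :=
  exists (s : seq R) (c : nat -> R -> 'M[R[i]]_N),
    [/\ path (fun x y : R => x < y) 0 s, last 0 s = 1 &
        forall i, (i < size s)%N -> smooth (c i) /\
          forall t : unit_interval R,
            nth 0 (0 :: s) i <= sval t <= nth 0 s i -> w t = c i (sval t)].

Definition Omega (R : realType) (N : nat) (P : set 'M[R[i]]_N)
    (p q : 'M[R[i]]_N) : set (unit_interval R -> 'M[R[i]]_N) :=
  [set w | [/\ piecewise_smooth w, forall t, P (w t),
               forall t, sval t = 0 -> w t = p &
               forall t, sval t = 1 -> w t = q]].

(* j x is the unique shortest geodesic segment from o to p with midpoint x. *)
Definition canonical_map (R : realType) (N : nat) (P : set 'M[R[i]]_N)
    (o p : 'M[R[i]]_N) (Q : set 'M[R[i]]_N) (j : Q -> Omega P o p) : Prop :=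
  forall x : Q,
    [set restrict01 c | c in [set c | shortest_geodesic P o p c /\
                                      c 2^-1 = sval x]]
    = [set sval (j x)].

Definition SO (R : realType) (N : nat) : set 'M[R[i]]_N :=
  [set map_mx (real_complex R) A |
     A in [set A : 'M[R]_N | A *m A^T = 1%:M /\ \det A = 1]].

Definition U (R : realType) (N : nat) : set 'M[R[i]]_N :=
  [set X | X \is unitarymx].

Definition tau (R : realType) (N : nat) (X : 'M[R[i]]_N) : 'M[R[i]]_N :=
  map_mx Num.conj X.

Definition SO_Bott_chain (R : realType) (n : nat)
    (P : nat -> set 'M[R[i]]_(16 * n)) (J : nat -> 'M[R[i]]_(16 * n)) : Prop :=
  [/\ P 0%N = @SO R (16 * n) /\ J 0%N = 1%:M,
      component_of [set X | @SO R (16 * n) X /\ X *m X = - 1%:M] (P 1%N),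
      forall k, (1 <= k <= 7)%N ->
        top_dimensional
          (component_of [set X | P k X /\ X *m J k = - (J k *m X)])
          (P k.+1) &
      forall k, (k <= 8)%N -> P k (J k)].

(* A centriole of (Pt k, J k) only makes sense when J k lies in Pt k. This is a
   consequence, not a part, of the construction: the requirement on Pt k.+1 is
   therefore conditional, and J k \in Pt k is left to be proved. *)
Definition U_Bott_chain (R : realType) (n : nat)
    (Pt : nat -> set 'M[R[i]]_(16 * n)) (J : nat -> 'M[R[i]]_(16 * n)) : Prop :=
  Pt 0%N = @U R (16 * n) /\
  forall k, (k <= 7)%N -> Pt k (J k) ->
    top_dimensional (s_centriole (Pt k) (J k) (- J k)) (Pt k.+1).

(* Main.v *)
From HB Require Import structures.
Require Import Defs.
From mathcomp Require Import all_boot all_order all_algebra.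
From mathcomp Require Import complex ring lra.
From mathcomp Require Import all_classical all_reals all_analysis.

Set Implicit Arguments.
Unset Strict Implicit.
Unset Printing Implicit Defensive.

Import Order.TTheory GRing.Theory Num.Theory.
Import numFieldNormedType.Exports.
Import numFieldTopology.Exports.

Local Open Scope classical_set_scope.
Local Open Scope ring_scope.
Local Open Scope complex_scope.

(** Let Cl_k be the set of the unitary matrices X that anticommute with
    J_1, ..., J_(k-1) and satisfy X^2 = -1 (no conditions if k = 0). The geodesics
    in a component of Cl_k are the curves x exp(tB) with B skew-Hermitian. Those
    from J_k to -J_k have exp B = -1, so that their midpoints lie in Cl_(k+1) and
    their length is at least pi sqrt N, with equality exactly for the arcs
    cos(pi t) J_k + sin(pi t) y, where y is in Cl_(k+1). By induction, the k-th
    members of the U-chain and the SO-chain are the components of J_k in Cl_k and in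
    its real part, and the canonical maps send y to the same arc.

    The induction needs J_(k+1) to lie in the chosen component of Cl_(k+1). For k
    odd Cl_(k+1) is connected. For k even the trace of J_1 ... J_k X separates the
    components; the dimension is maximal only where this trace vanishes, and it
    vanishes at X = J_(k+1) because J_(k+2) anticommutes with J_1, ..., J_(k+1). *)

(** The obstacle is to link dimensions with traces. The space of generators B at x in Cl_(k+1) is
    the image of a projection made of successive means over conjugations. Its real trace is the
    dimension, and it equals (T(1) - T(x))/2, where T(W) is the mean of |tr(W A)|^2 over the
    products A of subsets of J_1, ..., J_k. Hence a larger dimension means a smaller T. T is
    nonnegative, and it vanishes at J_(k+1) because each product J_(k+1) A anticommutes with J_(k+1)
    or with J_(k+2). So it vanishes wherever the dimension is maximal, and with it the trace of the
    full product. Points of Cl_(k+1) are joined by conjugation: if a unitary u commutes with J_1,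
    ..., J_k and carries X to Y, then a logarithm of u gives a path from X to Y. For k odd such a u
    is written down from the eigenspaces of the product of the J_i; for k even it is built by
    restricting to an eigenspace of i J_(n+1) J_(n+2), which removes two of the J_i at a time. *)

(* Locked: otherwise unification keeps unfolding it in products. *)
HB.lock Definition adj (R : realType) (m n : nat) (A : 'M[R[i]]_(m, n)) :
    'M[R[i]]_(n, m) :=
  (map_mx Num.conj A)^T.

(** * Adjoints, and real and imaginary parts *)

Section Adjoint.
Context {R : realType}.
Local Notation C := R[i].

Lemma adjM m n p (A : 'M[C]_(m, n)) (B : 'M[C]_(n, p)) :
  adj (A *m B) = adj B *m adj A.
Proof. by rewrite !adj.unlock map_mxM trmx_mul. Qed.

Lemma adjK m n (A : 'M[C]_(m, n)) : adj (adj A) = A.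
Proof. by rewrite !adj.unlock; apply/matrixP=> i j; rewrite !mxE conjCK. Qed.

Lemma adjD m n (A B : 'M[C]_(m, n)) : adj (A + B) = adj A + adj B.
Proof. by rewrite !adj.unlock map_mxD linearD. Qed.

Lemma adjN m n (A : 'M[C]_(m, n)) : adj (- A) = - adj A.
Proof. by rewrite !adj.unlock map_mxN linearN. Qed.

Lemma adjZ m n (a : C) (A : 'M[C]_(m, n)) : adj (a *: A) = Num.conj a *: adj A.
Proof. by rewrite !adj.unlock map_mxZ linearZ. Qed.

Lemma adj1 n : adj (1%:M : 'M[C]_n) = 1%:M.
Proof. by rewrite !adj.unlock map_mx1 trmx1. Qed.

Lemma adj0 m n : adj (0 : 'M[C]_(m, n)) = 0.
Proof. by rewrite !adj.unlock map_mx0 trmx0. Qed.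

Lemma conj_adj n (A : 'M[C]_n) : tau (adj A) = adj (tau A).
Proof. by rewrite adj.unlock; apply/matrixP=> i j; rewrite !mxE. Qed.

Lemma tauM n (A B : 'M[C]_n) : tau (A *m B) = tau A *m tau B.
Proof. by rewrite /tau map_mxM. Qed.

(** Both conjugates of z give |z|^2 when multiplied by z. *)
Lemma conjcE (z : C) : Num.conj z = conjc z.
Proof.
have [-> | z0] := eqVneq z 0; first by rewrite rmorph0 conjc0.
by apply: (mulfI z0); rewrite -normCK sqr_normc.
Qed.

Lemma cRe_conj (z : C) : complex.Re (Num.conj z) = complex.Re z.
Proof. by rewrite conjcE; case: z. Qed.

Lemma cIm_conj (z : C) : complex.Im (Num.conj z) = - complex.Im z.
Proof. by rewrite conjcE; case: z. Qed.

Lemma complex_ext (z w : C) :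
  complex.Re z = complex.Re w -> complex.Im z = complex.Im w -> z = w.
Proof. by case: z w => [a b] [c d] /= -> ->. Qed.

Lemma cReD (z w : C) : complex.Re (z + w) = complex.Re z + complex.Re w.
Proof. by case: z w => [a b] [c d]. Qed.

Lemma cImD (z w : C) : complex.Im (z + w) = complex.Im z + complex.Im w.
Proof. by case: z w => [a b] [c d]. Qed.

Lemma cReN (z : C) : complex.Re (- z) = - complex.Re z.
Proof. by case: z. Qed.

Lemma cImN (z : C) : complex.Im (- z) = - complex.Im z.
Proof. by case: z. Qed.

Lemma cReM (z w : C) : complex.Re (z * w) =
  complex.Re z * complex.Re w - complex.Im z * complex.Im w.
Proof. by case: z w => [a b] [c d]. Qed.

Lemma cImM (z w : C) : complex.Im (z * w) =
  complex.Re z * complex.Im w + complex.Im z * complex.Re w.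
Proof. by case: z w => [a b] [c d]. Qed.

Lemma cRe_sum (I : Type) (r : seq I) (P : pred I) (F : I -> C) :
  complex.Re (\sum_(i <- r | P i) F i) = \sum_(i <- r | P i) complex.Re (F i).
Proof. by elim/big_rec2: _ => // i x y _ <-; rewrite cReD. Qed.

Lemma cIm_sum (I : Type) (r : seq I) (P : pred I) (F : I -> C) :
  complex.Im (\sum_(i <- r | P i) F i) = \sum_(i <- r | P i) complex.Im (F i).
Proof. by elim/big_rec2: _ => // i x y _ <-; rewrite cImD. Qed.

End Adjoint.

(** * Differentiation of matrix-valued curves *)

Section MatrixCurves.
Context {R : realType}.
Local Notation C := R[i].

(** Existence and value of the derivative in one predicate; [velocity] alone says nothing about
    existence. *)
Definition cderiv (f : R -> C) (t : R) (v : C) : Prop :=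
  is_derive t 1 (fun s => complex.Re (f s)) (complex.Re v) /\
  is_derive t 1 (fun s => complex.Im (f s)) (complex.Im v).

Lemma cderiv_cst (a : C) t : cderiv (fun _ => a) t 0.
Proof. by split; exact: is_derive_cst. Qed.

Lemma cderivD (f g : R -> C) t v w :
  cderiv f t v -> cderiv g t w -> cderiv (fun s => f s + g s) t (v + w).
Proof.
move=> [f1 f2] [g1 g2]; split; rewrite ?cReD ?cImD.
- by under eq_fun do rewrite cReD; exact: is_deriveD.
- by under eq_fun do rewrite cImD; exact: is_deriveD.
Qed.

Lemma cderiv_sum (I : Type) (r : seq I) (f : I -> R -> C) t (v : I -> C) :
  (forall i, cderiv (f i) t (v i)) ->
  cderiv (fun s => \sum_(i <- r) f i s) t (\sum_(i <- r) v i).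
Proof.
move=> H; elim: r => [|i r IH].
  rewrite big_nil; under eq_fun do rewrite big_nil; exact: cderiv_cst.
by rewrite big_cons; under eq_fun do rewrite big_cons; exact: cderivD.
Qed.

Lemma cderivM (f g : R -> C) t v w :
  cderiv f t v -> cderiv g t w ->
  cderiv (fun s => f s * g s) t (v * g t + f t * w).
Proof.
move=> [f1 f2] [g1 g2]; split.
- under eq_fun do rewrite cReM.
  apply: (is_derive_eq (is_deriveB (is_deriveM f1 g1) (is_deriveM f2 g2))).
  by rewrite cReD !cReM /GRing.scale /=; ring.
- under eq_fun do rewrite cImM.
  apply: (is_derive_eq (is_deriveD (is_deriveM f1 g2) (is_deriveM f2 g1))).
  by rewrite cImD !cImM /GRing.scale /=; ring.
Qed.

Lemma cderiv_conj (f : R -> C) t v :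
  cderiv f t v -> cderiv (fun s => Num.conj (f s)) t (Num.conj v).
Proof.
move=> [f1 f2]; split.
- by under eq_fun do rewrite cRe_conj; rewrite cRe_conj.
- by under eq_fun do rewrite cIm_conj; rewrite cIm_conj; exact: is_deriveN.
Qed.

Definition mderiv (m n : nat) (c : R -> 'M[C]_(m, n)) (t : R)
    (V : 'M[C]_(m, n)) : Prop :=
  forall i j, cderiv (fun s => c s i j) t (V i j).

Lemma mderiv_cst m n (A : 'M[C]_(m, n)) t : mderiv (fun _ => A) t 0.
Proof. by move=> i j; rewrite mxE; exact: cderiv_cst. Qed.

Lemma mderivD m n (c d : R -> 'M[C]_(m, n)) t V W :
  mderiv c t V -> mderiv d t W -> mderiv (fun s => c s + d s) t (V + W).
Proof.
move=> hc hd i j; rewrite mxE; under eq_fun do rewrite mxE.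
exact: cderivD.
Qed.

Lemma mderivM m n p (c : R -> 'M[C]_(m, n)) (d : R -> 'M[C]_(n, p)) t V W :
  mderiv c t V -> mderiv d t W ->
  mderiv (fun s => c s *m d s) t (V *m d t + c t *m W).
Proof.
move=> hc hd i j; rewrite !mxE -big_split /=; under eq_fun do rewrite mxE.
by apply: cderiv_sum => k; exact: cderivM.
Qed.

Lemma mderivMl m n p (A : 'M[C]_(m, n)) (c : R -> 'M[C]_(n, p)) t V :
  mderiv c t V -> mderiv (fun s => A *m c s) t (A *m V).
Proof.
by move=> h; have := mderivM (mderiv_cst A t) h; rewrite mul0mx add0r.
Qed.

Lemma mderivMr m n p (A : 'M[C]_(n, p)) (c : R -> 'M[C]_(m, n)) t V :
  mderiv c t V -> mderiv (fun s => c s *m A) t (V *m A).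
Proof.
by move=> h; have := mderivM h (mderiv_cst A t); rewrite mulmx0 addr0.
Qed.

Lemma mderivZ m n (A : 'M[C]_(m, n)) (f : R -> C) t v :
  cderiv f t v -> mderiv (fun s => f s *: A) t (v *: A).
Proof.
move=> h i j; rewrite mxE; under eq_fun do rewrite mxE.
by have := cderivM h (cderiv_cst (A i j) t); rewrite mulr0 addr0.
Qed.

Lemma mderivN m n (c : R -> 'M[C]_(m, n)) t V :
  mderiv c t V -> mderiv (fun s => - c s) t (- V).
Proof.
move=> h; have := mderivMl (- 1%:M) h; rewrite mulNmx mul1mx.
by under eq_fun do rewrite mulNmx mul1mx.
Qed.

Lemma mderiv_adj m n (c : R -> 'M[C]_(m, n)) t V :
  mderiv c t V -> mderiv (fun s => adj (c s)) t (adj V).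
Proof.
by rewrite adj.unlock => h i j; rewrite !mxE; under eq_fun do rewrite !mxE; exact: cderiv_conj.
Qed.

Lemma mderiv_tau n (c : R -> 'M[C]_n) t V :
  mderiv c t V -> mderiv (fun s => tau (c s)) t (tau V).
Proof.
by move=> h i j; rewrite !mxE; under eq_fun do rewrite !mxE; exact: cderiv_conj.
Qed.

Lemma mderiv_velocity n (c : R -> 'M[C]_n) t V : mderiv c t V -> velocity c t = V.
Proof.
move=> h; apply/matrixP=> i j; rewrite mxE; have [h1 h2] := h i j.
by rewrite !derive1E (@derive_val _ _ _ _ _ _ _ h1) (@derive_val _ _ _ _ _ _ _ h2); case: (V i j).
Qed.

Lemma mderiv_unique n (c : R -> 'M[C]_n) t V W :
  mderiv c t V -> mderiv c t W -> V = W.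
Proof. by move=> /mderiv_velocity <- /mderiv_velocity <-. Qed.

Lemma smooth_mderiv n (c : R -> 'M[C]_n) t :
  smooth c -> mderiv c t (velocity c t).
Proof.
move=> h i j; have [h1 h2] := h i j 0%N t.
by have := derivableP h1; have := derivableP h2; rewrite -!derive1E mxE.
Qed.

Lemma smooth_mderiv2 n (c : R -> 'M[C]_n) t :
  smooth c -> mderiv (velocity c) t (velocity (velocity c) t).
Proof.
move=> h i j; have [h1 h2] := h i j 1%N t; rewrite !derive1n1 in h1 h2.
have := derivableP h1; have := derivableP h2; rewrite -!derive1E.
have -> : derive1 (fun s => complex.Re (c s i j)) =
  (fun s => complex.Re (velocity c s i j)) by apply/funext => s; rewrite mxE.
have -> : derive1 (fun s => complex.Im (c s i j)) =
  (fun s => complex.Im (velocity c s i j)) by apply/funext => s; rewrite mxE.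
by move=> d2 d1; split; rewrite mxE.
Qed.

Lemma mderiv_is_cst m n (c : R -> 'M[C]_(m, n)) :
  (forall t, mderiv c t 0) -> forall s t, c s = c t.
Proof.
move=> h s t; apply/matrixP=> i j; apply: complex_ext.
- apply: (@is_derive_0_is_cst _ (fun s => complex.Re (c s i j))) => x.
  by have [h1 _] := h x i j; rewrite mxE in h1.
- apply: (@is_derive_0_is_cst _ (fun s => complex.Im (c s i j))) => x.
  by have [_ h1] := h x i j; rewrite mxE in h1.
Qed.

(** Smooth curves are recognised by listing all their derivatives in closed form. *)
Lemma smooth_seq n (c : nat -> R -> 'M[C]_n) :
  (forall k t, mderiv (c k) t (c k.+1 t)) -> smooth (c 0%N).
Proof.
move=> h.
have hR i j k : derive1n k (fun s => complex.Re (c 0%N s i j)) =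
    (fun s => complex.Re (c k s i j)).
  elim: k => [|k IH]; first by rewrite derive1n0.
  rewrite derive1nS IH; apply/funext => t; rewrite derive1E.
  by have [h1 _] := h k t i j; exact: derive_val.
have hI i j k : derive1n k (fun s => complex.Im (c 0%N s i j)) =
    (fun s => complex.Im (c k s i j)).
  elim: k => [|k IH]; first by rewrite derive1n0.
  rewrite derive1nS IH; apply/funext => t; rewrite derive1E.
  by have [_ h1] := h k t i j; exact: derive_val.
move=> i j k t; rewrite hR hI.
by case: (h k t i j) => [[d1 _] [d2 _]]; split; [exact: d1 | exact: d2].
Qed.

End MatrixCurves.

(** * One-parameter groups of unitary matrices *)

Definition cis (R : realType) (t : R) : R[i] := (cos t) +i* (sin t).

(** This is exp(tB) for B = [rot_gen Q th]. Spectral data replace the exponential series and keep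
    the eigenangles [th] at hand, from which lengths and endpoints are read. *)
HB.lock Definition rot (R : realType) (n : nat) (Q : 'M[R[i]]_n) (th : 'rV[R]_n)
    (t : R) : 'M[R[i]]_n :=
  adj Q *m diag_mx (\row_j cis (th 0 j * t)) *m Q.

HB.lock Definition rot_gen (R : realType) (n : nat) (Q : 'M[R[i]]_n)
    (th : 'rV[R]_n) : 'M[R[i]]_n :=
  adj Q *m diag_mx (\row_j ((th 0 j) *i)) *m Q.

Section Exponential.
Context {R : realType}.
Local Notation C := R[i].

Lemma unitary_adjP n (X : 'M[C]_n) : X \is unitarymx <-> X *m adj X = 1%:M.
Proof.
by rewrite adj.unlock map_trmx; split=> [/unitarymxP|h] //; apply/unitarymxP.
Qed.

Lemma unitary_adj n (X : 'M[C]_n) : X \is unitarymx -> X *m adj X = 1%:M.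
Proof. by move/unitary_adjP. Qed.

Lemma adj_unitary n (X : 'M[C]_n) : X \is unitarymx -> adj X *m X = 1%:M.
Proof. by move/unitary_adj; exact: mulmx1C. Qed.

Lemma mulUadjK m n (A : 'M[C]_(m, n)) (Q : 'M[C]_n) : Q \is unitarymx -> A *m Q *m adj Q = A.
Proof. by move=> hQ; rewrite -mulmxA unitary_adj// mulmx1. Qed.

Lemma muladjUK m n (A : 'M[C]_(m, n)) (Q : 'M[C]_n) : Q \is unitarymx -> A *m adj Q *m Q = A.
Proof. by move=> hQ; rewrite -mulmxA adj_unitary// mulmx1. Qed.

Lemma frob_adj n (V W : 'M[C]_n) : frob V W = complex.Re (\tr (adj V *m W)).
Proof. by rewrite adj.unlock. Qed.

Lemma spectral_decomposition n (A : 'M[C]_n) : A *m adj A = adj A *m A ->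
  exists2 Q : 'M[C]_n, Q \is unitarymx &
    exists d : 'rV[C]_n, A = adj Q *m diag_mx d *m Q.
Proof.
move=> h; exists (spectralmx A); first exact: spectral_unitarymx.
exists (spectral_diag A).
have /orthomx_spectralP : A \is normalmx.
  by apply/normalmxP; rewrite adj.unlock map_trmx in h.
rewrite (invmx_unitary (spectral_unitarymx A)) -map_trmx adj.unlock => e; exact: e.
Qed.

Lemma adj_diag n (d : 'rV[C]_n) : adj (diag_mx d) = diag_mx (map_mx Num.conj d).
Proof. by rewrite adj.unlock map_diag_mx tr_diag_mx. Qed.

Lemma conj_diag_inv n (Q : 'M[C]_n) d : Q \is unitarymx ->
  Q *m (adj Q *m d *m Q) *m adj Q = d.
Proof.
by move=> /unitary_adj h; rewrite !mulmxA h mul1mx -mulmxA h mulmx1.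
Qed.

Lemma cis0 : cis (0 : R) = 1.
Proof. by rewrite /cis cos0 sin0. Qed.

Lemma cisD (s t : R) : cis (s + t) = cis s * cis t.
Proof.
by apply: complex_ext; rewrite ?cReM ?cImM /= ?cosD ?sinD // addrC.
Qed.

Lemma cisN (t : R) : cis (- t) = Num.conj (cis t).
Proof. by rewrite conjcE /cis cosN sinN. Qed.

Lemma is_derive_comp_scale (f : R -> R) (a t df : R) :
  is_derive (a * t) 1 f df -> is_derive t 1 (fun s => f (a * s)) (a * df).
Proof.
move=> h.
have h1 : is_derive t 1 (fun s : R => a * s) a.
  have := @is_deriveZ _ _ _ id a t 1 1 (is_derive_id _ _).
  by rewrite /GRing.scale /= mulr1.
by have := is_derive1_comp h h1; rewrite mulrC.
Qed.

Lemma cderiv_cis (a t : R) : cderiv (fun s => cis (a * s)) t ((a *i) * cis (a * t)).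
Proof.
split.
- apply: (is_derive_eq (is_derive_comp_scale (is_derive_cos _))).
  by rewrite cReM /= mul0r sub0r mulrN.
- apply: (is_derive_eq (is_derive_comp_scale (is_derive_sin _))).
  by rewrite cImM /= mul0r add0r.
Qed.

Lemma mderiv_rot n (Q : 'M[C]_n) th t : Q \is unitarymx ->
  mderiv (rot Q th) t (rot Q th t *m rot_gen Q th).
Proof.
move=> hQ; have -> : rot Q th t *m rot_gen Q th =
   adj Q *m diag_mx (\row_j (((th 0 j) *i) * cis (th 0 j * t))) *m Q.
  rewrite rot.unlock rot_gen.unlock !mulmxA (mulUadjK _ hQ).
  congr (_ *m _); rewrite -mulmxA mulmx_diag; congr (_ *m diag_mx _).
  by apply/rowP=> j; rewrite !mxE mulrC.
have -> : rot Q th = fun s => adj Q *m diag_mx (\row_j cis (th 0 j * s)) *m Q.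
  by rewrite rot.unlock.
apply: mderivMr; apply: mderivMl => i j; rewrite !mxE.
have [->|ij] := eqVneq i j.
  by under eq_fun do rewrite !mxE eqxx mulr1n; rewrite mulr1n; exact: cderiv_cis.
under eq_fun do rewrite !mxE (negbTE ij) mulr0n.
by rewrite mulr0n; exact: cderiv_cst.
Qed.

Lemma rot0 n (Q : 'M[C]_n) th : Q \is unitarymx -> rot Q th 0 = 1%:M.
Proof.
move=> hQ; rewrite rot.unlock (_ : diag_mx _ = 1%:M) ?mulmx1 ?adj_unitary//.
by apply/matrixP => i j; rewrite !mxE mulr0 cis0.
Qed.

Lemma rot_add n (Q : 'M[C]_n) th s t : Q \is unitarymx ->
  rot Q th (s + t) = rot Q th s *m rot Q th t.
Proof.
move=> hQ; rewrite rot.unlock !mulmxA (mulUadjK _ hQ).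
congr (_ *m _); rewrite -mulmxA mulmx_diag; congr (_ *m diag_mx _).
by apply/rowP=> j; rewrite !mxE mulrDr cisD.
Qed.

Lemma adj_rot n (Q : 'M[C]_n) th t : adj (rot Q th t) = rot Q th (- t).
Proof.
rewrite rot.unlock !adjM adjK adj_diag mulmxA; congr (_ *m diag_mx _ *m _).
by apply/rowP=> j; rewrite !mxE mulrN cisN.
Qed.

Lemma adj_rot_gen n (Q : 'M[C]_n) th : adj (rot_gen Q th) = - rot_gen Q th.
Proof.
rewrite rot_gen.unlock !adjM adjK adj_diag mulmxA -mulNmx -mulmxN; congr (_ *m _ *m _).
by apply/matrixP=> i j; rewrite !mxE conjcE -mulNrn; congr (_ *+ _); apply: complex_ext; rewrite /= ?oppr0.
Qed.

Lemma rot_gen_comm n (Q : 'M[C]_n) th t : Q \is unitarymx ->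
  rot_gen Q th *m rot Q th t = rot Q th t *m rot_gen Q th.
Proof.
move=> hQ; rewrite rot.unlock rot_gen.unlock !mulmxA !(mulUadjK _ hQ).
congr (_ *m _); rewrite -!mulmxA !mulmx_diag; congr (_ *m diag_mx _).
by apply/rowP=> j; rewrite !mxE mulrC.
Qed.

Lemma skew_decomposition n (B : 'M[C]_n) : adj B = - B ->
  exists2 Q : 'M[C]_n, Q \is unitarymx & exists th, B = rot_gen Q th.
Proof.
move=> hB; have [|Q hQ [d Bd]] := @spectral_decomposition n B.
  by rewrite hB mulmxN mulNmx.
exists Q => //; exists (map_mx (@complex.Im R) d); rewrite rot_gen.unlock [LHS]Bd.
congr (_ *m diag_mx _ *m _); apply/rowP => j; rewrite !mxE.
have : adj (diag_mx d) = - diag_mx d.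
  by rewrite -(conj_diag_inv (diag_mx d) hQ) -Bd !adjM adjK hB mulmxA mulmxN mulNmx.
rewrite adj_diag => /matrixP/(_ j j); rewrite !mxE eqxx !mulr1n conjcE.
case: (d 0 j) => a b /= [ha]; apply: complex_ext => //=.
by move: ha; lra.
Qed.

(* [rot_gen Q th] can be diagonalised in many ways; the linear ODE shows that
   [rot Q th] depends on it only. *)
Lemma linear_ode n (Q : 'M[C]_n) th m (Y : R -> 'M[C]_(m, n)) :
  Q \is unitarymx -> (forall t, mderiv Y t (Y t *m rot_gen Q th)) ->
  forall t, Y t = Y 0 *m rot Q th t.
Proof.
move=> hQ hY t.
have hN s : mderiv (fun s => rot Q th (- s)) s (- (rot Q th (- s) *m rot_gen Q th)).
  have := mderiv_adj (mderiv_rot th s hQ).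
  rewrite adjM adj_rot adj_rot_gen mulNmx rot_gen_comm//.
  by under eq_fun do rewrite adj_rot.
have h s : mderiv (fun s => Y s *m rot Q th (- s)) s 0.
  have := mderivM (hY s) (hN s).
  by rewrite mulmxN -mulmxA rot_gen_comm// mulmxA -!mulmxA subrr.
have := mderiv_is_cst h t 0; rewrite oppr0 rot0// mulmx1 => <-.
by rewrite -mulmxA -rot_add// addNr rot0// mulmx1.
Qed.

Lemma smooth_rot n (Q : 'M[C]_n) th (X Y : 'M[C]_n) : Q \is unitarymx ->
  smooth (fun t => X *m rot Q th t *m Y).
Proof.
(* The k-th derivative is X exp(tB) B^k Y. *)
move=> hQ; pose c k t := X *m rot Q th t *m (iter k (mulmx (rot_gen Q th)) Y).
apply: (smooth_seq (c := c)) => k t; rewrite /c iterS mulmxA.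
by apply: mderivMr; rewrite -mulmxA; apply: mderivMl; exact: mderiv_rot.
Qed.

(** exp(tB) M solves Y' = Y B with Y(0) = M, so it is M exp(tB) by uniqueness. The anticommuting and
    the real case below follow in the same way. *)
Lemma rot_intertwine n (Q : 'M[C]_n) th (M : 'M[C]_n) t : Q \is unitarymx ->
  M *m rot_gen Q th = rot_gen Q th *m M -> M *m rot Q th t = rot Q th t *m M.
Proof.
move=> hQ hM; rewrite [RHS](linear_ode (Y := fun t => rot Q th t *m M) (th := th) hQ) ?rot0 ?mul1mx// => s.
by rewrite -mulmxA hM mulmxA; apply: mderivMr; exact: mderiv_rot.
Qed.

Lemma rot_anti_intertwine n (Q : 'M[C]_n) th (M : 'M[C]_n) t : Q \is unitarymx ->
  M *m rot_gen Q th = - (rot_gen Q th *m M) ->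
  M *m rot Q th t = rot Q th (- t) *m M.
Proof.
move=> hQ hM; rewrite [RHS](linear_ode (Y := fun t => rot Q th (- t) *m M) (th := th) hQ) ?oppr0 ?rot0 ?mul1mx// => s.
rewrite -mulmxA hM mulmxN mulmxA -mulNmx; apply: mderivMr.
have := mderiv_adj (mderiv_rot th s hQ).
rewrite adjM adj_rot adj_rot_gen mulNmx rot_gen_comm//.
by under eq_fun do rewrite adj_rot.
Qed.

Lemma rot_tau n (Q : 'M[C]_n) th t : Q \is unitarymx ->
  tau (rot_gen Q th) = rot_gen Q th -> tau (rot Q th t) = rot Q th t.
Proof.
move=> hQ hB; rewrite [LHS](linear_ode (Y := fun t => tau (rot Q th t)) (th := th) hQ).
  by rewrite rot0// {1}/tau map_mx1 mul1mx.
by move=> s; have := mderiv_tau (mderiv_rot th s hQ); rewrite tauM hB.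
Qed.

Lemma rot_unitary n (Q : 'M[C]_n) th t : Q \is unitarymx -> rot Q th t \is unitarymx.
Proof.
by move=> hQ; apply/unitary_adjP; rewrite adj_rot -rot_add// subrr rot0.
Qed.

Lemma rot_gen_sqr n (Q : 'M[C]_n) th : Q \is unitarymx ->
  rot_gen Q th *m rot_gen Q th =
  adj Q *m diag_mx (\row_j (- ((th 0 j)^+2)%:C)) *m Q.
Proof.
move=> hQ; rewrite rot_gen.unlock !mulmxA (mulUadjK _ hQ).
congr (_ *m _); rewrite -mulmxA mulmx_diag; congr (_ *m diag_mx _).
by apply/rowP=> j; rewrite !mxE; apply: complex_ext; rewrite ?cReM ?cImM ?cReN ?cImN /=; ring.
Qed.

Lemma frob_rot_gen n (Q : 'M[C]_n) th : Q \is unitarymx ->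
  frob (rot_gen Q th) (rot_gen Q th) = \sum_j (th 0 j) ^+ 2.
Proof.
move=> hQ; rewrite frob_adj adj_rot_gen mulNmx rot_gen_sqr//.
rewrite -mulNmx -mulmxN -mulmxA mxtrace_mulC -mulmxA unitary_adj// mulmx1.
rewrite /mxtrace cRe_sum; apply: eq_bigr => j _.
by rewrite !mxE eqxx mulr1n opprK.
Qed.

(** cos t = -1 gives cos(t/2) = 0, whereas the cosine is positive on (-pi/2, pi/2). *)
Lemma cis_eqN1 (t : R) : cis t = -1 -> pi ^+ 2 <= t ^+ 2.
Proof.
move=> /(congr1 (@complex.Re R)) /= hc.
have pi0 := pi_gt0 R.
have pi1 := ltW pi0; rewrite -(real_normK (num_real t)) ler_sqr ?nnegrE ?normr_ge0 ?pi1// real_leNgt ?num_real//; apply/negP => h.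
have hh : cos (t / 2) = 0.
  have := cos_mulr2n (t / 2).
  have -> : (t / 2) *+ 2 = t by rewrite -mulr_natr; field.
  rewrite hc => /eqP; rewrite -subr_eq0 => /eqP e.
  have /eqP : cos (t / 2) ^+ 2 *+ 2 = 0 by rewrite -[RHS](subrK 0) -oppr0; move: e; lra.
  by rewrite mulrn_eq0 /= expf_eq0 /= => /eqP.
have := @cos_gt0_pihalf _ (t / 2); rewrite hh ltxx => /(_ _)/negP; apply => //.
by move: h; rewrite ltr_norml => /andP[h1 h2]; apply/andP; split; lra.
Qed.

Lemma cis_surj (z : C) : z * Num.conj z = 1 -> exists t, cis t = z.
Proof.
case: z => a b; rewrite conjcE => /(congr1 (@complex.Re R)); rewrite cReM /= => h.
have h1 : a ^+ 2 + b ^+ 2 = 1 by rewrite -h; ring.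
have ha : -1 <= a <= 1.
  by have := sqr_ge0 a; have := sqr_ge0 b; nra.
have hs : sin (acos a) ^+ 2 = b ^+ 2.
  by rewrite sin2cos2 acosK // -h1; ring.
move/eqP: hs; rewrite eqf_sqr => /orP[/eqP hs|/eqP hs].
  by exists (acos a); rewrite /cis acosK // hs.
by exists (- acos a); rewrite /cis cosN sinN acosK // hs opprK.
Qed.

(** The angle is chosen as a function of the eigenvalue, so that equal eigenvalues get equal angles.
    The logarithm then commutes with everything that commutes with A. *)
Lemma unitary_log n (A : 'M[C]_n) : A \is unitarymx ->
  exists2 Q : 'M[C]_n, Q \is unitarymx & exists2 th, rot Q th 1 = A &
    forall M t, M *m A = A *m M -> M *m rot Q th t = rot Q th t *m M.
Proof.
move=> hA; have [|Q hQ [d Ad]] := @spectral_decomposition n A.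
  by rewrite unitary_adj// adj_unitary.
have hd j : d 0 j * Num.conj (d 0 j) = 1.
  have : diag_mx d *m adj (diag_mx d) = 1%:M.
    rewrite -(conj_diag_inv (diag_mx d) hQ) -Ad !adjM adjK !mulmxA.
    by rewrite -(mulmxA _ (adj Q)) adj_unitary// mulmx1 -(mulmxA Q) unitary_adj// mulmx1 unitary_adj.
  rewrite adj_diag => /matrixP/(_ j j).
  by rewrite mulmx_diag !mxE eqxx !mulr1n.
have [th hth] : exists th : 'I_n -> R, forall j, cis (th j) = d 0 j /\
    forall k, d 0 j = d 0 k -> th j = th k.
  pose f (z : C) : R := xget 0 [set t | cis t = z].
  exists (fun j => f (d 0 j)) => j; split=> [|k ->//].
  by rewrite /f; case: xgetP => //= /(_ _) h; have [t /h] := cis_surj (hd j).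
exists Q => //; exists (\row_j th j) => [|M t hM].
  rewrite Ad rot.unlock; congr (_ *m diag_mx _ *m _).
  by apply/rowP=> j; rewrite !mxE mulr1; have [] := hth j.
apply: rot_intertwine => //.
pose M' := Q *m M *m adj Q.
have e : M = adj Q *m M' *m Q.
  by rewrite /M' !mulmxA adj_unitary// mul1mx -mulmxA adj_unitary// mulmx1.
have h1 : M' *m diag_mx d = diag_mx d *m M'.
  rewrite -(conj_diag_inv (diag_mx d) hQ) -Ad /M' !mulmxA.
  rewrite -(mulmxA _ (adj Q) Q) adj_unitary// mulmx1.
  rewrite -(mulmxA _ (adj Q) Q) adj_unitary// mulmx1.
  by rewrite -(mulmxA Q) hM mulmxA.
clearbody M'.
have h2 : M' *m diag_mx (\row_j (((\row_j th j) 0 j) *i)) =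
          diag_mx (\row_j (((\row_j th j) 0 j) *i)) *m M'.
  apply/matrixP => i j; rewrite mul_mx_diag mul_diag_mx !mxE.
  (* A nonzero entry of M' links equal eigenvalues, hence equal angles. *)
  have /matrixP/(_ i j) := h1; rewrite mul_mx_diag mul_diag_mx !mxE => h3.
  have [->|nz] := eqVneq (M' i j) 0; first by rewrite mul0r mulr0.
  rewrite mulrC; congr (_ *i * _).
  have [_ hk] := hth j; rewrite (hk i)//.
by apply: (mulfI nz); rewrite h3 mulrC.
rewrite {1 2}e rot_gen.unlock !mulmxA (mulUadjK _ hQ).
rewrite -(mulmxA _ Q (adj Q)) unitary_adj// mulmx1.
by rewrite -(mulmxA _ M') h2 !mulmxA.
Qed.

End Exponential.

(** * Continuity and connected components *)

Section Topology.
Context {R : realType}.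
Local Notation C := (R[i]^o).

Section ComplexContinuity.
Variable T : topologicalType.

Lemma continuous_real_complex (f : T -> R) :
  continuous f -> continuous (fun x => (f x)%:C : C).
Proof.
move=> cf x; apply/cvgrPdist_lt => e e0.
have ee : e = (complex.Re e)%:C by rewrite RRe_real// gtr0_real.
have e1 : 0 < complex.Re e by rewrite -ltcR -ee.
have /cvgrPdist_lt/(_ _ e1) := cf x; apply: filterS => y h.
by rewrite ee -rmorphB normc_def /= expr0n addr0 sqrtr_sqr ltcR.
Qed.

Lemma continuous_cRe (f : T -> C) :
  continuous f -> continuous (fun x => complex.Re (f x)).
Proof.
move=> cf x; apply/cvgrPdist_lt => e e0.
have e1 : 0 < e%:C :> R[i] by rewrite ltcR.
have /cvgrPdist_lt/(_ _ e1) := cf x; apply: filterS => y h.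
rewrite -ltcR; apply: le_lt_trans h.
by rewrite -cReN -cReD; exact: normc_ge_Re.
Qed.

Lemma continuous_cst_C (a : C) : continuous (fun _ : T => a).
Proof. by move=> x; exact: cvg_cst. Qed.

Lemma continuous_addC (f g : T -> C) :
  continuous f -> continuous g -> continuous (fun x => f x + g x).
Proof. by move=> cf cg x; exact: cvgD (cf x) (cg x). Qed.

Lemma continuous_mulC (f g : T -> C) :
  continuous f -> continuous g -> continuous (fun x => f x * g x).
Proof. by move=> cf cg x; exact: cvgM (cf x) (cg x). Qed.

Lemma continuous_cIm (f : T -> C) :
  continuous f -> continuous (fun x => complex.Im (f x)).
Proof.
move=> cf; have -> : (fun x => complex.Im (f x)) = (fun x => complex.Re (- 'i * f x : C)).
  by apply/funext => x; rewrite cReM /= oppr0 mul0r sub0r mulN1r opprK.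
by apply: continuous_cRe; apply: continuous_mulC; [exact: continuous_cst_C|].
Qed.

Lemma continuous_sumC (I : Type) (r : seq I) (P : pred I) (f : I -> T -> C) :
  (forall i, continuous (f i)) -> continuous (fun x => \sum_(i <- r | P i) f i x).
Proof.
move=> cf; elim: r => [|i r IH].
  by under eq_fun do rewrite big_nil; exact: continuous_cst_C.
under eq_fun do rewrite big_cons.
by case: (P i); [exact: continuous_addC (cf i) IH | exact: IH].
Qed.

Lemma continuous_prodC (I : Type) (r : seq I) (P : pred I) (f : I -> T -> C) :
  (forall i, continuous (f i)) -> continuous (fun x => \prod_(i <- r | P i) f i x).
Proof.
move=> cf; elim: r => [|i r IH].
  by under eq_fun do rewrite big_nil; exact: continuous_cst_C.
under eq_fun do rewrite big_cons.
by case: (P i); [exact: continuous_mulC (cf i) IH | exact: IH].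
Qed.

Lemma continuous_conjC (f : T -> C) :
  continuous f -> continuous (fun x => Num.conj (f x : R[i]) : C).
Proof.
move=> cf x; apply/cvgrPdist_lt => e e0.
have /cvgrPdist_lt/(_ _ e0) := cf x; apply: filterS => y h.
by rewrite -rmorphB norm_conjC.
Qed.

Lemma continuous_entries N (F : T -> 'M[C]_N) :
  (forall i j, continuous (fun x => F x i j)) -> continuous F.
Proof.
move=> h x A [B /= hB hBA].
have : \forall y \near x, forall i j, B i j (F y i j).
  apply: filter_forall => i; apply: filter_forall => j.
  exact: h (hB i j).
by apply: filterS => y hy; exact: hBA.
Qed.

End ComplexContinuity.

Lemma continuous_coord N (i j : 'I_N) : continuous (fun M : 'M[C]_N => M i j).
Proof. exact: (@coord_continuous R[i] N N i j). Qed.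

Lemma continuous_tau N : continuous (fun M : 'M[C]_N => tau M : 'M[C]_N).
Proof.
apply: continuous_entries => i j; under eq_fun do rewrite mxE.
by apply: continuous_conjC; exact: continuous_coord.
Qed.

Lemma continuous_det N : continuous (fun M : 'M[C]_N => \det (M : 'M[R[i]]_N) : C).
Proof.
apply: continuous_sumC => s; apply: continuous_mulC; first exact: continuous_cst_C.
by apply: continuous_prodC => i; exact: continuous_coord.
Qed.

Lemma continuous_trace_mul N (A : 'M[R[i]]_N) :
  continuous (fun M : 'M[C]_N => \tr (A *m (M : 'M[R[i]]_N)) : C).
Proof.
apply: continuous_sumC => i; under eq_fun do rewrite mxE.
apply: continuous_sumC => j; apply: continuous_mulC; first exact: continuous_cst_C.
exact: continuous_coord.
Qed.

Lemma component_sub N (A : set 'M[R[i]]_N) x : component A x `<=` A.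
Proof. exact: (@connected_component_sub 'M[C]_N). Qed.

Lemma component_refl N (A : set 'M[R[i]]_N) x : A x -> component A x x.
Proof. exact: (@connected_component_refl 'M[C]_N). Qed.

Lemma component_sym N (A : set 'M[R[i]]_N) x y :
  component A x y -> component A y x.
Proof. exact: (@connected_component_sym 'M[C]_N). Qed.

Lemma component_trans N (A : set 'M[R[i]]_N) y x z :
  component A x y -> component A y z -> component A x z.
Proof. exact: (@connected_component_trans 'M[C]_N). Qed.

Lemma component_eq N (A : set 'M[R[i]]_N) x y :
  component A x y -> component A x = component A y.
Proof. exact: (@same_connected_component 'M[C]_N). Qed.

Lemma component_mem N (A : set 'M[R[i]]_N) x y : component A x y -> A x.
Proof. by move/component_sym/component_sub. Qed.

Lemma component_connected N (A : set 'M[R[i]]_N) x :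
  @connected 'M[C]_N (component A x).
Proof. exact: (@topology_theory.connected.component_connected 'M[C]_N). Qed.

Lemma component_image N (A B : set 'M[R[i]]_N) (f : 'M[R[i]]_N -> 'M[R[i]]_N) x :
  continuous (f : 'M[C]_N -> 'M[C]_N) -> (forall y, A y -> B (f y)) ->
  forall y, component A x y -> component B (f x) (f y).
Proof.
move=> cf hf y hy.
have hc : @connected 'M[C]_N (f @` component A x).
  apply: (@connected_continuous_connected 'M[C]_N 'M[C]_N _ f (@component_connected N A x)).
  exact: continuous_subspaceT.
have hx : (f @` component A x) (f x).
  by exists x => //; exact: component_refl (component_mem hy).
have hs : f @` component A x `<=` B.
  by move=> _ [z /component_sub hz <-]; exact: hf.
by apply: (@connected_component_max 'M[C]_N _ _ _ hx hs hc); exists y.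
Qed.

Lemma component_mono N (A B : set 'M[R[i]]_N) x :
  A `<=` B -> component A x `<=` component B x.
Proof.
by move=> AB y; apply: (component_image (f := id)) => // z; exact: cvg_id.
Qed.

Lemma component_component N (A : set 'M[R[i]]_N) x : component (component A x) x = component A x.
Proof.
apply/seteqP; split; first exact: component_sub.
move=> y hy; have hx := component_refl (component_mem hy).
by apply: (@connected_component_max 'M[C]_N _ _ _ hx (@subset_refl _ _) (@component_connected N A x)).
Qed.

Lemma continuous_curve N (c : R -> 'M[R[i]]_N) :
  (forall t, exists V, mderiv c t V) -> continuous (c : R -> 'M[C]_N).
Proof.
move=> h; apply: continuous_entries => i j.
have cR : continuous (fun t => complex.Re (c t i j)).
  move=> t; have [V hV] := h t; have [[d1 _] _] := hV i j.
  exact: differentiable_continuous (iffLR (derivable1_diffP _ _) d1).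
have cI : continuous (fun t => complex.Im (c t i j)).
  move=> t; have [V hV] := h t; have [_ [d1 _]] := hV i j.
  exact: differentiable_continuous (iffLR (derivable1_diffP _ _) d1).
have -> : (fun t => c t i j : C) = (fun t => (complex.Re (c t i j))%:C +
     'i%C * (complex.Im (c t i j))%:C : C).
  by apply/funext => t; rewrite -complexE.
apply: continuous_addC; first exact: continuous_real_complex.
by apply: continuous_mulC; [exact: continuous_cst_C|exact: continuous_real_complex].
Qed.

Lemma component_curve N (A : set 'M[R[i]]_N) (c : R -> 'M[R[i]]_N) :
  (forall t, exists V, mderiv c t V) -> (forall t, A (c t)) ->
  forall s t, component A (c s) (c t).
Proof.
move=> hc hA s t.
have cT : connected [set: R] by apply/connected_intervalP => ? ? ? ? ? ?.
have hcc : @connected 'M[C]_N (c @` [set: R]).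
  apply: (@connected_continuous_connected R 'M[C]_N _ c cT).
  by apply: continuous_subspaceT; exact: continuous_curve.
have hs : c @` [set: R] `<=` A by move=> _ [u _ <-].
have h1 : (c @` [set: R]) (c s) by exists s.
by apply: (@connected_component_max 'M[C]_N _ _ _ h1 hs hcc); exists t.
Qed.

(** The image of the component is an interval; two integer values p < q would put p + 1/2 into
    it. *)
Lemma integer_valued_is_cst N (A : set 'M[R[i]]_N) (f : 'M[C]_N -> R) x :
  continuous f -> (forall y, A y -> exists z : int, f y = z%:~R) ->
  forall y, component A x y -> f y = f x.
Proof.
move=> cf hf y hy.
have hc : connected (f @` (component A x : set 'M[C]_N)).
  apply: (@connected_continuous_connected 'M[C]_N R _ f (@component_connected N A x)).
  exact: continuous_subspaceT.
move/connected_intervalP : hc => hi.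
have key a b : component A x a -> component A x b -> ~ (f a < f b).
  move=> ha hb.
  have [p hp] := hf _ (component_sub ha); have [q hq] := hf _ (component_sub hb).
  rewrite hp hq ltr_int => pq.
  have : (f @` (component A x : set 'M[C]_N)) (p%:~R + 2^-1).
    apply: (hi (f a) (f b)); [by exists a|by exists b|].
    rewrite hp hq; apply/andP; split; first by rewrite lerDl.
    apply: (@le_trans _ _ ((p + 1)%:~R)); last by rewrite ler_int lezD1.
    by rewrite intrD lerD2l; lra.
  move=> [d hd]; have [r ->] := hf _ (component_sub hd).
  move=> e; have /eqP : (r - p)%:~R * 2%:~R = 1%:~R :> R.
    by rewrite intrB e; field.
  rewrite -intrM eqr_int => /eqP h.
  have : (2 %| 1)%Z by apply/dvdzP; exists (r - p); rewrite h.
  by [].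
have hx := component_refl (component_mem hy).
apply/eqP; rewrite eq_le !leNgt; apply/andP; split; apply/negP; exact: key.
Qed.

End Topology.

(** * Tangent spaces and geodesics of the components of Cl_k *)

Section Geodesics.
Context {R : realType} {N : nat}.
Local Notation M := 'M[R[i]]_N.

Lemma tr_adj (A : M) : \tr (adj A) = Num.conj (\tr A).
Proof.
rewrite adj.unlock mxtrace_tr /mxtrace rmorph_sum /=.
by apply: eq_bigr => i _; rewrite mxE.
Qed.

(** The conjugate of tr(H S) is the trace of its adjoint -S H, so tr(H S) is purely imaginary. *)
Lemma Re_tr_herm_skew (H S : M) : adj H = H -> adj S = - S ->
  complex.Re (\tr (H *m S)) = 0.
Proof.
move=> hH hS; have := tr_adj (H *m S).
rewrite adjM hH hS mulNmx raddfN /= mxtrace_mulC => /(congr1 (@complex.Re R)).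
by rewrite cRe_conj cReN; lra.
Qed.

Lemma frobE (V W : M) : frob V W = \sum_i \sum_j
  (complex.Re (V j i) * complex.Re (W j i) + complex.Im (V j i) * complex.Im (W j i)).
Proof.
rewrite frob_adj adj.unlock /mxtrace cRe_sum; apply: eq_bigr => i _.
rewrite mxE cRe_sum; apply: eq_bigr => j _.
by rewrite !mxE cReM cRe_conj cIm_conj; ring.
Qed.

Lemma frob_eq0 (V : M) : frob V V = 0 -> V = 0.
Proof.
rewrite frobE => h; apply/matrixP => i j; rewrite mxE.
have h1 i0 j0 : 0 <= complex.Re (V j0 i0) * complex.Re (V j0 i0) +
    complex.Im (V j0 i0) * complex.Im (V j0 i0).
  by rewrite addr_ge0// -expr2 sqr_ge0.
have h2 i0 : 0 <= \sum_j0 (complex.Re (V j0 i0) * complex.Re (V j0 i0) +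
    complex.Im (V j0 i0) * complex.Im (V j0 i0)) by apply: sumr_ge0 => j0 _.
have h3 : \sum_j0 (complex.Re (V j0 j) * complex.Re (V j0 j) +
    complex.Im (V j0 j) * complex.Im (V j0 j)) = 0.
  by apply: (psumr_eq0P (P := predT) (F := fun i0 => \sum_j0 _) _ h).
have h4 := psumr_eq0P (P := predT) (F := fun j0 => complex.Re (V j0 j) * complex.Re (V j0 j) +
    complex.Im (V j0 j) * complex.Im (V j0 j)) (fun j0 _ => h1 j j0) h3 (i := i) isT.
by apply: complex_ext => /=; apply/eqP; rewrite -sqrf_eq0; apply/eqP; move: h4; nra.
Qed.

Lemma frob_unitary (X A B : M) : X \is unitarymx -> frob (X *m A) (X *m B) = frob A B.
Proof.
move=> hX; rewrite !frob_adj adjM -mulmxA (mulmxA (adj X)).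
by rewrite adj_unitary// mul1mx.
Qed.

Lemma tauK (X : M) : tau (tau X) = X.
Proof. by apply/matrixP=> i j; rewrite !mxE conjCK. Qed.

Lemma tauN (X : M) : tau (- X) = - tau X.
Proof. by rewrite /tau map_mxN. Qed.

(** The flag b selects the real part of Cl_k, so that both chains share one development. The index 0
    is left out because nothing invertible anticommutes with J_0 = 1; the equation X^2 = -1 takes
    its place. *)
Definition cliff (b : bool) (J : nat -> M) (k : nat) : set M :=
  [set X | [/\ X \is unitarymx,
               (0 < k)%N -> X *m X = - 1%:M,
               forall i, (0 < i < k)%N -> X *m J i = - (J i *m X) &
               b -> tau X = X]].

(* The tangent space of [cliff b J k] at x is [x *m B] for these B. *)
Definition gen (b : bool) (J : nat -> M) (k : nat) (x B : M) : Prop :=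
  [/\ adj B = - B,
      (0 < k)%N -> B *m x = - (x *m B),
      forall i, (0 < i < k)%N -> B *m J i = J i *m B &
      b -> tau B = B].

Variables (b : bool) (J : nat -> M) (k : nat).
Local Notation K := (cliff b J k).

Lemma unitaryM (X Y : M) : X \is unitarymx -> Y \is unitarymx -> X *m Y \is unitarymx.
Proof. exact: mul_unitarymx. Qed.

Lemma adj_sqrN1 (X : M) : X \is unitarymx -> X *m X = - 1%:M -> adj X = - X.
Proof.
move=> hX h; rewrite -[LHS]mulmx1 -[1%:M]opprK -h mulmxN mulmxA adj_unitary//.
by rewrite mul1mx.
Qed.

(** As B anticommutes with x, the square of x exp(tB) is x^2 exp(-tB) exp(tB) = -1. The other
    equations persist because B commutes with the J_i and is real if b. *)
Lemma cliff_rot x Q th t : Q \is unitarymx -> K x -> gen b J k x (rot_gen Q th) ->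
  K (x *m rot Q th t).
Proof.
move=> hQ [x1 x2 x3 x4] [g1 g2 g3 g4]; split.
- exact: unitaryM x1 (rot_unitary th t hQ).
- move=> k0; have hx : x *m rot_gen Q th = - (rot_gen Q th *m x).
    by rewrite g2// opprK.
  rewrite mulmxA -[x *m _ *m x]mulmxA.
  have -> : rot Q th t *m x = x *m rot Q th (- t).
    by rewrite (rot_anti_intertwine _ hQ hx) opprK.
  by rewrite mulmxA (x2 k0) -mulmxA -(rot_add _ _ _ hQ) addNr (rot0 _ hQ) mulmx1.
- move=> i hi; rewrite -(mulmxA x) -(rot_intertwine t hQ (esym (g3 i hi))).
  by rewrite (mulmxA x) (x3 i hi) mulNmx mulmxA.
- by move=> hb; rewrite tauM (x4 hb) (rot_tau _ hQ (g4 hb)).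
Qed.

Variable x0 : M.
Local Notation P := (component K x0).

Lemma cliff_rot_component x Q th t : Q \is unitarymx -> P x ->
  gen b J k x (rot_gen Q th) -> P (x *m rot Q th t).
Proof.
move=> hQ hx hg; apply: (component_trans hx).
rewrite -[x in component _ x]mulmx1 -(rot0 th hQ).
apply: (component_curve (c := fun t => x *m rot Q th t)) => s; last first.
  exact: (cliff_rot s hQ (component_sub hx) hg).
by exists (x *m (rot Q th s *m rot_gen Q th)); apply: mderivMl; exact: mderiv_rot.
Qed.

(** Each condition in [gen] comes from differentiating the corresponding equation of Cl_k along
    c. *)
Lemma curve_gen (c : R -> M) t V : (forall s, P (c s)) -> mderiv c t V ->
  gen b J k (c t) (adj (c t) *m V).
Proof.
move=> hc hV.
have hK s := component_sub (hc s).
have e1 : adj V *m c t + adj (c t) *m V = 0.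
  apply: (mderiv_unique (c := fun s => adj (c s) *m c s)).
    exact: mderivM (mderiv_adj hV) hV.
  have -> : (fun s => adj (c s) *m c s) = fun _ => 1%:M.
    by apply/funext => s; rewrite adj_unitary//; case: (hK s).
  exact: mderiv_cst.
have e2 : (0 < k)%N -> V *m c t + c t *m V = 0.
  move=> k0; apply: (mderiv_unique (c := fun s => c s *m c s)).
    exact: (mderivM hV hV).
  have -> : (fun s => c s *m c s) = fun _ => - 1%:M.
    by apply/funext => s; case: (hK s) => _ ->.
  exact: mderiv_cst.
have e3 i : (0 < i < k)%N -> V *m J i = - (J i *m V).
  move=> hi; apply: (mderiv_unique (c := fun s => c s *m J i)).
    exact: mderivMr hV.
  have -> : (fun s => c s *m J i) = fun s => - (J i *m c s).
    by apply/funext => s; case: (hK s) => _ _ ->.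
  by apply: mderivN; exact: mderivMl.
have e4 : b -> tau V = V.
  move=> hb; apply: (mderiv_unique (c := fun s => tau (c s))).
    exact: mderiv_tau hV.
  have -> // : (fun s => tau (c s)) = c.
    by apply/funext => s; case: (hK s) => _ _ _ ->.
have [c1 c2 c3 c4] := hK t.
have ca : (0 < k)%N -> adj (c t) = - c t by move=> k0; rewrite adj_sqrN1// c2.
split.
- by rewrite adjM adjK; apply/eqP; rewrite -addr_eq0 e1.
- move=> k0; rewrite ca// !mulNmx mulmxN opprK -mulmxA.
  have -> : V *m c t = - (c t *m V) by apply/eqP; rewrite -addr_eq0 e2.
  by rewrite mulmxN opprK mulmxA.
- move=> i /andP[i0 ik]; have k0 : (0 < k)%N := leq_ltn_trans (leq0n i) ik.
  rewrite (ca k0) !mulNmx mulmxN -(mulmxA (c t)) e3 ?i0// mulmxN (mulmxA (c t)) c3 ?i0//.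
  by rewrite mulNmx opprK mulmxA.
- by move=> hb; rewrite tauM conj_adj c4// e4.
Qed.

(** Conversely, x exp(tB) stays in the component and has velocity x B at 0, so every generator is
    attained. *)
Lemma tangentP x v : P x -> tangent P x v <-> gen b J k x (adj x *m v).
Proof.
move=> hx; split.
  move=> [c [sc hc c0 cv]]; rewrite -c0.
  by apply: curve_gen => //; rewrite -cv; exact: smooth_mderiv.
move=> hg; have [Q hQ [th e]] := skew_decomposition (let: And4 h _ _ _ := hg in h).
have xU : x \is unitarymx by case: (component_sub hx).
exists (fun t => x *m rot Q th t); split.
- have := smooth_rot th x 1%:M hQ.
  by under eq_fun do rewrite mulmx1.
- by move=> t; apply: (cliff_rot_component t hQ hx); rewrite -e.
- by rewrite rot0// mulmx1.
- have := mderivMl x (mderiv_rot th 0 hQ); rewrite -e rot0// mul1mx mulmxA.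
  by rewrite unitary_adj// mul1mx => /mderiv_velocity.
Qed.

Lemma velocity_rot (x Q : M) th : Q \is unitarymx ->
  velocity (fun t => x *m rot Q th t) = (fun t => x *m rot Q th t *m rot_gen Q th).
Proof.
move=> hQ; apply/funext => t; apply: mderiv_velocity; rewrite -mulmxA.
by apply: mderivMl; exact: mderiv_rot.
Qed.

(** The acceleration at c is c B^2 with B^2 Hermitian, while the tangent vectors are c times
    skew-Hermitian matrices. *)
Lemma geodesic_rot x Q th : Q \is unitarymx -> P x -> gen b J k x (rot_gen Q th) ->
  geodesic P (fun t => x *m rot Q th t).
Proof.
move=> hQ hx hg.
have hc t : P (x *m rot Q th t) by exact: cliff_rot_component.
split => //.
  have := smooth_rot th x 1%:M hQ.
  by under eq_fun do rewrite mulmx1.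
move=> t v /(tangentP _ (hc t)) [hv _ _ _]; rewrite velocity_rot//.
have -> : velocity (fun t0 => x *m rot Q th t0 *m rot_gen Q th) t =
    x *m rot Q th t *m (rot_gen Q th *m rot_gen Q th).
  apply: mderiv_velocity; rewrite mulmxA; apply: mderivMr; rewrite -mulmxA.
  by apply: mderivMl; exact: mderiv_rot.
rewrite frob_adj adjM -mulmxA; apply: Re_tr_herm_skew => //.
by rewrite adjK adjM adj_rot_gen mulmxN mulNmx opprK.
Qed.

(* For a geodesic c, put [B = c^* c']. As [c'' = c (B' + B^2)] is normal and
   [c B'] is tangent, [|B'|^2 = <B' + B^2, B'> = 0] because [B^2] is Hermitian
   and [B'] is skew. *)
Lemma geodesic_is_rot c : geodesic P c -> exists2 Q : M, Q \is unitarymx &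
  exists2 th, gen b J k (c 0) (rot_gen Q th) & forall t, c t = c 0 *m rot Q th t.
Proof.
move=> [sc hc hn].
pose V := velocity c; pose V' := velocity V.
have dV t : mderiv c t (V t) := smooth_mderiv t sc.
have dV' t : mderiv V t (V' t) := smooth_mderiv2 t sc.
have hK t := component_sub (hc t).
pose B t := adj (c t) *m V t.
pose B' t := adj (V t) *m V t + adj (c t) *m V' t.
have dB t : mderiv B t (B' t) := mderivM (mderiv_adj (dV t)) (dV' t).
have hB t : gen b J k (c t) (B t) := curve_gen hc (dV t).
have cU t : c t \is unitarymx by case: (hK t).
have Ve t : V t = c t *m B t by rewrite /B mulmxA unitary_adj// mul1mx.
have skB' t : adj (B' t) = - B' t.
  apply: (mderiv_unique (c := fun s => adj (B s))); first exact: mderiv_adj.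
  have -> : (fun s => adj (B s)) = fun s => - B s.
    by apply/funext => s; case: (hB s).
  exact: mderivN.
have V'e t : adj (c t) *m V' t = B' t + B t *m B t.
  rewrite /B' Ve adjM; case: (hB t) => -> _ _ _.
  by rewrite !mulNmx mulmxA -(mulmxA (B t)) adj_unitary// mulmx1 addrAC addNr add0r.
have hgB' t : gen b J k (c t) (B' t).
  split => //.
  - move=> k0.
    have h0 s : B s *m c s = - (c s *m B s) by case: (hB s) => _ ->.
    have h1 := mderivM (dB t) (dV t).
    have h2 := mderivN (mderivM (dV t) (dB t)).
    have h3 : (fun s => B s *m c s) = (fun s => - (c s *m B s)).
      by apply/funext => s.
    rewrite h3 in h1; have := mderiv_unique h1 h2.
    (* As c' = c B and B anticommutes with c, the terms that contain c' cancel and B' c = -c B'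
       remains. *)
    have -> : V t *m B t = - (B t *m V t).
      by rewrite Ve mulmxA h0 mulNmx opprK.
    by rewrite opprD opprK addrC => /addrI.
  - move=> i hi; apply: (mderiv_unique (c := fun s => B s *m J i)).
      exact: mderivMr.
    have -> : (fun s => B s *m J i) = fun s => J i *m B s.
      by apply/funext => s; case: (hB s) => _ _ ->.
    exact: mderivMl.
  - move=> hb; apply: (mderiv_unique (c := fun s => tau (B s))).
      exact: mderiv_tau.
    have -> // : (fun s => tau (B s)) = B.
      by apply/funext => s; case: (hB s) => _ _ _ ->.
have B'0 t : B' t = 0.
  have ht : tangent P (c t) (c t *m B' t).
    by apply/tangentP => //; rewrite mulmxA adj_unitary// mul1mx.
  have := hn t _ ht; rewrite -/V -/V' frob_adj mulmxA.
  have -> : adj (V' t) *m c t = adj (B' t + B t *m B t).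
    by rewrite -V'e adjM adjK.
  have [sB _ _ _] := hB t.
  rewrite adjD mulmxDl mxtraceD cReD -frob_adj.
  rewrite Re_tr_herm_skew//; last by rewrite adjK adjM sB mulmxN mulNmx opprK.
  by rewrite addr0; exact: frob_eq0.
have Bc t : B t = B 0 by apply: mderiv_is_cst => s; rewrite -(B'0 s).
have [sB _ _ _] := hB 0.
have [Q hQ [th e]] := skew_decomposition sB.
exists Q => //; exists th; first by rewrite -e; exact: hB.
by apply: linear_ode => // t; rewrite -e -(Bc t) -Ve.
Qed.

Lemma length_rot (x Q : M) th : Q \is unitarymx -> x \is unitarymx ->
  curve_length (fun t => x *m rot Q th t) = (Num.sqrt (\sum_j (th 0 j) ^+ 2))%:E.
Proof.
move=> hQ hx; rewrite /curve_length velocity_rot//.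
have h t : frob (x *m rot Q th t *m rot_gen Q th) (x *m rot Q th t *m rot_gen Q th)
    = \sum_j (th 0 j) ^+ 2.
  by rewrite -(frob_rot_gen th hQ) (frob_unitary _ _ (unitaryM hx (rot_unitary th t hQ))).
under eq_integral do rewrite h.
rewrite integral_cst//= lebesgue_measure_itv/= lte_fin ltr01 -EFinB subr0 mule1 //.
Qed.

End Geodesics.

(** * Shortest geodesics from J_k to -J_k *)

Section Arcs.
Context {R : realType} {N : nat}.
Local Notation M := 'M[R[i]]_N.

Definition arc (x y : M) (t : R) : M :=
  (cos (pi * t))%:C *: x + (sin (pi * t))%:C *: y.

Lemma arc0 x y : arc x y 0 = x.
Proof. by rewrite /arc mulr0 cos0 sin0 scale1r scale0r addr0. Qed.

Lemma arc1 x y : arc x y 1 = - x.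
Proof. by rewrite /arc mulr1 cospi sinpi scale0r addr0 rmorphN1 scaleN1r. Qed.

Lemma arc_half x y : arc x y 2^-1 = y.
Proof. by rewrite /arc cos_pihalf sin_pihalf scale0r add0r scale1r. Qed.

Lemma mul_arc (A x y : M) t : A *m arc x y t = arc (A *m x) (A *m y) t.
Proof. by rewrite /arc mulmxDr -!scalemxAr. Qed.

Lemma mderiv_arc x y t :
  mderiv (arc x y) t (pi%:C *: ((cos (pi * t))%:C *: y - (sin (pi * t))%:C *: x)).
Proof.
move=> i j; rewrite !mxE; under eq_fun do rewrite !mxE.
have hc : cderiv (fun s => (cos (pi * s))%:C) t ((- (pi * sin (pi * t)))%:C).
  split; last exact: is_derive_cst.
  apply: (is_derive_eq (is_derive_comp_scale (is_derive_cos _))).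
  by rewrite mulrN.
have hs : cderiv (fun s => (sin (pi * s))%:C) t ((pi * cos (pi * t))%:C).
  split; last exact: is_derive_cst.
  exact: (is_derive_comp_scale (is_derive_sin _)).
have := cderivD (cderivM hc (cderiv_cst (x i j) t)) (cderivM hs (cderiv_cst (y i j) t)).
rewrite !mulr0 !addr0; congr cderiv.
by rewrite !rmorphN !rmorphM /=; ring.
Qed.

(** Euler's formula: as Z^2 = -1, both sides solve Y' = pi Y Z. *)
Lemma rot_arc (Q Z : M) th t : Q \is unitarymx -> rot_gen Q th = pi%:C *: Z ->
  Z *m Z = - 1%:M -> rot Q th t = arc 1%:M Z t.
Proof.
move=> hQ e hZ; rewrite (linear_ode (Y := arc 1%:M Z) (th := th) hQ).
  by rewrite arc0 mul1mx.
move=> s; have := mderiv_arc 1%:M Z s; rewrite e -scalemxAr {3}/arc.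
rewrite mulmxDl -!scalemxAl mul1mx hZ scalerN; exact.
Qed.

Lemma cliffS b (J : nat -> M) k y : cliff b J k.+1 y <->
  [/\ cliff b J k y, y *m y = - 1%:M & (0 < k)%N -> y *m J k = - (J k *m y)].
Proof.
split.
  move=> [y1 y2 y3 y4]; split; [|exact: y2|].
  - split=> // [_|i /andP[i0 ik]]; [exact: y2|apply: y3].
    by rewrite i0 ltnW.
  - by move=> k0; apply: y3; rewrite k0 leqnn.
move=> [[y1 y2 y3 y4] y5 y6]; split=> // i /andP[i0].
rewrite ltnS leq_eqVlt => /orP[/eqP e|ik]; first by rewrite e in i0 *; exact: y6.
by apply: y3; rewrite i0.
Qed.

Lemma adjCZ (a : R) (A : M) : adj (a%:C *: A) = a%:C *: adj A.
Proof. by rewrite adjZ conjcE conjc_real. Qed.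

Lemma tauCZ (a : R) (A : M) : tau (a%:C *: A) = a%:C *: tau A.
Proof. by rewrite /tau map_mxZ /= conjcE conjc_real. Qed.

Variables (b : bool) (J : nat -> M) (k : nat).
Local Notation K := (cliff b J k).
Local Notation P := (component (cliff b J k) (J k)).

Hypothesis JK : cliff b J k (J k).
Hypothesis J0 : J 0%N = 1%:M.

Lemma J_unitary : J k \is unitarymx.
Proof. by case: JK. Qed.

Lemma adj_J : (0 < k)%N -> adj (J k) = - J k.
Proof. by move=> k0; apply: adj_sqrN1; [exact: J_unitary|case: JK => _ ->]. Qed.

(** The arc through y is J_k exp(pi t Z) with Z = [adj (J k) *m y], and this makes pi Z an
    admissible generator. The case k = 0 stands apart because J_0 = 1 is Hermitian and the later J_k
    are skew. *)
Lemma cliffS_gen (a : R) y : cliff b J k.+1 y -> gen b J k (J k) (a%:C *: (adj (J k) *m y)).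
Proof.
move=> /cliffS [[y1 y2 y3 y4] y5 y6]; have [x1 x2 x3 x4] := JK.
have ya := adj_sqrN1 y1 y5.
split.
- rewrite adjCZ adjM adjK ya mulNmx scalerN; congr (- (_ *: _)).
  have [k0|k0] := posnP k; first by rewrite k0 J0 mulmx1 adj1 mul1mx.
  by rewrite (y6 k0) (adj_J k0) mulNmx.
- move=> k0; rewrite -scalemxAl -scalemxAr -scalerN; congr (_ *: _).
  by rewrite (adj_J k0) !mulNmx mulmxN opprK -mulmxA (y6 k0) mulmxN opprK.
- move=> i hi; have k0 : (0 < k)%N by case/andP: hi => i0; exact: leq_ltn_trans.
  rewrite -scalemxAl -scalemxAr; congr (_ *: _).
  rewrite (adj_J k0) !mulNmx mulmxN; congr (- _).
  by rewrite -mulmxA (y3 _ hi) mulmxN mulmxA (x3 _ hi) mulNmx opprK mulmxA.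
- by move=> hb; rewrite tauCZ tauM conj_adj (x4 hb) (y4 hb).
Qed.

Lemma cliffS_sqr y : cliff b J k.+1 y ->
  (adj (J k) *m y) *m (adj (J k) *m y) = - 1%:M.
Proof.
move=> /cliffS [[y1 y2 y3 y4] y5 y6].
have [k0|k0] := posnP k; first by rewrite k0 J0 adj1 mul1mx.
rewrite {2}(adj_J k0) mulNmx mulmxN -mulmxA (mulmxA y) (y6 k0) mulNmx mulmxN opprK.
by rewrite -(mulmxA (J k)) y5 mulmxN mulmx1 mulmxN (adj_unitary J_unitary).
Qed.

Lemma arc_rot y : cliff b J k.+1 y -> exists2 Q : M, Q \is unitarymx & exists th,
  [/\ gen b J k (J k) (rot_gen Q th), arc (J k) y = (fun t => J k *m rot Q th t)
    & \sum_j (th 0 j) ^+ 2 = N%:R * pi ^+ 2].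
Proof.
move=> hy; have hg := cliffS_gen pi hy; have [sB _ _ _] := hg.
have [Q hQ [th e]] := skew_decomposition sB.
exists Q => //; exists th; split; first by rewrite -e.
  apply/funext => t; rewrite (rot_arc _ hQ (esym e) (cliffS_sqr hy)) mul_arc mulmx1.
  by rewrite mulmxA (unitary_adj J_unitary) mul1mx.
rewrite -(frob_rot_gen th hQ) frob_adj adj_rot_gen -e -scalemxAr mulNmx -scalemxAl.
rewrite (cliffS_sqr hy) !scalerN opprK scalerA -scalemx1 !mxtraceZ mxtrace1.
by rewrite -(rmorph_nat (real_complex R)) -!rmorphM /=; ring.
Qed.

(** The arc from J_k to y runs inside Cl_k. Hence all components of Cl_(k+1) lie in the single
    component of J_k. *)
Lemma cliff_component y : cliff b J k.+1 y -> P y.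
Proof.
move=> hy; have [Q hQ [th [hg ha _]]] := arc_rot hy.
rewrite -(arc_half (J k) y) ha.
exact: (cliff_rot_component _ hQ (component_refl JK) hg).
Qed.

Lemma arc_component y t : cliff b J k.+1 y -> P (arc (J k) y t).
Proof.
move=> hy; have [Q hQ [th [hg -> _]]] := arc_rot hy.
exact: (cliff_rot_component _ hQ (component_refl JK) hg).
Qed.

Lemma arc_geodesic y : cliff b J k.+1 y ->
  geodesic_from_to P (J k) (- J k) (arc (J k) y).
Proof.
move=> hy; split; [|exact: arc0|exact: arc1].
have [Q hQ [th [hg -> _]]] := arc_rot hy.
exact: geodesic_rot hQ (component_refl JK) hg.
Qed.

Lemma arc_length y : cliff b J k.+1 y ->
  curve_length (arc (J k) y) = (Num.sqrt (N%:R * pi ^+ 2))%:E.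
Proof.
move=> hy; have [Q hQ [th [hg -> h]]] := arc_rot hy.
by rewrite (length_rot _ hQ J_unitary) h.
Qed.

(** The endpoint forces exp B = -1, so each eigenangle is an odd multiple of pi. This is the source
    of the bound pi sqrt N. *)
Lemma geodesic_to_antipode c : geodesic_from_to P (J k) (- J k) c ->
  exists2 Q : M, Q \is unitarymx & exists th,
  [/\ gen b J k (J k) (rot_gen Q th), c = (fun t => J k *m rot Q th t),
      rot Q th 1 = - 1%:M & forall j, pi ^+ 2 <= (th 0 j) ^+ 2].
Proof.
move=> [gc c0 c1]; have [Q hQ [th hg hc]] := geodesic_is_rot gc.
rewrite c0 in hg hc.
have r1 : rot Q th 1 = - 1%:M.
  rewrite -[LHS]mul1mx -(adj_unitary J_unitary) -mulmxA -hc c1 mulmxN.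
  by rewrite (adj_unitary J_unitary).
exists Q => //; exists th; split => //; first exact/funext.
move=> j; apply: cis_eqN1.
have : diag_mx (\row_j cis (th 0 j * 1)) = - 1%:M.
  rewrite -(conj_diag_inv (diag_mx (\row_j cis (th 0 j * 1))) hQ).
  have := r1; rewrite rot.unlock => ->.
  by rewrite mulmxN mulmx1 mulNmx (unitary_adj hQ).
by move=> /matrixP/(_ j j); rewrite !mxE eqxx mulr1n mulr1.
Qed.

(** E = exp(B/2) has E^2 = -1, so its inverse is -E. As B anticommutes with J_k for k > 0, moving
    J_k past E inverts E, that is J_k E = -E J_k. *)
Lemma midpoint_cliff c : geodesic_from_to P (J k) (- J k) c -> cliff b J k.+1 (c 2^-1).
Proof.
move=> hc; have [Q hQ [th [hg e r1 _]]] := geodesic_to_antipode hc.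
have hK : K (c 2^-1) by case: hc => [[_ h _] _ _]; exact: component_sub (h _).
have hY : rot Q th 2^-1 *m rot Q th 2^-1 = - 1%:M.
  by rewrite -(rot_add _ _ _ hQ) -r1; congr (rot Q th _); lra.
have hYN : rot Q th (- 2^-1) = - rot Q th 2^-1.
  have : rot Q th (- 2^-1) *m (rot Q th 2^-1 *m rot Q th 2^-1) = rot Q th 2^-1.
    by rewrite mulmxA -(rot_add _ _ _ hQ) addNr (rot0 _ hQ) mul1mx.
  by rewrite hY mulmxN mulmx1 => <-; rewrite opprK.
have [g1 g2 g3 g4] := hg.
have hJ : (0 < k)%N -> J k *m rot Q th 2^-1 = - (rot Q th 2^-1 *m J k).
  move=> k0; rewrite (rot_anti_intertwine _ hQ) ?hYN ?mulNmx//.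
  by rewrite (g2 k0) opprK.
have hm : (0 < k)%N -> c 2^-1 *m J k = - (J k *m c 2^-1).
  by move=> k0; rewrite e -mulmxA -[in RHS]mulmxN (hJ k0) opprK.
apply/cliffS; split => //.
have [k0|k0] := posnP k; last by case: hK => _ ->.
by rewrite e k0 J0 !mul1mx.
Qed.

Lemma centrosomeE : centrosome P (J k) (- J k) = cliff b J k.+1.
Proof.
apply/seteqP; split=> [_ [c hc <-]|y hy]; first exact: midpoint_cliff.
by exists (arc (J k) y); [exact: arc_geodesic|exact: arc_half].
Qed.

Lemma antipode_length c : geodesic_from_to P (J k) (- J k) c ->
  ((Num.sqrt (N%:R * pi ^+ 2))%:E <= curve_length c)%E.
Proof.
move=> hc; have [Q hQ [th [_ -> _ h]]] := geodesic_to_antipode hc.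
rewrite (length_rot _ hQ J_unitary) lee_fin ler_wsqrtr//.
rewrite -[leLHS]mulr1 -[N in N%:R]card_ord mulr_natl -sumr_const.
by rewrite mulr1; apply: ler_sum => j _.
Qed.

Lemma arc_shortest y : cliff b J k.+1 y ->
  shortest_geodesic P (J k) (- J k) (arc (J k) y).
Proof.
move=> hy; split; first exact: arc_geodesic.
by move=> c' hc'; rewrite arc_length//; exact: antipode_length.
Qed.

(* Equality in the length estimate forces [B^2 = - pi^2] for the generator B. *)
Lemma shortest_is_arc y0 c : cliff b J k.+1 y0 ->
  shortest_geodesic P (J k) (- J k) c -> c = arc (J k) (c 2^-1).
Proof.
move=> hy0 [hc hmin]; have [Q hQ [th [hg e r1 h]]] := geodesic_to_antipode hc.
(* The arc through y0 bounds the minimal length from above by pi sqrt N. *)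
have := hmin _ (arc_geodesic hy0).
rewrite arc_length// e (length_rot _ hQ J_unitary) lee_fin ler_sqrt; last first.
  by rewrite mulr_ge0// sqr_ge0.
have -> : N%:R * pi ^+ 2 = \sum_(j < N) pi ^+ 2 :> R.
  by rewrite sumr_const card_ord mulr_natl.
rewrite -subr_le0 -sumrB => hle.
have heq j : (th 0 j) ^+ 2 = pi ^+ 2.
  apply/eqP; rewrite -subr_eq0; apply/eqP.
  apply: (psumr_eq0P (P := predT) (F := fun j => (th 0 j) ^+ 2 - pi ^+ 2)) => //.
    by move=> i _; rewrite subr_ge0.
  apply/eqP; rewrite eq_le hle /=; apply: sumr_ge0 => i _.
  by rewrite subr_ge0.
pose Z := (pi^-1)%:C *: rot_gen Q th.
have pi0 : (pi : R) != 0 by rewrite gt_eqF// pi_gt0.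
have eZ : rot_gen Q th = pi%:C *: Z.
  by rewrite /Z scalerA -rmorphM /= divff// scale1r.
have hZ : Z *m Z = - 1%:M.
  rewrite /Z -scalemxAl -scalemxAr scalerA (rot_gen_sqr _ hQ).
  have -> : (\row_j (- ((th 0 j) ^+ 2)%:C) : 'rV[R[i]]_N) = const_mx (- (pi ^+ 2)%:C).
    by apply/rowP => j; rewrite !mxE heq.
  rewrite diag_const_mx scalar_mxC -mulmxA (adj_unitary hQ) mulmx1.
  rewrite -scalemx1 scalerA.
  have -> : (pi^-1)%:C * (pi^-1)%:C * - (pi ^+ 2)%:C = -1 :> R[i].
    rewrite mulrN -!rmorphM /=.
    have -> : pi^-1 * pi^-1 * pi ^+ 2 = 1 :> R.
      by rewrite expr2 mulrA -(mulrA pi^-1) mulVf// mulr1 mulVf.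
    by rewrite rmorph1.
  exact: scaleN1r.
apply/funext => t; rewrite (rot_arc 2^-1 hQ eZ hZ) (rot_arc t hQ eZ hZ) arc_half.
by rewrite mul_arc mulmx1.
Qed.

Lemma arc_Omega y : cliff b J k.+1 y -> Omega P (J k) (- J k) (restrict01 (arc (J k) y)).
Proof.
move=> hy; split.
- exists [:: 1], (fun _ => arc (J k) y); split; rewrite /= ?andbT ?ltr01//.
  move=> i _; split => //.
  by have [[] ] := arc_geodesic hy.
- by move=> t; exact: arc_component.
- by move=> t t0; rewrite /restrict01 t0 arc0.
- by move=> t t1; rewrite /restrict01 t1 arc1.
Qed.

Lemma shortest_with_midpoint y : cliff b J k.+1 y ->
  [set restrict01 c | c in [set c | shortest_geodesic P (J k) (- J k) c /\ c 2^-1 = y]]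
  = [set restrict01 (arc (J k) y)].
Proof.
move=> hy; apply/seteqP; split=> [_ [c [hc e] <-]|_ ->].
  by rewrite (shortest_is_arc hy hc) e.
exists (arc (J k) y); last exact: erefl.
exact: (conj (arc_shortest hy) (arc_half (J k) y)).
Qed.

Lemma s_centriole_component Q : s_centriole P (J k) (- J k) Q ->
  exists2 y, cliff b J k.+1 y & Q = component (cliff b J k.+1) y.
Proof. by move=> [_ [y]]; rewrite centrosomeE => hy -> _; exists y. Qed.

Lemma component_s_centriole y : pole P (J k) (- J k) -> cliff b J k.+1 y ->
  s_centriole P (J k) (- J k) (component (cliff b J k.+1) y).
Proof.
move=> hp hy; split => //; first by rewrite centrosomeE; exists y.
exists (arc (J k) y); first exact: arc_shortest.
by rewrite arc_half; exact: component_refl.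
Qed.

End Arcs.

(** * Products of the J_i, and paths by conjugation *)

Section Words.
Context {R : realType} {N : nat}.
Local Notation C := R[i].
Local Notation M := 'M[R[i]]_N.
Implicit Types (J : nat -> M) (X Y : M).

(** J_1, ..., J_m are unitary, square to -1 and anticommute pairwise: a unitary representation of a
    Clifford algebra. *)
Definition csys J (m : nat) : Prop :=
  forall i, (0 < i <= m)%N -> cliff false J i (J i).

Fixpoint word J (m : nat) : M :=
  if m is m'.+1 then word J m' *m J m'.+1 else 1%:M.

Lemma csysW J m n : (m <= n)%N -> csys J n -> csys J m.
Proof. by move=> mn h i /andP[i0 im]; apply: h; rewrite i0 (leq_trans im). Qed.

Lemma csys_unitary J m i : csys J m -> (0 < i <= m)%N -> J i \is unitarymx.
Proof. by move=> h /h []. Qed.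

Lemma csys_sqr J m i : csys J m -> (0 < i <= m)%N -> J i *m J i = - 1%:M.
Proof. by move=> h hi; have [_ + _ _] := h i hi; apply; case/andP: hi. Qed.

Lemma csys_adj J m i : csys J m -> (0 < i <= m)%N -> adj (J i) = - J i.
Proof.
move=> h hi; apply: adj_sqrN1; first exact: csys_unitary h hi.
exact: csys_sqr h hi.
Qed.

Lemma csys_anti J m i j : csys J m -> (0 < i <= m)%N -> (0 < j <= m)%N ->
  i != j -> J i *m J j = - (J j *m J i).
Proof.
move=> h hi hj; case: ltngtP => // ij _.
- have [_ _ + _] := h j hj; move/(_ i) => ->; first by rewrite opprK.
  by rewrite ij andbT; case/andP: hi.
- by have [_ _ + _] := h i hi; apply; rewrite ij andbT; case/andP: hj.
Qed.

Lemma word_anti J m Y :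
  (forall i, (0 < i <= m)%N -> Y *m J i = - (J i *m Y)) ->
  Y *m word J m = (-1) ^+ m *: (word J m *m Y).
Proof.
elim: m => [|m IH] h /=; first by rewrite mulmx1 mul1mx expr0 scale1r.
rewrite mulmxA IH => [|i /andP[i0 im]]; last by apply: h; rewrite i0 ltnW.
rewrite -scalemxAl -(mulmxA _ Y) h ?leqnn// mulmxN scalerN mulmxA exprS mulN1r.
by rewrite scaleNr.
Qed.

(** J_i changes sign with m - 1 factors and commutes with the factor J_i itself. *)
Lemma word_comm J m i : csys J m -> (0 < i <= m)%N ->
  J i *m word J m = (-1) ^+ m.-1 *: (word J m *m J i).
Proof.
elim: m => [|m IH] h /andP[i0]; first by case: i i0.
rewrite leq_eqVlt => /orP[/eqP ->|im] /=.
  rewrite mulmxA word_anti -?scalemxAl// => j /andP[j0 jm].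
  by apply: (csys_anti h) => //; rewrite ?leqnn ?j0 ?(leq_trans jm)// gtn_eqF.
have hm := csysW (leqnSn m) h; have m0 : (0 < m)%N by exact: leq_trans i0 im.
have hi : (0 < i <= m)%N by rewrite i0.
have anti : J i *m J m.+1 = - (J m.+1 *m J i).
  apply: (csys_anti h); [by rewrite i0 leqW|by rewrite leqnn|].
  by rewrite neq_ltn im.
rewrite mulmxA (IH hm hi) -scalemxAl -(mulmxA _ (J i)) anti mulmxN scalerN mulmxA.
have -> : (-1) ^+ m = - (-1) ^+ m.-1 :> C.
  by rewrite -{1}(prednK m0) exprS mulN1r.
by rewrite scaleNr.
Qed.

Lemma unitary1 : (1%:M : M) \is unitarymx.
Proof. by apply/unitary_adjP; rewrite adj1 mul1mx. Qed.

Lemma word_unitary J m : csys J m -> word J m \is unitarymx.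
Proof.
elim: m => [|m IH] h /=; first exact: unitary1.
apply: unitaryM; first exact: IH (csysW (leqnSn m) h).
by apply: (csys_unitary h); rewrite leqnn.
Qed.

Lemma word_sqr J m : csys J m -> exists n, word J m *m word J m = (-1) ^+ n *: 1%:M.
Proof.
elim: m => [|m IH] h /=; first by exists 0%N; rewrite mul1mx scale1r.
have [n hn] := IH (csysW (leqnSn m) h); exists (m + n.+1)%N.
rewrite mulmxA -(mulmxA (word J m)) word_anti => [|j /andP[j0 jm]]; last first.
  by apply: (csys_anti h); rewrite ?leqnn ?j0 ?(leq_trans jm)// gtn_eqF.
rewrite -scalemxAr -scalemxAl mulmxA hn -!scalemxAl mul1mx (csys_sqr h) ?leqnn//.
by rewrite scalerA -exprD addnS exprS mulN1r scaleNr scalerN.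
Qed.

Definition herm_involution (S : M) : Prop := adj S = S /\ S *m S = 1%:M.

(** The word is unitary with square 1 or -1, and a factor i turns the second case into the first. A
    unitary matrix with square 1 is Hermitian. *)
Lemma word_involution J m : csys J m ->
  exists2 a : C, a = 1 \/ a = 'i & herm_involution (a *: word J m).
Proof.
move=> h; have [n hn] := word_sqr h; have hU := word_unitary h.
have [a ha [a1 a2]] : exists2 a : C, a = 1 \/ a = 'i &
    Num.conj a * a = 1 /\ a * a * (-1) ^+ n = 1.
  rewrite -signr_odd; case: (odd n); last first.
    by exists 1; rewrite ?rmorph1 ?mulr1; [left|].
  by exists 'i; rewrite ?conjCi ?mulNr -?expr2 ?sqrCi ?expr1 ?mulrNN ?mulr1 ?opprK; [right|].
exists a => //.
have sq : (a *: word J m) *m (a *: word J m) = 1%:M.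
  by rewrite -scalemxAl -scalemxAr hn !scalerA a2 scale1r.
split => //.
have sU : adj (a *: word J m) *m (a *: word J m) = 1%:M.
  by rewrite adjZ -scalemxAl -scalemxAr (adj_unitary hU) scalerA a1 scale1r.
by rewrite -[LHS]mulmx1 -sq mulmxA sU mul1mx.
Qed.

(** The logarithm of u commutes with the J_i as u does, so conjugation with exp(tB) keeps X in Cl_k
    for all t. *)
Lemma unitary_commutant_component J k (u X : M) : u \is unitarymx ->
  (forall i, (0 < i < k)%N -> u *m J i = J i *m u) -> cliff false J k X ->
  component (cliff false J k) X (u *m X *m adj u).
Proof.
move=> hu hJ hX; have [Q hQ [th r1 hr]] := unitary_log hu.
pose c t := rot Q th t *m X *m rot Q th (- t).
have c0 : c 0 = X by rewrite /c oppr0 (rot0 _ hQ) mul1mx mulmx1.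
have c1 : c 1 = u *m X *m adj u by rewrite /c -adj_rot r1.
have hcJ i t : (0 < i < k)%N -> J i *m rot Q th t = rot Q th t *m J i.
  by move=> hi; apply: hr; rewrite hJ.
have rN t : rot Q th (- t) *m rot Q th t = 1%:M by rewrite -(rot_add _ _ _ hQ) addNr (rot0 _ hQ).
rewrite -c1 -c0; apply: (component_curve (c := c)) => t.
  eexists; apply: mderivM; first exact: mderivMr (mderiv_rot th t hQ).
  under eq_fun do rewrite -adj_rot.
  exact: mderiv_adj (mderiv_rot th t hQ).
have [x1 x2 x3 x4] := hX; split; last by [].
- exact: unitaryM (unitaryM (rot_unitary _ _ hQ) x1) (rot_unitary _ _ hQ).
- move=> k0; rewrite /c mulmxA mulmxA -(mulmxA (_ *m X)) rN mulmx1.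
  rewrite -(mulmxA _ X X) (x2 k0) mulmxN mulmx1 mulNmx.
  by rewrite -(rot_add _ _ _ hQ) subrr (rot0 _ hQ).
- move=> i hi; rewrite /c -(mulmxA (rot Q th t *m X)) -(hcJ i (- t) hi) mulmxA.
  rewrite -(mulmxA _ X (J i)) (x3 _ hi) mulmxN mulNmx (mulmxA _ (J i) X) -(hcJ i t hi).
  by rewrite !mulmxA.
Qed.

Lemma conjugator_component J k (u X Y : M) : u \is unitarymx ->
  (forall i, (0 < i < k)%N -> u *m J i = J i *m u) -> u *m X = Y *m u ->
  cliff false J k X -> component (cliff false J k) X Y.
Proof.
move=> hu hJ huX hX; have := unitary_commutant_component hu hJ hX.
by rewrite huX mulUadjK.
Qed.

(** For a Hermitian involution S this is the orthogonal projection onto its eigenspace for 1. *)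
Definition half_proj (S : M) : M := 2^-1 *: (1%:M + S).

Lemma half_projK S : S = 2 *: half_proj S - 1%:M.
Proof. by rewrite scalerA divff ?pnatr_eq0// scale1r addrC addKr. Qed.

Lemma half_proj_adj S : herm_involution S -> adj (half_proj S) = half_proj S.
Proof.
by move=> [hS _]; rewrite adjZ adjD adj1 hS fmorphV rmorph_nat.
Qed.

Lemma half_proj_idem S : herm_involution S -> half_proj S *m half_proj S = half_proj S.
Proof.
move=> [_ hS]; rewrite /half_proj -scalemxAl -scalemxAr mulmxDl mul1mx mulmxDr mulmx1 hS.
have -> : 1%:M + S + (S + 1%:M) = 2 *: (1%:M + S).
  by rewrite scaler_nat mulr2n (addrC S).
by rewrite !scalerA; congr (_ *: _); field.
Qed.

Lemma half_proj_comm S X : X *m S = S *m X -> X *m half_proj S = half_proj S *m X.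
Proof.
by move=> h; rewrite /half_proj -scalemxAr -scalemxAl mulmxDr mulmxDl h mul1mx mulmx1.
Qed.

Lemma half_proj_anti S X : X *m S = - (S *m X) ->
  X *m half_proj S = (1%:M - half_proj S) *m X.
Proof.
move=> h; have -> : 1%:M - half_proj S = half_proj (- S).
  have e2 : 1%:M - S = 2 *: (1%:M - half_proj S).
    rewrite [in LHS](half_projK S) opprB addrA scalerBr; congr (_ - _).
    by rewrite scaler_nat mulr2n.
  by rewrite [RHS]/half_proj e2 scalerA mulVf ?pnatr_eq0// scale1r.
by rewrite /half_proj -scalemxAr -scalemxAl mulmxDr mulmxDl h mul1mx mulmx1 mulNmx.
Qed.

(** X and Y exchange the two eigenspaces of S. If u is the identity on the range of e, then u X = Y
    u forces it to be -Y X, that is Y times the inverse of X, on the range of 1 - e. *)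
Lemma conjugator_anti (S X Y : M) : herm_involution S ->
  X \is unitarymx -> X *m X = - 1%:M -> Y \is unitarymx -> Y *m Y = - 1%:M ->
  X *m S = - (S *m X) -> Y *m S = - (S *m Y) ->
  let u := half_proj S - Y *m X *m (1%:M - half_proj S) in
  u \is unitarymx /\ u *m X = Y *m u.
Proof.
move=> hS X1 X2 Y1 Y2 hX hY.
have eX := half_proj_anti hX; have eY := half_proj_anti hY.
have ee := half_proj_idem hS; have ea := half_proj_adj hS.
set e := half_proj S in eX eY ee ea *; set f := 1%:M - e.
have fX : X *m f = e *m X by rewrite mulmxBr mulmx1 eX mulmxBl mul1mx opprB addrC subrK.
have fY : Y *m f = e *m Y by rewrite mulmxBr mulmx1 eY mulmxBl mul1mx opprB addrC subrK.
have ef : e *m f = 0 by rewrite mulmxBr mulmx1 ee subrr.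
have fe : f *m e = 0 by rewrite mulmxBl mul1mx ee subrr.
have ff : f *m f = f by rewrite {1}/f mulmxBl mul1mx ef subr0.
have fa : adj f = f by rewrite adjD adjN adj1 ea.
rewrite -/f in eX eY.
have Z : Y *m X *m f = f *m (Y *m X) by rewrite -mulmxA fX mulmxA eY mulmxA.
have fDe : f + e = 1%:M by rewrite subrK.
have NN : - X *m - Y = X *m Y by rewrite mulNmx mulmxN opprK.
have ZZ : Y *m X *m f *m (f *m (X *m Y)) = f.
  rewrite mulmxA -(mulmxA (Y *m X) f f) ff Z -!mulmxA (mulmxA X X Y) X2 mulNmx mul1mx.
  by rewrite mulmxN Y2 opprK mulmx1.
clearbody f e.
split.
  apply/unitary_adjP; rewrite adjD adjN !adjM fa ea (adj_sqrN1 X1 X2) (adj_sqrN1 Y1 Y2).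
  rewrite NN mulmxBr !mulmxBl ee.
  by rewrite -(mulmxA (Y *m X)) fe mulmx0 (mulmxA e f) ef mul0mx ZZ subr0 sub0r opprK addrC.
rewrite mulmxBl mulmxBr -(mulmxA _ f) -eX !mulmxA Y2 mulNmx mul1mx mulNmx opprK.
by rewrite fX -(mulmxA Y) X2 mulmxN mulmx1 mulNmx opprK addrC.
Qed.

(** The word in J_1, ..., J_(k-1) has odd length. It therefore anticommutes with X and Y but
    commutes with every J_i, so the matrix u of [conjugator_anti] also commutes with them. *)
Lemma even_component J k X Y : csys J k.-1 -> (0 < k)%N -> ~~ odd k ->
  cliff false J k X -> cliff false J k Y -> component (cliff false J k) X Y.
Proof.
move=> hJ k0 ko hX hY; have [a a0 hS] := word_involution hJ.
have [x1 x2 x3 _] := hX; have [y1 y2 y3 _] := hY.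
have ik i : (0 < i <= k.-1)%N = (0 < i < k)%N by rewrite -{2}(prednK k0).
have ok : odd k.-1 by rewrite -(prednK k0) /= negbK in ko.
have anti Z : (forall i, (0 < i < k)%N -> Z *m J i = - (J i *m Z)) ->
    Z *m (a *: word J k.-1) = - (a *: word J k.-1 *m Z).
  move=> hZ; rewrite -scalemxAr word_anti => [|i]; last by rewrite ik; exact: hZ.
  by rewrite -signr_odd ok expr1 scaleN1r scalerN -scalemxAl.
have [hu1 hu2] := conjugator_anti hS x1 (x2 k0) y1 (y2 k0) (anti _ x3) (anti _ y3).
apply: (conjugator_component hu1 _ hu2 hX) => i hi.
have cS : J i *m (a *: word J k.-1) = a *: word J k.-1 *m J i.
  have o2 : odd k.-1.-1 = false by case: (k.-1) ok => //= n /negbTE.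
  by rewrite -scalemxAr (word_comm hJ) ?ik// -signr_odd o2 expr0 scale1r -scalemxAl.
have cYX : J i *m (Y *m X) = Y *m X *m J i.
  by rewrite -(mulmxA Y X) (x3 _ hi) mulmxN (mulmxA Y (J i)) (y3 _ hi) mulNmx opprK mulmxA.
have ce := half_proj_comm cS.
have cf : J i *m (1%:M - half_proj (a *: word J k.-1)) =
    (1%:M - half_proj (a *: word J k.-1)) *m J i.
  by rewrite mulmxBr mulmxBl mulmx1 mul1mx ce.
by rewrite mulmxBl (mulmxBr (J i)) ce (mulmxA (J i)) cYX -!mulmxA cf.
Qed.

End Words.

(** * Traces of projections, and restriction to their ranges *)

Lemma idempotent_trace (F : fieldType) (n : nat) (e : 'M[F]_n) :
  e *m e = e -> \tr e = (\rank e)%:R.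
Proof.
(* In a rank factorization e = c r, idempotence gives r c = 1, and the trace of c r is that of r
   c. *)
move=> he; suff key : forall k (c : 'M[F]_(n, k)) (r : 'M[F]_(k, n)), row_full c -> row_free r ->
    c *m r = e -> r *m c = 1%:M.
  have hrc := key _ _ _ (col_base_full e) (row_base_free e) (mulmx_base e).
  by rewrite -[in LHS](mulmx_base e) mxtrace_mulC hrc mxtrace1.
move=> k c r hc hr h.
move: (mulVpmx hc) (mulmxVp hr); move: (pinvmx c) (pinvmx r) => c' r' hc' hr'.
have : c' *m (e *m e) *m r' = c' *m e *m r' by rewrite he.
rewrite -h !mulmxA hc' !mul1mx -(mulmxA _ r r') hr'.
by rewrite mulmx1.
Qed.

Section Isometries.
Context {R : realType}.
Local Notation C := R[i].

(** Gram-Schmidt on the row space of e gives the rows of the adjoint of V. The isometry V identifies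
    the range of e with C^m. *)
Lemma projection_isometry N m (e : 'M[C]_N) : adj e = e -> e *m e = e ->
  \tr e = m%:R -> exists2 V : 'M[C]_(N, m), adj V *m V = 1%:M & V *m adj V = e.
Proof.
move=> ha he; rewrite idempotent_trace// => /eqP; rewrite eqr_nat => /eqP <-.
pose Q := schmidt (row_base e).
have hQ : Q *m adj Q = 1%:M.
  have /unitarymxP : Q \is unitarymx.
    by apply: schmidt_unitarymx; exact: rank_leq_col.
  by rewrite adj.unlock map_trmx.
have eqQ : (Q :=: e)%MS.
  apply: eqmx_trans (eq_row_base e).
  exact/eqmx_schmidt_free/row_base_free.
have Qe : Q *m e = Q.
  have : (Q <= e)%MS by rewrite eqQ.
  by move=> /submxP[D ->]; rewrite -mulmxA he.
have eQQ : e = adj Q *m Q.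
  have : (e <= Q)%MS by rewrite eqQ.
  move=> /submxP[D eD].
  have h1 : e *m adj Q = adj Q by have := adjM Q e; rewrite Qe ha => <-.
  have := congr1 (mulmx^~ (adj Q)) eD; rewrite /= h1 -mulmxA hQ mulmx1 => ->.
  exact: eD.
by exists (adj Q); rewrite adjK.
Qed.

Lemma mxtraceB N (A B : 'M[C]_N) : \tr (A - B) = \tr A - \tr B.
Proof. exact: raddfB. Qed.

Lemma half_proj_trace N (S : 'M[C]_N) : \tr S = 2 * \tr (half_proj S) - N%:R.
Proof. by rewrite {1}(half_projK S) raddfB /= mxtraceZ mxtrace1. Qed.

Lemma involution_trace N (S : 'M[C]_N) : herm_involution S ->
  \tr S = 2 * (\rank (half_proj S))%:R - N%:R.
Proof.
by move=> hS; rewrite half_proj_trace idempotent_trace//; exact: half_proj_idem.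
Qed.

(** Equal traces mean eigenspaces of equal dimensions; u carries orthonormal bases of those of S to
    orthonormal bases of those of T. *)
Lemma involution_conjugator N (S T : 'M[C]_N) : herm_involution S -> herm_involution T ->
  \tr S = \tr T -> exists2 u : 'M[C]_N, u \is unitarymx & u *m S = T *m u.
Proof.
move=> hS hT.
pose e := half_proj S; pose f := half_proj T.
have ee : e *m e = e := half_proj_idem hS. have ff : f *m f = f := half_proj_idem hT.
have ea : adj e = e := half_proj_adj hS. have fa : adj f = f := half_proj_adj hT.
move=> htr; have tref : \tr e = \tr f.
  have h2 : (2 : C) != 0 by rewrite pnatr_eq0.
  by apply: (mulfI h2); apply: (addIr (- N%:R)); rewrite -!half_proj_trace.
have compl (p : 'M[C]_N) : adj p = p -> p *m p = p ->
    adj (1%:M - p) = 1%:M - p /\ (1%:M - p) *m (1%:M - p) = 1%:M - p.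
  move=> h1 h2; rewrite adjD adjN adj1 h1; split => //.
  by rewrite mulmxBl mul1mx mulmxBr mulmx1 h2 subrr subr0.
have [ea' ee'] := compl _ ea ee; have [fa' ff'] := compl _ fa ff.
have [r1 te] : exists r : nat, \tr e = r%:R by exists (\rank e); exact: (idempotent_trace ee).
have [r2 te'] : exists r : nat, \tr (1%:M - e) = r%:R.
  by exists (\rank (1%:M - e)); exact: (idempotent_trace ee').
have [V1 V11 V12] := projection_isometry ea ee te.
have [V2 V21 V22] := projection_isometry ea' ee' te'.
have tf : \tr f = r1%:R by rewrite -tref.
have tf' : \tr (1%:M - f) = r2%:R by rewrite -te' [LHS]mxtraceB [RHS]mxtraceB -tref.
have [W1 W11 W12] := projection_isometry fa ff tf.
have [W2 W21 W22] := projection_isometry fa' ff' tf'.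
have V12' : adj V1 *m V2 = 0.
  rewrite -[V1]mulmx1 -V11 mulmxA V12 -[V2]mulmx1 -V21 (mulmxA V2) V22 adjM ea.
  by rewrite mulmxA -(mulmxA _ e) mulmxBr mulmx1 ee subrr mulmx0 mul0mx.
have V21' : adj V2 *m V1 = 0 by rewrite -[RHS]adj0 -V12' adjM adjK.
exists (W1 *m adj V1 + W2 *m adj V2).
  apply/unitary_adjP; rewrite adjD !adjM !adjK mulmxDl !mulmxDr !mulmxA.
  rewrite -!(mulmxA _ (adj _) V1) -!(mulmxA _ (adj _) V2) V11 V21 V12' V21'.
  by rewrite !mulmx1 !mulmx0 !mul0mx addr0 add0r W12 W22 addrC subrK.
have ue : (W1 *m adj V1 + W2 *m adj V2) *m e = f *m (W1 *m adj V1 + W2 *m adj V2).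
  rewrite -V12 -W12 mulmxDl mulmxDr !mulmxA.
  rewrite -(mulmxA W1 (adj V1) V1) -(mulmxA W2 (adj V2) V1) V11 V21'.
  rewrite -(mulmxA W1 (adj W1) W1) -(mulmxA W1 (adj W1) W2) W11.
  have -> : adj W1 *m W2 = 0.
    rewrite -[W1]mulmx1 -W11 mulmxA W12 -[W2]mulmx1 -W21 (mulmxA W2) W22 adjM fa.
    by rewrite mulmxA -(mulmxA _ f) mulmxBr mulmx1 ff subrr mulmx0 mul0mx.
  by rewrite !mulmx1 !mulmx0 !mul0mx.
rewrite (half_projK S) (half_projK T) -/e -/f mulmxBr mulmxBl mulmx1 mul1mx.
by rewrite -scalemxAr -scalemxAl ue.
Qed.

Lemma skew_involution N (X : 'M[C]_N) : X \is unitarymx -> X *m X = - 1%:M ->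
  herm_involution ('i *: X).
Proof.
move=> X1 X2; split.
  by rewrite adjZ conjCi (adj_sqrN1 X1 X2) scaleNr scalerN opprK.
by rewrite -scalemxAl -scalemxAr X2 scalerA -expr2 sqrCi scaleN1r opprK.
Qed.

Section Compression.
Variables (N m : nat) (V : 'M[C]_(N, m)) (e : 'M[C]_N).
Hypotheses (VV : adj V *m V = 1%:M) (Ve : V *m adj V = e).

(** If Z commutes with e, this is the restriction of Z to the range of e in the orthonormal basis V,
    and it is multiplicative. *)
Definition compress (Z : 'M[C]_N) : 'M[C]_m := adj V *m Z *m V.

Lemma compress_mulV Z : Z *m e = e *m Z -> Z *m V = V *m compress Z.
Proof.
by move=> h; rewrite /compress !mulmxA Ve -h -Ve -!mulmxA VV mulmx1.
Qed.

Lemma compress_Vmul Z : Z *m e = e *m Z -> adj V *m Z = compress Z *m adj V.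
Proof.
by move=> h; rewrite /compress -(mulmxA _ V) Ve -mulmxA h -Ve !mulmxA VV mul1mx.
Qed.

Lemma compressM Z T : Z *m e = e *m Z -> compress (Z *m T) = compress Z *m compress T.
Proof.
by move=> h; rewrite [LHS]/compress mulmxA (compress_Vmul h) -2!(mulmxA (compress Z)).
Qed.

Lemma compress1 : compress 1%:M = 1%:M.
Proof. by rewrite /compress mulmx1. Qed.

Lemma compressN Z : compress (- Z) = - compress Z.
Proof. by rewrite /compress mulmxN mulNmx. Qed.

Lemma compress_adj Z : compress (adj Z) = adj (compress Z).
Proof. by rewrite /compress !adjM adjK mulmxA. Qed.

Lemma compress_unitary Z : Z *m e = e *m Z -> Z \is unitarymx ->
  compress Z \is unitarymx.
Proof.
move=> h hZ; apply/unitary_adjP; rewrite -compress_adj -(compressM _ h).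
by rewrite unitary_adj// compress1.
Qed.

Lemma compress_trace Z : \tr (compress Z) = \tr (Z *m e).
Proof. by rewrite /compress -mulmxA mxtrace_mulC -mulmxA Ve. Qed.

Lemma compress_cliff (J : nat -> 'M[C]_N) k X : (0 < k)%N ->
  (forall i, (0 < i < k)%N -> J i *m e = e *m J i) -> X *m e = e *m X ->
  cliff false J k X -> cliff false (fun i => compress (J i)) k (compress X).
Proof.
move=> k0 hJ hX [x1 x2 x3 _]; split => //.
- exact: compress_unitary.
- by move=> _; rewrite -(compressM _ hX) (x2 k0) compressN compress1.
- move=> i hi; rewrite -(compressM _ hX) (x3 i hi) compressN.
  by rewrite (compressM _ (hJ i hi)).
Qed.

End Compression.

End Isometries.

(** * Conjugacy in the presence of an even number of J_i *)

Section Conjugacy.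
Context {R : realType}.
Local Notation C := R[i].

Lemma compress_word N m (V : 'M[C]_(N, m)) (e : 'M[C]_N) (J : nat -> 'M[C]_N) n :
  adj V *m V = 1%:M -> V *m adj V = e ->
  (forall i, (0 < i <= n)%N -> J i *m e = e *m J i) ->
  word J n *m e = e *m word J n /\
  compress V (word J n) = word (fun i => compress V (J i)) n.
Proof.
move=> VV Ve; elim: n => [|n IH] h /=.
  by rewrite mulmx1 mul1mx /compress mulmx1.
have [|h1 h2] := IH; first by move=> i /andP[i0 ni]; apply: h; rewrite i0 ltnW.
have hn : J n.+1 *m e = e *m J n.+1 by apply: h; rewrite leqnn.
split; first by rewrite -mulmxA hn mulmxA h1 mulmxA.
by rewrite (compressM VV Ve _ h1) h2.
Qed.

Section Step.
Variables (N n : nat) (J : nat -> 'M[C]_N).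
Hypothesis hJ : csys J n.+2.
Hypothesis n_even : ~~ odd n.
Variables (A D : 'M[C]_N).
Hypotheses (eA : J n.+1 = A) (eD : J n.+2 = D).
(** A swaps the two eigenspaces of i A D, whereas whatever anticommutes with both A and D preserves
    them. One eigenspace thus carries the same problem with A and D removed; this is the period 2 of
    complex Bott periodicity. *)
Let S := 'i *: (A *m D).
Let e := half_proj S.

Let AA : A *m A = - 1%:M.
Proof. by rewrite -eA; apply: (csys_sqr hJ); rewrite leqnSn. Qed.

Let DD : D *m D = - 1%:M.
Proof. by rewrite -eD; apply: (csys_sqr hJ); rewrite leqnn. Qed.

Let Aa : adj A = - A.
Proof. by rewrite -eA; apply: (csys_adj hJ); rewrite leqnSn. Qed.

Let Da : adj D = - D.
Proof. by rewrite -eD; apply: (csys_adj hJ); rewrite leqnn. Qed.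

Let DA : D *m A = - (A *m D).
Proof.
rewrite -eA -eD; apply: (csys_anti hJ); rewrite ?leqnn ?leqnSn//.
by rewrite neq_ltn ltnSn orbT.
Qed.

Let AS : A *m S = - (S *m A).
Proof.
by rewrite -scalemxAr -scalemxAl -scalerN -(mulmxA A D A) DA mulmxN opprK.
Qed.

Lemma step_involution : herm_involution S.
Proof.
split; first by rewrite adjZ adjM Aa Da mulNmx mulmxN opprK DA conjCi scaleNr scalerN opprK.
rewrite -scalemxAl -scalemxAr scalerA -expr2 sqrCi mulmxA -(mulmxA A D A) DA.
by rewrite mulmxN mulNmx mulmxA AA -mulmxA DD mulmxN mulmx1 !opprK scaleN1r opprK.
Qed.

Let ee : e *m e = e. Proof. exact: half_proj_idem step_involution. Qed.
Let ea : adj e = e. Proof. exact: half_proj_adj step_involution. Qed.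
Let Ae : A *m e = (1%:M - e) *m A. Proof. exact: half_proj_anti AS. Qed.

Let AeA : A *m e *m A = e - 1%:M.
Proof. by rewrite Ae -mulmxA AA mulmxN mulmx1 opprB. Qed.

Let eAe : e *m A *m e = 0.
Proof. by rewrite -mulmxA Ae mulmxA mulmxBr mulmx1 ee subrr mul0mx. Qed.

Let comm_e Z : Z *m A = - (A *m Z) -> Z *m D = - (D *m Z) -> Z *m e = e *m Z.
Proof.
move=> h1 h2; apply: half_proj_comm; rewrite -scalemxAr -scalemxAl mulmxA h1.
by rewrite mulNmx -(mulmxA A Z D) h2 mulmxN opprK mulmxA.
Qed.

Let J_e i : (0 < i <= n)%N -> J i *m e = e *m J i.
Proof.
move=> /andP[i0 im]; have i2 : (0 < i <= n.+2)%N by rewrite i0 !leqW.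
by apply: comm_e; rewrite -?eA -?eD; apply: (csys_anti hJ) => //; rewrite ?leqnn ?leqnSn// ltn_eqF// ltnS ?leqW.
Qed.

Let cliff_e X : cliff false J n.+3 X -> X *m e = e *m X.
Proof.
by move=> [_ _ h _]; apply: comm_e; rewrite -?eA -?eD; apply: h; rewrite ltnS ?leqnn ?leqnSn.
Qed.

Variables (m : nat) (V : 'M[C]_(N, m)).
Hypotheses (VV : adj V *m V = 1%:M) (Ve : V *m adj V = e).
Let J' i := compress V (J i).

Let compress_csys : csys J' n.
Proof.
move=> i hi; apply: (compress_cliff VV Ve).
- by case/andP: hi.
- by move=> j /andP[j0 ji]; apply: J_e; rewrite j0 (leq_trans (ltnW ji))//; case/andP: hi.
- exact: J_e.
- by apply: hJ; case/andP: hi => -> /= hi; rewrite !leqW.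
Qed.

Let compress_cliffX X : cliff false J n.+3 X -> cliff false J' n.+1 (compress V X).
Proof.
move=> hX; apply: (compress_cliff VV Ve).
- by [].
- by move=> i hi; apply: J_e.
- exact: cliff_e.
- have [x1 x2 x3 x4] := hX; split; [exact: x1|by move=> _; apply: x2| |exact: x4].
  move=> i /andP[i0 im]; apply: x3.
  by rewrite i0; exact: (leq_trans im (leqW (leqW (leqnn _)))).
Qed.

(** With T = W X the left side is the trace of -i T S, where S = 2e - 1. As n is even, A commutes
    with W and so anticommutes with T, whence tr T = 0; and tr(T e) is the trace of the compression
    of T. *)
Let trace_step X : cliff false J n.+3 X ->
  \tr (word J n.+2 *m X) = - ('i *+ 2) * \tr (word J' n *m compress V X).
Proof.
move=> hX; have [_ _ x3 _] := hX.
have XA : X *m A = - (A *m X) by rewrite -eA; apply: x3; rewrite leqnSn.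
have XD : X *m D = - (D *m X) by rewrite -eD; apply: x3; rewrite leqnn.
have [We We'] := compress_word VV Ve J_e.
rewrite -We' -(compressM VV Ve _ We) (compress_trace Ve).
set W := word J n.
have AW : A *m W = W *m A.
  rewrite word_anti => [|i /andP[i0 im]].
    by rewrite -signr_odd (negbTE n_even) expr0 scale1r.
  rewrite -eA; apply: (csys_anti hJ); [by rewrite leqnSn|by rewrite i0 !leqW|].
  by rewrite neq_ltn ltnS im orbT.
have eW : word J n = W by [].
clearbody W.
pose T := W *m X.
have AT : A *m T = - (T *m A).
  have AX : A *m X = - (X *m A) by rewrite XA opprK.
  rewrite /T mulmxA AW -(mulmxA W A X) AX mulmxN (mulmxA W X A).
  exact: erefl.
have trT : \tr T = 0.
  have h : \tr (A *m T *m A) = \tr T.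
    by rewrite AT mulNmx -mulmxA AA mulmxN opprK mulmx1.
  have : \tr T = - \tr T.
    rewrite -{1}h mxtrace_mulC mulmxA AA mulNmx mul1mx.
    exact: raddfN.
  by move=> /eqP; rewrite -addr_eq0 -mulr2n mulrn_eq0 /= => /eqP.
have -> : word J n.+2 *m X = - 'i *: (T *m S).
  rewrite /= eA eD eW /S -scalemxAr scalerA mulNr -expr2 sqrCi opprK scale1r.
  rewrite /T -!mulmxA; congr (W *m _).
  by rewrite (mulmxA X A D) XA mulNmx -(mulmxA A X D) XD mulmxN opprK.
rewrite mxtraceZ (half_projK S) -/e mulmxBr mulmx1 mxtraceB trT subr0 -scalemxAr.
by rewrite mxtraceZ mulrA; congr (_ * _); ring.
Qed.

(** The first term acts on the range of e as u'. As the inverse of A is -A, the second is its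
    conjugate by A on the other eigenspace, which makes the sum commute with A. *)
Let lift (u' : 'M[C]_m) := V *m u' *m adj V - A *m (V *m u' *m adj V) *m A.

Let lift_inter u' Z T : Z *m e = e *m Z -> T *m e = e *m T ->
  Z *m A = - (A *m Z) -> T *m A = - (A *m T) ->
  u' *m compress V Z = compress V T *m u' -> lift u' *m Z = T *m lift u'.
Proof.
move=> Ze Te ZA TA h.
have EZ : V *m u' *m adj V *m Z = T *m (V *m u' *m adj V).
  rewrite -(mulmxA (V *m u')) (compress_Vmul VV Ve Ze) mulmxA -(mulmxA V) h.
  by rewrite (mulmxA V (compress V T) u') -(compress_mulV VV Ve Te) -!(mulmxA T).
rewrite /lift mulmxBl mulmxBr EZ; congr (_ - _).
move: (V *m u' *m adj V) EZ => E EZ.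
rewrite -(mulmxA (A *m E) A Z) -[A *m Z]opprK -ZA mulmxN (mulmxA (A *m E) Z A).
rewrite -(mulmxA A E Z) EZ (mulmxA A T E) -[A *m T]opprK -TA !mulNmx opprK.
by rewrite -!(mulmxA T).
Qed.

Let lift_A u' : lift u' *m A = A *m lift u'.
Proof.
rewrite /lift mulmxBl mulmxBr -(mulmxA _ A A) AA mulmxN mulmx1 opprK.
by rewrite !mulmxA AA !mulNmx mul1mx opprK addrC.
Qed.

(** D = i A S, and the lift commutes with A and preserves both eigenspaces of S. *)
Let lift_D u' : lift u' *m D = D *m lift u'.
Proof.
set E := V *m u' *m adj V.
have Ee : E *m e = E by rewrite /E -Ve -!mulmxA (mulmxA (adj V) V) VV mul1mx.
have eE : e *m E = E by rewrite /E -Ve !mulmxA -(mulmxA V (adj V) V) VV mulmx1.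
have ES : E *m S = E.
  by rewrite (half_projK S) -/e mulmxBr -scalemxAr Ee mulmx1 scaler_nat mulr2n addrK.
have SE : S *m E = E.
  by rewrite (half_projK S) -/e mulmxBl -scalemxAl eE mul1mx scaler_nat mulr2n addrK.
have LS : lift u' *m S = S *m lift u'.
  rewrite /lift -/E mulmxBl mulmxBr ES SE; congr (_ - _); clearbody S E.
  rewrite -(mulmxA (A *m E) A S) AS mulmxN (mulmxA (A *m E) S A) -(mulmxA A E S) ES.
  rewrite (mulmxA S (A *m E) A) (mulmxA S A E) -[S *m A]opprK -AS !mulNmx.
  by rewrite -(mulmxA A S E) SE.
have De : D = 'i *: (A *m S).
  by rewrite -scalemxAr mulmxA AA mulNmx mul1mx scalerA -expr2 sqrCi scaleN1r opprK.
have LA := lift_A u'; move: (lift u') LA LS => L LA LS.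
by rewrite De -scalemxAr -scalemxAl (mulmxA L A S) LA -(mulmxA A L S) LS mulmxA.
Qed.

Let lift_unitary u' : u' \is unitarymx -> lift u' \is unitarymx.
Proof.
move=> hu; apply/unitary_adjP; rewrite /lift.
set E := V *m u' *m adj V.
have Ee : E *m e = E by rewrite /E -Ve -!mulmxA (mulmxA (adj V) V) VV mul1mx.
have EE : E *m adj E = e.
  rewrite /E !adjM adjK -!mulmxA (mulmxA (adj V) V) VV mul1mx (mulmxA u').
  by rewrite (unitary_adj hu) mul1mx.
have eE : e *m adj E = adj E by rewrite -{1}ea -adjM Ee.
have EAE : E *m A *m adj E = 0.
  have -> : E *m A *m adj E = E *m (e *m A *m e) *m adj E.
    by rewrite !mulmxA Ee -(mulmxA _ e) eE.
  by rewrite eAe mulmx0 mul0mx.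
clearbody E.
have -> : adj (E - A *m E *m A) = adj E - A *m adj E *m A.
  by rewrite adjD adjN !adjM Aa !mulNmx !mulmxN opprK mulmxA.
move: (adj E) EE EAE => F EF EAF.
have T2 : A *m E *m A *m F = 0.
  by rewrite -(mulmxA A E A) -(mulmxA A (E *m A) F) EAF mulmx0.
have T3 : E *m (A *m F *m A) = 0 by rewrite !mulmxA EAF mul0mx.
have T4 : A *m E *m A *m (A *m F *m A) = 1%:M - e.
  rewrite !mulmxA -(mulmxA (A *m E) A A) AA mulmxN mulmx1 !mulNmx -(mulmxA A E F) EF.
  by rewrite AeA opprB.
by rewrite mulmxBr !mulmxBl T2 T3 T4 EF subr0 sub0r opprK addrC subrK.
Qed.

Lemma conjugator_step X Y : cliff false J n.+3 X -> cliff false J n.+3 Y ->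
  \tr (word J n.+2 *m X) = \tr (word J n.+2 *m Y) ->
  (forall J' X' Y', csys J' n -> cliff false J' n.+1 X' -> cliff false J' n.+1 Y' ->
     \tr (word J' n *m X') = \tr (word J' n *m Y') ->
     exists2 u : 'M[C]_m, u \is unitarymx &
       (forall i, (0 < i <= n)%N -> u *m J' i = J' i *m u) /\ u *m X' = Y' *m u) ->
  exists2 u : 'M[C]_N, u \is unitarymx &
    (forall i, (0 < i <= n.+2)%N -> u *m J i = J i *m u) /\ u *m X = Y *m u.
Proof.
move=> hX hY htr IH; have [_ _ x3 _] := hX; have [_ _ y3 _] := hY.
have [|u' hu [u1 u2]] :=
    IH J' _ _ compress_csys (compress_cliffX hX) (compress_cliffX hY).
  move: htr; rewrite (trace_step hX) (trace_step hY); apply: mulfI.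
  by rewrite oppr_eq0 mulrn_eq0 /= neq0Ci.
exists (lift u'); first exact: lift_unitary.
split; last first.
  apply: lift_inter => //; [exact: cliff_e|exact: cliff_e| |].
    by rewrite -eA; apply: x3; rewrite leqnSn.
  by rewrite -eA; apply: y3; rewrite leqnSn.
move=> i /andP[i0]; rewrite leq_eqVlt => /orP[/eqP ->|]; first by rewrite eD; exact: lift_D.
rewrite ltnS leq_eqVlt => /orP[/eqP ->|im]; first by rewrite eA; exact: lift_A.
have hi : (0 < i <= n)%N by rewrite i0.
have JA : J i *m A = - (A *m J i).
  rewrite -eA; apply: (csys_anti hJ); [by rewrite i0 !leqW|by rewrite leqnSn|].
  by rewrite neq_ltn im.
by apply: lift_inter => //; [exact: J_e|exact: J_e|exact: u1].
Qed.

End Step.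

(** Induction on the number of pairs of J_i; N varies because each step passes to an eigenspace.
    Without any J_i, the Hermitian involutions i X and i Y are classified by their traces. *)
Lemma odd_conjugator r : forall N (J : nat -> 'M[C]_N) X Y,
  csys J r.*2 -> cliff false J r.*2.+1 X -> cliff false J r.*2.+1 Y ->
  \tr (word J r.*2 *m X) = \tr (word J r.*2 *m Y) ->
  exists2 u : 'M[C]_N, u \is unitarymx &
    (forall i, (0 < i <= r.*2)%N -> u *m J i = J i *m u) /\ u *m X = Y *m u.
Proof.
elim: r => [|r IH] N J X Y hJ hX hY htr.
  have [x1 x2 _ _] := hX; have [y1 y2 _ _] := hY.
  have hx := skew_involution x1 (x2 isT); have hy := skew_involution y1 (y2 isT).
  have [|u hu] := involution_conjugator hx hy.
    by rewrite !mxtraceZ; move: htr; rewrite /= !mul1mx => ->.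
  rewrite -scalemxAr -scalemxAl => /(scalerI (neq0Ci _)) e.
  by exists u => //; split => // i /andP[i0 /(leq_trans i0)].
rewrite doubleS in hJ hX hY htr *.
have no : ~~ odd r.*2 by rewrite odd_double.
pose e := half_proj ('i *: (J r.*2.+1 *m J r.*2.+2)).
have [ea [ee te]] : adj e = e /\ e *m e = e /\ \tr e = (\rank e)%:R.
  have hS := step_involution hJ erefl erefl.
  by rewrite half_proj_adj// half_proj_idem// idempotent_trace ?half_proj_idem.
have [V VV Ve] := projection_isometry ea ee te.
by apply: (conjugator_step hJ no erefl erefl VV Ve hX hY htr) => J' X' Y'; exact: IH.
Qed.

End Conjugacy.

(** * Real traces and real dimensions *)

Section RealTrace.
Context {R : realType} {N : nat}.
Local Notation M := 'M[R[i]]_N.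
Implicit Types (L : M -> M) (S : set M).

Definition real_linear L : Prop :=
  (forall V W, L (V + W) = L V + L W) /\
  forall (a : R) V, L (a%:C *: V) = a%:C *: L V.

(* The trace of L as an endomorphism of a real vector space. *)
Definition rtr L : R := \sum_i \sum_j
  (complex.Re (L (delta_mx i j) i j) + complex.Im (L ('i *: delta_mx i j) i j)).

(** This is the condition that [mfd_dim] puts on each tangent space. *)
Definition real_basis S (d : nat) (b : 'I_d -> M) : Prop :=
  forall v, S v <-> exists! r : 'rV[R]_d, v = \sum_(i < d) (r 0 i)%:C *: b i.

Lemma rtrD L1 L2 : rtr (fun V => L1 V + L2 V) = rtr L1 + rtr L2.
Proof.
rewrite /rtr -big_split; apply: eq_bigr => i _; rewrite -big_split.
by apply: eq_bigr => j _; rewrite !mxE cReD cImD /=; ring.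
Qed.

Lemma cReZ (a : R) (z : R[i]) : complex.Re (a%:C * z) = a * complex.Re z.
Proof. by rewrite cReM /= mul0r subr0. Qed.

Lemma cImZ (a : R) (z : R[i]) : complex.Im (a%:C * z) = a * complex.Im z.
Proof. by rewrite cImM /= mul0r addr0. Qed.

Lemma rtrZ (a : R) L : rtr (fun V => a%:C *: L V) = a * rtr L.
Proof.
rewrite /rtr mulr_sumr; apply: eq_bigr => i _; rewrite mulr_sumr.
by apply: eq_bigr => j _; rewrite !mxE cReZ cImZ mulrDr.
Qed.

Lemma real_linearB L V W : real_linear L -> L (V - W) = L V - L W.
Proof.
move=> [LD LZ]; rewrite LD; congr (_ + _).
by rewrite -scaleN1r -[- L W]scaleN1r -(rmorphN1 (real_complex R)) LZ.
Qed.

Lemma real_linear0 L : real_linear L -> L 0 = 0.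
Proof. by move=> hL; rewrite -[X in L X](subrr 0) real_linearB// subrr. Qed.

Lemma real_expansion (V : M) : V = \sum_i \sum_j
  ((complex.Re (V i j))%:C *: delta_mx i j +
   (complex.Im (V i j))%:C *: ('i *: delta_mx i j)).
Proof.
rewrite {1}(matrix_sum_delta V); apply: eq_bigr => i _; apply: eq_bigr => j _.
by rewrite scalerA -scalerDl {1}(complexE (V i j)) (mulrC 'i).
Qed.

Lemma real_functional_trace (f : M -> R) (b : M) :
  (forall V W, f (V + W) = f V + f W) -> (forall (a : R) V, f (a%:C *: V) = a * f V) ->
  rtr (fun V => (f V)%:C *: b) = f b.
Proof.
move=> fD fZ.
have f0 : f 0 = 0 by have := fZ 0 0; rewrite scale0r mul0r.
have fs (I : Type) (r : seq I) (F : I -> M) : f (\sum_(i <- r) F i) = \sum_(i <- r) f (F i).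
  elim: r => [|i r IH]; first by rewrite !big_nil.
  by rewrite !big_cons fD IH.
rewrite [in RHS](real_expansion b) fs; apply: eq_bigr => i _; rewrite fs.
by apply: eq_bigr => j _; rewrite fD !fZ !mxE cReZ cImZ; ring.
Qed.

Section Projection.
Variables (L : M -> M) (S : set M).
Hypotheses (hL : real_linear L) (LS : forall V, S (L V)) (LK : forall V, S V -> L V = V).

(** L is the sum of the rank-one maps that send V to f_l(V) b_l, where f_l(V) is a coordinate of L
    V. As L fixes b_l, each of them has trace f_l(b_l) = 1. *)
Lemma real_basis_trace (d : nat) (b : 'I_d -> M) : real_basis S b -> rtr L = d%:R.
Proof.
move=> hb.
have [f fE] : exists f : M -> 'rV[R]_d, forall V, L V = \sum_(i < d) (f V 0 i)%:C *: b i.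
  exists (fun V => projT1 (cid (iffLR (hb _) (LS V)))) => V.
  by case: cid => r [].
have uniq0 (r s : 'rV[R]_d) :
    \sum_(i < d) (r 0 i)%:C *: b i = \sum_(i < d) (s 0 i)%:C *: b i -> r = s.
  move=> e; have := LS 0; rewrite (real_linear0 hL) => /hb [r0 [_ h0]].
  have h1 : r - s = r0.
    apply/esym/h0; rewrite -[LHS](subrr (\sum_(i < d) (s 0 i)%:C *: b i)) -{1}e -sumrB.
    by apply: eq_bigr => i _; rewrite !mxE rmorphB scalerBl.
  have h2 : 0 = r0.
    by apply/esym/h0; rewrite big1// => i _; rewrite mxE scale0r.
  by apply/eqP; rewrite -subr_eq0 h1 h2.
have Sb l : S (b l).
  apply/hb; exists (delta_mx 0 l); split=> [|r h].
    rewrite (bigD1 l)//= mxE !eqxx scale1r big1 ?addr0// => i /negbTE il.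
    by rewrite mxE il andbF scale0r.
  apply: uniq0; rewrite -h (bigD1 l)//= mxE !eqxx scale1r big1 ?addr0// => i /negbTE il.
  by rewrite mxE il andbF scale0r.
have fD V W : f (V + W) = f V + f W.
  apply: uniq0; rewrite -fE; case: hL => -> _; rewrite !fE -big_split.
  by apply: eq_bigr => i _; rewrite mxE rmorphD scalerDl.
have fZ (a : R) V : f (a%:C *: V) = a *: f V.
  apply: uniq0; rewrite -fE; case: hL => _ ->; rewrite !fE scaler_sumr.
  by apply: eq_bigr => i _; rewrite mxE rmorphM scalerA.
have fb l : f (b l) = delta_mx 0 l.
  apply: uniq0; rewrite -fE LK// (bigD1 l)//= mxE !eqxx scale1r big1 ?addr0// => i /negbTE il.
  by rewrite mxE il andbF scale0r.
have -> : rtr L = \sum_(l < d) rtr (fun V => (f V 0 l)%:C *: b l).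
  rewrite /rtr [RHS]exchange_big; apply: eq_bigr => i _; rewrite [RHS]exchange_big.
  by apply: eq_bigr => j _; rewrite [RHS]big_split /= !fE !summxE cRe_sum cIm_sum.
rewrite (eq_bigr (fun _ => 1)); first by rewrite sumr_const card_ord.
move=> l _; rewrite (real_functional_trace (f := fun V => f V 0 l)).
- by rewrite fb mxE !eqxx.
- by move=> V W; rewrite fD mxE.
- by move=> a V; rewrite fZ mxE.
Qed.

(** Pairs of real matrices turn the problem into one over R, where S is the image of a linear
    endomorphism and has a basis. *)
Lemma real_basis_exists : exists d (b : 'I_d -> M), real_basis S b.
Proof.
pose E := ('M[R]_N * 'M[R]_N)%type.
pose cplx (p : E) : M := \matrix_(i, j) (p.1 i j +i* p.2 i j).
pose realp (V : M) : E := (map_mx (@complex.Re R) V, map_mx (@complex.Im R) V).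
have cplxK p : realp (cplx p) = p.
  by case: p => A B; congr (_, _); apply/matrixP => i j; rewrite !mxE.
have realpK V : cplx (realp V) = V.
  by apply/matrixP => i j; rewrite !mxE; case: (V i j).
have cplxL a p q : cplx (a *: p + q) = a%:C *: cplx p + cplx q.
  by apply/matrixP => i j; rewrite !mxE; apply: complex_ext; rewrite ?cReD ?cImD ?cReZ ?cImZ.
pose g p := realp (L (cplx p)).
have gL : linear g.
  move=> a p q; apply: (can_inj cplxK); rewrite cplxL /g !realpK cplxL.
  by case: hL => -> ->.
pose gl : {linear E -> E} := HB.pack g (GRing.isLinear.Build R E E *:%R g gL).
pose W := limg (linfun gl).
have WP p : (p \in W) <-> S (cplx p).
  split=> [/memv_imgP [q _ ->]|h].
    by rewrite lfunE /= /g realpK; exact: LS.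
  have -> : p = linfun gl p by rewrite lfunE /= /g LK// cplxK.
  by rewrite memv_img// memvf.
have fr : free (vbasis W) := basis_free (vbasisP W).
have to_sum (r : 'rV[R]_(\dim W)) : cplx (\sum_(i < \dim W) r 0 i *: (vbasis W)`_i) =
    \sum_(i < \dim W) (r 0 i)%:C *: cplx (vbasis W)`_i.
  have to0 : cplx 0 = 0 by apply/matrixP => i j; rewrite !mxE.
  elim/big_rec2: _ => // i p q _ <-; exact: cplxL.
exists (\dim W), (fun i => cplx (vbasis W)`_i) => v; split.
  rewrite -{1}(realpK v) => /WP hv.
  exists (\row_i coord (vbasis W) i (realp v)); split.
    rewrite -to_sum -[LHS]realpK; congr cplx; rewrite [LHS](coord_vbasis hv).
    by apply: eq_bigr => i _; rewrite mxE.
  move=> r ->; apply/rowP => i; rewrite mxE -to_sum cplxK.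
  by rewrite (coord_sum_free (fun i => r 0 i)).
move=> [r [-> _]]; rewrite -to_sum; apply/WP; apply: rpred_sum => i _.
by apply: rpredZ; apply: vbasis_mem; apply: mem_nth; rewrite size_tuple.
Qed.

End Projection.

End RealTrace.

(** * Means over conjugations by anticommuting matrices *)

Section Averages.
Context {R : realType} {N : nat}.
Local Notation M := 'M[R[i]]_N.
Implicit Types (A B V W X Z : M) (s : seq M).

Definition skew_part V : M := (2^-1)%:C *: (V - adj V).

(** If the members of s are unitary, square to -1 and anticommute pairwise, this projects onto the
    skew-Hermitian matrices that commute with all of them. *)
Fixpoint avg s V : M :=
  if s is A :: s' then (2^-1)%:C *: (avg s' V + A *m avg s' V *m adj A)
  else skew_part V.

(* Expanding the averages gives the mean over all subwords A of s of
   [`|\tr (W *m A)| ^+ 2]. *)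
Definition twisted_trace s W : R := rtr (fun V => W *m avg s V *m adj W).

Lemma half_double V : (2^-1)%:C *: (V + V) = V.
Proof.
rewrite scalerDr -scalerDl -rmorphD /= (_ : 2^-1 + 2^-1 = 1); last by field.
by rewrite rmorph1 scale1r.
Qed.

Lemma skew_part_linear : real_linear skew_part.
Proof.
split=> [V W|a V]; rewrite /skew_part.
  by rewrite adjD opprD addrACA scalerDr.
by rewrite adjCZ -[a%:C *: V - _]scalerBr !scalerA mulrC.
Qed.

Lemma avg_linear s : real_linear (avg s).
Proof.
elim: s => [|A s [IHD IHZ]] /=; first exact: skew_part_linear.
split=> [V W|a V].
  by rewrite IHD mulmxDr mulmxDl addrACA scalerDr.
by rewrite IHZ -scalemxAr -scalemxAl -scalerDr !scalerA mulrC.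
Qed.

Lemma avg_skew s V : adj (avg s V) = - avg s V.
Proof.
elim: s => [|A s IH] /=; first by rewrite adjCZ adjD adjN adjK -scalerN opprB.
by rewrite adjCZ adjD !adjM adjK IH mulNmx mulmxN mulmxA -opprD scalerN.
Qed.

Lemma avg_fixed s B : adj B = - B -> (forall A, A \in s -> A *m B *m adj A = B) ->
  avg s B = B.
Proof.
move=> hB; elim: s => [|A s IH] h /=.
  by rewrite /skew_part hB opprK half_double.
rewrite IH => [|Z hZ]; last by apply: h; rewrite inE hZ orbT.
by rewrite h ?mem_head// half_double.
Qed.

(** Anticommuting matrices give commuting conjugations, because the sign occurs twice. *)
Lemma conj_anti A Z B : A *m Z = - (Z *m A) ->
  A *m (Z *m B *m adj Z) *m adj A = Z *m (A *m B *m adj A) *m adj Z.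
Proof.
move=> h; have h' : adj Z *m adj A = - (adj A *m adj Z).
  by rewrite -!adjM h adjN.
rewrite !mulmxA h !mulNmx -(mulmxA _ (adj Z) (adj A)) h' mulmxN opprK.
by rewrite !mulmxA.
Qed.

(** As A^2 = -1, conjugation by A is an involution and swaps the two summands of the outermost mean.
    The other conjugations commute with it and are handled by induction. *)
Lemma avg_invariant s V :
  (forall A B, A \in s -> B \in s -> A = B \/ A *m B = - (B *m A)) ->
  (forall A, A \in s -> A \is unitarymx /\ A *m A = - 1%:M) ->
  forall A, A \in s -> A *m avg s V *m adj A = avg s V.
Proof.
elim: s => [|A s IH] //= hs hU Z Zs.
have [ZA|[{}Zs ZA]] : Z = A \/ Z \in s /\ Z *m A = - (A *m Z).
  have [->|ZA] := hs Z A Zs (mem_head _ _); first by left.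
  by case/predU1P: Zs => [|Zs]; [left|right].
  rewrite ZA.
  have [AU AA] := hU A (mem_head _ _).
  rewrite -scalemxAr -scalemxAl mulmxDr mulmxDl; congr (_ *: _); rewrite addrC; congr (_ + _).
  rewrite !mulmxA (adj_sqrN1 AU AA) !mulmxN mulNmx opprK -(mulmxA _ A A) AA.
  by rewrite mulmxN mulmx1 mulNmx mul1mx opprK.
have IHZ : Z *m avg s V *m adj Z = avg s V.
  by apply: IH => // [B C hB hC|B hB]; [apply: hs|apply: hU]; rewrite inE ?hB ?hC orbT.
rewrite -scalemxAr -scalemxAl mulmxDr mulmxDl; congr (_ *: _); congr (_ + _); first exact: IHZ.
by rewrite conj_anti ?IHZ.
Qed.

Lemma twisted_trace_cons A s W :
  twisted_trace (A :: s) W = 2^-1 * (twisted_trace s W + twisted_trace s (W *m A)).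
Proof.
rewrite /twisted_trace -rtrD -rtrZ; congr rtr; apply/funext => V /=.
by rewrite -scalemxAr -scalemxAl mulmxDr mulmxDl adjM !mulmxA.
Qed.

(** The map is complex linear with trace |tr W|^2; its real trace is twice the real part of that. *)
Lemma rtr_conj W : rtr (fun V => W *m V *m adj W) =
  2 * (complex.Re (\tr W) ^+ 2 + complex.Im (\tr W) ^+ 2).
Proof.
have E i j : (W *m delta_mx i j *m adj W) i j = W i i * Num.conj (W j j).
  rewrite -(mulmxA W) mxE (bigD1 i)//= big1 ?addr0 => [|k ki]; last first.
    rewrite mxE big1 ?mulr0// => l _; rewrite mxE (negbTE ki).
    by rewrite mul0r.
  rewrite mxE (bigD1 j)//= big1 ?addr0 => [|l lj]; last first.
    by rewrite mxE (negbTE lj) andbF mul0r.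
  by rewrite mxE !eqxx mul1r adj.unlock !mxE.
transitivity (2 * complex.Re (\tr W * Num.conj (\tr W))); last first.
  by rewrite cReM cRe_conj cIm_conj; ring.
rewrite /mxtrace rmorph_sum mulr_suml cRe_sum mulr_sumr; apply: eq_bigr => i _.
rewrite mulr_sumr cRe_sum mulr_sumr; apply: eq_bigr => j _.
rewrite -scalemxAr -scalemxAl [('i *: _ : M) i j]mxE E cImM /=.
by rewrite mul0r add0r mul1r -mulr2n mulr_natl.
Qed.

(** The map is antilinear, so a basis vector and its multiple by i contribute opposite amounts. *)
Lemma rtr_conj_adj W : rtr (fun V => W *m adj V *m adj W) = 0.
Proof.
rewrite /rtr big1// => i _; rewrite big1// => j _.
rewrite adjZ conjcE -scalemxAr -scalemxAl [(_ *: _ : M) i j]mxE cImM /=.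
by rewrite mul0r add0r mulN1r subrr.
Qed.

Lemma twisted_trace_nil W :
  twisted_trace [::] W = complex.Re (\tr W) ^+ 2 + complex.Im (\tr W) ^+ 2.
Proof.
rewrite /twisted_trace /= /skew_part.
have -> : (fun V => W *m ((2^-1)%:C *: (V - adj V)) *m adj W) =
   (fun V => (2^-1)%:C *: (W *m V *m adj W + (-1)%:C *: (W *m adj V *m adj W))).
  apply/funext => V; rewrite -scalemxAr -scalemxAl mulmxBr mulmxBl.
  by rewrite rmorphN1 scaleN1r.
by rewrite rtrZ rtrD rtrZ rtr_conj rtr_conj_adj mulr0 addr0 mulrA mulVf// mul1r.
Qed.

Lemma twisted_trace_ge0 s W : 0 <= twisted_trace s W.
Proof.
elim: s W => [|A s IH] W.
  by rewrite twisted_trace_nil addr_ge0// sqr_ge0.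
by rewrite twisted_trace_cons mulr_ge0// addr_ge0.
Qed.

(** A mean of squares that is at most 0 has only zero terms; the term of the full product is the one
    kept. *)
Lemma twisted_trace_eq0 s W : twisted_trace s W <= 0 -> \tr (foldl mulmx W s) = 0.
Proof.
elim: s W => [|A s IH] W.
  rewrite twisted_trace_nil /= => h; have h1 := sqr_ge0 (complex.Re (\tr W)).
  have h2 := sqr_ge0 (complex.Im (\tr W)).
  by apply: complex_ext => /=; apply/eqP; rewrite -sqrf_eq0; apply/eqP; lra.
rewrite twisted_trace_cons => h; apply: IH.
have := twisted_trace_ge0 s W; have := twisted_trace_ge0 s (W *m A); lra.
Qed.

(* W is a product of p factors, among them X but not Y, so that one of X and Y
   anticommutes with it. *)
Lemma twisted_trace_vanishes s W X Y p : X \is unitarymx -> Y \is unitarymx ->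
  (forall A, A \in s -> X *m A = - (A *m X) /\ Y *m A = - (A *m Y)) ->
  X *m W = (-1) ^+ p.+1 *: (W *m X) -> Y *m W = (-1) ^+ p *: (W *m Y) ->
  twisted_trace s W = 0.
Proof.
move=> hX hY; elim: s W p => [|A s IH] W p hs XW YW.
  have tr0 Z : Z \is unitarymx -> Z *m W = - (W *m Z) -> \tr W = 0.
    move=> hZ ZW; have h : \tr (Z *m W *m adj Z) = \tr W.
      by rewrite mxtrace_mulC mulmxA adj_unitary// mul1mx.
    have : \tr W = - \tr W.
      by rewrite -{1}h ZW mulNmx mulUadjK//; exact: raddfN.
    by move=> /eqP; rewrite -addr_eq0 -mulr2n mulrn_eq0 /= => /eqP.
  rewrite twisted_trace_nil.
  have -> : \tr W = 0.
    move: XW YW; rewrite -(signr_odd _ p) -(signr_odd _ p.+1) /=.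
    case: (odd p); rewrite expr0 expr1 scale1r scaleN1r => XW YW.
      exact: tr0 hY YW.
    exact: tr0 hX XW.
  by rewrite /= expr0n addr0.
have [XA YA] := hs A (mem_head _ _).
have hs' B : B \in s -> X *m B = - (B *m X) /\ Y *m B = - (B *m Y).
  by move=> hB; apply: hs; rewrite inE hB orbT.
rewrite twisted_trace_cons (IH _ _ hs' XW YW) (IH _ p.+1 hs') ?addr0 ?mulr0//.
  by rewrite mulmxA XW -scalemxAl -!mulmxA XA mulmxN scalerN -scaleNr (exprS _ p.+1) mulN1r.
by rewrite mulmxA YW -scalemxAl -!mulmxA YA mulmxN scalerN -scaleNr exprS mulN1r.
Qed.

Lemma twisted_trace_conj s u X Y : u \is unitarymx ->
  (forall A, A \in s -> u *m A = A *m u) -> u *m X = Y *m u ->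
  twisted_trace s X = twisted_trace s Y.
Proof.
move=> hu; elim: s X Y => [|A s IH] X Y h e.
  rewrite !twisted_trace_nil; have -> : \tr X = \tr Y; last by [].
  by rewrite -[X]mul1mx -(adj_unitary hu) -mulmxA e mxtrace_mulC mulUadjK.
have h' B : B \in s -> u *m B = B *m u by move=> hB; apply: h; rewrite inE hB orbT.
have e' : u *m (X *m A) = (Y *m A) *m u.
  by rewrite mulmxA e -!mulmxA (h A (mem_head _ _)).
by rewrite !twisted_trace_cons (IH _ _ h' e) (IH _ _ h' e').
Qed.

End Averages.

(** * Dimensions of the components of Cl_(k+1) *)

Section Dimensions.
Context {R : realType} {N : nat}.
Local Notation M := 'M[R[i]]_N.

Lemma real_basis_unitary (S : set M) (x : M) d (b : 'I_d -> M) : x \is unitarymx ->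
  real_basis S b -> real_basis [set B | S (x *m B)] (fun i => adj x *m b i).
Proof.
move=> hx hb B; rewrite /= hb.
have e (r : 'rV[R]_d) : (x *m B = \sum_(i < d) (r 0 i)%:C *: b i) <->
    (B = \sum_(i < d) (r 0 i)%:C *: (adj x *m b i)).
  have -> : \sum_(i < d) (r 0 i)%:C *: (adj x *m b i) =
      adj x *m \sum_(i < d) (r 0 i)%:C *: b i.
    by rewrite mulmx_sumr; apply: eq_bigr => i _; rewrite scalemxAr.
  split=> [<-|->]; first by rewrite mulmxA adj_unitary// mul1mx.
  by rewrite mulmxA unitary_adj// mul1mx.
by split=> -[r [/e h1 h2]]; exists r; split=> // r' /e; exact: h2.
Qed.

Variables (J : nat -> M) (k : nat).
Hypothesis hJ : csys J k.

Definition gens : seq M := [seq J i | i <- iota 1 k].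

Lemma gensP (A : M) : A \in gens -> exists2 i, (0 < i <= k)%N & A = J i.
Proof. by move=> /mapP [j]; rewrite mem_iota add1n ltnS => hj ->; exists j. Qed.

Lemma mem_gens i : (0 < i <= k)%N -> J i \in gens.
Proof. by move=> hi; apply: map_f; rewrite mem_iota add1n ltnS. Qed.

Lemma foldl_gens (W : M) : foldl mulmx W gens = W *m word J k.
Proof.
rewrite /gens; elim: k => [|m IH]; first by rewrite mulmx1.
by rewrite -[m.+1]addn1 iotaD map_cat foldl_cat IH /= addn1 add1n mulmxA.
Qed.

Lemma avg_gens V i : (0 < i <= k)%N ->
  avg gens V *m J i = J i *m avg gens V.
Proof.
move=> hi; have hU := csys_unitary hJ hi.
have h : J i *m avg gens V *m adj (J i) = avg gens V.
  apply: avg_invariant (mem_gens hi) => [A B|A].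
    move=> /gensP [a ha ->] /gensP [c hc ->]; have [->|ac] := eqVneq a c; first by left.
    by right; apply: (csys_anti hJ).
  by move=> /gensP [a ha ->]; split; [exact: csys_unitary ha|exact: csys_sqr ha].
by rewrite -{1}h -mulmxA adj_unitary// mulmx1.
Qed.

(** The mean over the J_i yields a skew-Hermitian matrix in their commutant; the difference keeps
    its part that anticommutes with x. The result is a projection onto the generators at x. *)
Definition gen_proj (x V : M) : M :=
  (2^-1)%:C *: (avg gens V - x *m avg gens V *m adj x).

Lemma gen_proj_linear x : real_linear (gen_proj x).
Proof.
have [aD aZ] := avg_linear gens; split=> [V W|a V]; rewrite /gen_proj.
  by rewrite aD mulmxDr mulmxDl opprD addrACA scalerDr.
by rewrite aZ -scalemxAr -scalemxAl -[a%:C *: _ - _]scalerBr !scalerA mulrC.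
Qed.

Lemma rtr_gen_proj x :
  rtr (gen_proj x) = 2^-1 * (twisted_trace gens 1%:M - twisted_trace gens x).
Proof.
rewrite /gen_proj rtrZ; congr (_ * _).
rewrite -[X in _ - X]mul1r -mulNr -rtrZ -rtrD; congr rtr; apply/funext => V.
by rewrite mul1mx adj1 mulmx1 rmorphN1 scaleN1r.
Qed.

Variable x : M.
Hypothesis hx : cliff false J k.+1 x.

Let xU : x \is unitarymx. Proof. by case: hx. Qed.
Let xx : x *m x = - 1%:M. Proof. by case: hx => _ ->. Qed.
Let xa : adj x = - x. Proof. exact: adj_sqrN1. Qed.

Let xJ i : (0 < i <= k)%N -> x *m J i = - (J i *m x).
Proof. by case: hx => _ _ h _ hi; apply: h; rewrite ltnS. Qed.

Lemma gen_proj_gen V : gen false J k.+1 x (gen_proj x V).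
Proof.
have FA i : (0 < i <= k)%N -> _ := @avg_gens V i.
have Fs := avg_skew gens V.
rewrite /gen_proj; move: (avg gens V) FA Fs => F FA Fs; split=> //.
- by rewrite adjCZ adjD adjN !adjM adjK Fs mulNmx mulmxN mulmxA -opprB opprK addrC -scalerN opprB.
- move=> _; rewrite -scalemxAl -scalemxAr -scalerN; congr (_ *: _).
  rewrite mulmxBl mulmxBr muladjUK// xa mulmxN mulmxN opprK !mulmxA xx.
  by rewrite mulNmx mul1mx mulNmx opprD opprK addrC.
- move=> i; rewrite ltnS => hi; rewrite -scalemxAl -scalemxAr; congr (_ *: _).
  rewrite mulmxBl mulmxBr FA//; congr (_ - _).
  rewrite xa !(mulmxN, mulNmx); congr (- _).
  rewrite -(mulmxA _ x) xJ// mulmxN mulmxA -(mulmxA x) FA// !mulmxA xJ//.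
  by rewrite !mulNmx opprK.
Qed.

Lemma gen_proj_fixed B : gen false J k.+1 x B -> gen_proj x B = B.
Proof.
move=> [Bs Bx BJ _].
have -> : gen_proj x B = (2^-1)%:C *: (B + B); last by rewrite half_double.
rewrite /gen_proj avg_fixed//; last first.
  move=> A /gensP [i hi ->]; rewrite -(BJ i hi); apply: mulUadjK.
  exact: csys_unitary hJ hi.
congr (_ *: (_ + _)); have -> : x *m B = - (B *m x) by rewrite Bx// opprK.
by rewrite mulNmx mulUadjK// opprK.
Qed.

End Dimensions.

Section ComponentDimension.
Context {R : realType} {N : nat}.
Local Notation M := 'M[R[i]]_N.
Variables (J : nat -> M) (k : nat) (y : M).
Hypothesis hJ : csys J k.
Local Notation Q := (component (cliff false J k.+1) y).

(** Translation by x identifies the tangent space with the image of [gen_proj], whose trace is its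
    dimension. *)
Lemma mfd_dim_twisted_trace x d : Q x -> mfd_dim Q d ->
  d%:R = 2^-1 * (twisted_trace (gens J k) 1%:M - twisted_trace (gens J k) x).
Proof.
move=> hx hd; have hK := component_sub hx; have [xU _ _ _] := hK.
rewrite -rtr_gen_proj; have [b hb] := hd x hx.
have hb' : real_basis (tangent Q x) b by exact: hb.
apply/esym; apply: (real_basis_trace _ _ _ (real_basis_unitary xU hb')).
- exact: gen_proj_linear.
- move=> V /=; apply/(tangentP _ hx); rewrite mulmxA adj_unitary// mul1mx.
  exact: gen_proj_gen.
- move=> V /= /(tangentP _ hx); rewrite mulmxA adj_unitary// mul1mx.
  exact: gen_proj_fixed.
Qed.

Lemma mfd_dim_exists : cliff false J k.+1 y ->
  (forall x, Q x -> twisted_trace (gens J k) x = twisted_trace (gens J k) y) ->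
  exists d, mfd_dim Q d.
Proof.
move=> hy ht.
have ex x : Q x -> exists d (b : 'I_d -> M), real_basis (tangent Q x) b /\
    d%:R = 2^-1 * (twisted_trace (gens J k) 1%:M - twisted_trace (gens J k) x).
  move=> hx; have hK := component_sub hx; have [xU _ _ _] := hK.
  have [d [b hb]] := real_basis_exists (gen_proj_linear J k x)
    (gen_proj_gen hJ hK) (gen_proj_fixed hJ hK).
  exists d, (fun i => x *m b i); split; last first.
    rewrite -rtr_gen_proj; apply/esym.
    exact: (real_basis_trace (gen_proj_linear J k x) (gen_proj_gen hJ hK) (gen_proj_fixed hJ hK) hb).
  have xU' : adj x \is unitarymx by apply/unitary_adjP; rewrite adjK adj_unitary.
  have -> : tangent Q x = [set B | gen false J k.+1 x (adj x *m B)].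
    by apply/funext => v; apply/propext/tangentP.
  by have := real_basis_unitary xU' hb; rewrite adjK.
(* The same d must serve at every point; this is where the constancy of the twisted trace enters. *)
have [d [b [_ hd]]] := ex y (component_refl hy).
exists d => x hx; have [d' [b' [hb' hd']]] := ex x hx.
have e : d' = d by apply/eqP; rewrite -(eqr_nat R) hd hd' (ht x hx).
by move: b' hb'; rewrite e => b' hb'; exists b'.
Qed.

End ComponentDimension.

(** * The components of Cl_(k+1) for k even *)

Section OddComponent.
Context {R : realType} {N : nat}.
Local Notation M := 'M[R[i]]_N.
Variables (J : nat -> M) (k : nat).
Hypotheses (k_even : ~~ odd k) (hJ : csys J k).

(** With y appended as J_(k+1), the product is a Hermitian involution up to a factor 1 or i, and the
    trace of such an involution is 2r - N with r the dimension of its eigenspace for 1. *)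
Lemma word_trace_integer y : cliff false J k.+1 y ->
  (exists z : int, complex.Re (\tr (word J k *m y)) = z%:~R) /\
  (exists z : int, complex.Im (\tr (word J k *m y)) = z%:~R).
Proof.
move=> hy; pose J' i := if i == k.+1 then y else J i.
have wJ m : (m <= k)%N -> word J' m = word J m.
  elim: m => //= m IH mk; rewrite IH ?(ltnW mk)// /J' eqSS ltn_eqF//.
have hJ' : csys J' k.+1.
  move=> i /andP[i0]; rewrite leq_eqVlt => /orP[/eqP ->|ik].
    have [y1 y2 y3 y4] := hy; rewrite /J' eqxx; split => // j /andP[j0 jk].
    by rewrite ltn_eqF//; apply: y3; rewrite j0.
  have [|x1 x2 x3 x4] := hJ (i := i); first by rewrite i0.
  rewrite /J' (ltn_eqF ik); split => // j /andP[j0 ji].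
  by rewrite ltn_eqF ?(ltn_trans ji)//; apply: x3; rewrite j0.
have [a ha hS] := word_involution hJ'.
have := involution_trace hS; rewrite /= wJ// /J' eqxx mxtraceZ.
set t := \tr _; set r := \rank _ => e.
have hz : a * t = ((2 * r%:Z - N%:Z)%:~R : R)%:C.
  by rewrite e rmorph_int intrB intrM.
case: ha => ea; rewrite ea ?mul1r in hz.
  by rewrite hz; split; [exists (2 * r%:Z - N%:Z)|exists 0].
split; [exists 0|exists (- (2 * r%:Z - N%:Z))].
  have := congr1 (@complex.Im R) hz.
  by rewrite cImM /= mul0r add0r mul1r.
have := congr1 (@complex.Re R) hz.
by rewrite cReM /= mul0r sub0r mul1r rmorphN /= => <-; rewrite opprK.
Qed.

Lemma word_trace_component x y : component (cliff false J k.+1) x y ->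
  \tr (word J k *m y) = \tr (word J k *m x).
Proof.
move=> hy; apply: complex_ext.
- apply: (integer_valued_is_cst (f := fun X => complex.Re (\tr (word J k *m X)))
    _ _ hy) => [|z /word_trace_integer []//].
  exact: (@continuous_cRe _ _ (fun X : 'M[R[i]^o]_N => \tr (word J k *m (X : M)) : R[i]^o)
    (@continuous_trace_mul _ _ _)).
- apply: (integer_valued_is_cst (f := fun X => complex.Im (\tr (word J k *m X)))
    _ _ hy) => [|z /word_trace_integer []//].
  exact: (@continuous_cIm _ _ (fun X : 'M[R[i]^o]_N => \tr (word J k *m (X : M)) : R[i]^o)
    (@continuous_trace_mul _ _ _)).
Qed.

Lemma word_trace_conjugator X Y : cliff false J k.+1 X -> cliff false J k.+1 Y ->
  \tr (word J k *m X) = \tr (word J k *m Y) ->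
  exists2 u : M, u \is unitarymx &
    (forall i, (0 < i <= k)%N -> u *m J i = J i *m u) /\ u *m X = Y *m u.
Proof.
have ek : k = k./2.*2 by rewrite -[LHS]odd_double_half (negbTE k_even).
by move: hJ; rewrite ek => hJ' hX hY h; exact: odd_conjugator.
Qed.

(* J (k + 2) anticommutes with the word in J 1, ..., J (k + 1), whose trace thus
   vanishes; a component on which this trace is not 0 has smaller dimension. *)
Lemma odd_component y d : csys J k.+2 -> cliff false J k.+1 y ->
  mfd_dim (component (cliff false J k.+1) y) d ->
  (forall d', mfd_dim (component (cliff false J k.+1) (J k.+1)) d' -> (d' <= d)%N) ->
  component (cliff false J k.+1) y (J k.+1).
Proof.
move=> hJ2 hy hd hmax.
have hj : cliff false J k.+1 (J k.+1) by apply: hJ2; rewrite leqnSn.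
have t0 : twisted_trace (gens J k) (J k.+1) = 0.
  have U1 : (0 < k.+1 <= k.+2)%N by rewrite leqnSn.
  have U2 : (0 < k.+2 <= k.+2)%N by rewrite leqnn.
  apply: (@twisted_trace_vanishes _ _ _ _ (J k.+2) (J k.+1) 0%N).
  - exact: csys_unitary hJ2 U2.
  - exact: csys_unitary hJ2 U1.
  - move=> A /gensP [i /andP[i0 ik] ->].
    have U3 : (0 < i <= k.+2)%N by rewrite i0 !leqW.
    split; apply: (csys_anti hJ2) => //; rewrite gtn_eqF// ltnS//.
    exact: leqW.
  - rewrite expr1 scaleN1r; apply: (csys_anti hJ2) => //.
    by rewrite gtn_eqF.
  - by rewrite expr0 scale1r.
(* All points of this component have the same word trace, hence are conjugate to J_(k+1) by matrices
   that commute with the J_i; the twisted trace is therefore constant on it. *)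
have [d' hd'] : exists d', mfd_dim (component (cliff false J k.+1) (J k.+1)) d'.
  apply: mfd_dim_exists => // x hx.
  have [u hu [uJ e]] := word_trace_conjugator (component_sub hx) hj (word_trace_component hx).
  by apply: twisted_trace_conj hu _ e => A /gensP [i hi ->]; exact: uJ.
have := hmax _ hd'; rewrite -(ler_nat R).
rewrite (mfd_dim_twisted_trace hJ (component_refl hy) hd).
rewrite (mfd_dim_twisted_trace hJ (component_refl hj) hd') t0 => hle.
(* The comparison of dimensions now says that the twisted trace of y is at most 0. *)
have tr0 W : twisted_trace (gens J k) W <= 0 -> \tr (word J k *m W) = 0.
  by move=> /twisted_trace_eq0; rewrite foldl_gens mxtrace_mulC.
have [|u hu [uJ e]] := word_trace_conjugator hy hj.
  rewrite !tr0 ?t0//; lra.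
apply: conjugator_component hu _ e hy => i; rewrite ltnS; exact: uJ.
Qed.

End OddComponent.

(** * Connectedness of the special orthogonal group *)

Section SpecialOrthogonal.
Context {R : realType}.
Local Notation C := R[i].
Local Notation rc := (map_mx (real_complex R)).

Lemma adj_real m n (A : 'M[R]_(m, n)) : adj (rc A) = rc A^T.
Proof.
rewrite adj.unlock; apply/matrixP => i j; rewrite !mxE conjcE.
exact: conjc_real.
Qed.

Lemma tau_real n (A : 'M[R]_n) : tau (rc A) = rc A.
Proof. by apply/matrixP => i j; rewrite !mxE conjcE conjc_real. Qed.

Lemma tau_fixed n (X : 'M[C]_n) : tau X = X -> X = rc (map_mx (@complex.Re R) X).
Proof.
move=> /matrixP h; apply/matrixP => i j; rewrite !mxE.
apply: complex_ext => //=; have := h i j; rewrite mxE => /(congr1 (@complex.Im R)).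
by rewrite cIm_conj; lra.
Qed.

Section Plane.
Variable N : nat.
Implicit Types u v w x y : 'rV[R]_N.

Definition dot x y : R := \sum_i x 0 i * y 0 i.

Lemma dotC x y : dot x y = dot y x.
Proof. by apply: eq_bigr => i _; rewrite mulrC. Qed.

Lemma dotDr x y z : dot x (y + z) = dot x y + dot x z.
Proof. by rewrite -big_split; apply: eq_bigr => i _; rewrite mxE mulrDr. Qed.

Lemma dotZr x (a : R) y : dot x (a *: y) = a * dot x y.
Proof. by rewrite mulr_sumr; apply: eq_bigr => i _; rewrite mxE mulrCA. Qed.

Lemma dot_mul x y : x *m y^T = (dot x y)%:M.
Proof.
by apply/matrixP => i j; rewrite !mxE !ord1 mulr1n; apply: eq_bigr => k _; rewrite mxE.
Qed.

Lemma dot_delta (i : 'I_N) x : dot (delta_mx 0 i) x = x 0 i.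
Proof.
rewrite /dot (bigD1 i)//= mxE !eqxx mul1r big1 ?addr0// => j /negbTE ji.
by rewrite mxE ji andbF mul0r.
Qed.

(** Acting on rows from the right, v^T u - u^T v sends v to u, u to -v and their orthogonal
    complement to 0. *)
Lemma plane_rotation u v : dot u u = 1 -> dot v v = 1 -> dot u v = 0 ->
  exists2 Q : 'M[C]_N, Q \is unitarymx & exists th,
  [/\ tau (rot_gen Q th) = rot_gen Q th,
      forall t, rc v *m rot Q th t = (cos t)%:C *: rc v + (sin t)%:C *: rc u &
      forall x, dot x u = 0 -> dot x v = 0 -> forall t, rc x *m rot Q th t = rc x].
Proof.
move=> uu vv uv; pose B := v^T *m u - u^T *m v.
have Bs : adj (rc B) = - rc B.
  by rewrite adj_real -map_mxN /B linearB /= !trmx_mul !trmxK opprB.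
have xB x : x *m B = dot x v *: u - dot x u *: v.
  by rewrite /B mulmxBr !mulmxA !dot_mul !mul_scalar_mx.
have [Q hQ [th e]] := skew_decomposition Bs.
exists Q => //; exists th; split.
- by rewrite -e tau_real.
- move=> t; rewrite [RHS](linear_ode (Y := fun t => (cos t)%:C *: rc v + (sin t)%:C *: rc u) (th := th) hQ).
    by rewrite cos0 sin0 scale1r scale0r addr0.
  move=> s; rewrite -e mulmxDl -!scalemxAl -!map_mxM !xB vv uu (dotC v) uv.
  rewrite !scale0r !scale1r subr0 sub0r map_mxN.
  have hc : cderiv (fun s => (cos s)%:C) s ((- sin s)%:C).
    by split; [exact: is_derive_cos|exact: is_derive_cst].
  have hs : cderiv (fun s => (sin s)%:C) s ((cos s)%:C).
    by split; [exact: is_derive_sin|exact: is_derive_cst].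
  have -> : (cos s)%:C *: rc u + (sin s)%:C *: - rc v =
      (- sin s)%:C *: rc v + (cos s)%:C *: rc u.
    by rewrite rmorphN scaleNr scalerN addrC.
  exact: mderivD (mderivZ (rc v) hc) (mderivZ (rc u) hs).
- move=> x xu xv t; rewrite [RHS](linear_ode (Y := fun=> rc x) (th := th) hQ _ t)// => s.
  rewrite -e -map_mxM xB xu xv !scale0r subr0 map_mx0.
  exact: mderiv_cst.
Qed.

(** u is the normalised part of w orthogonal to v. The vector u0 replaces it when that part
    vanishes, that is when w is v or -v. *)
Lemma plane_angle w v u0 : dot w w = 1 -> dot v v = 1 -> dot u0 u0 = 1 -> dot u0 v = 0 ->
  exists u, exists2 t, [/\ dot u u = 1, dot u v = 0 & w = cos t *: v + sin t *: u] &
    forall x, dot x w = 0 -> dot x v = 0 -> dot x u0 = 0 -> dot x u = 0.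
Proof.
move=> ww vv uu uv; pose a := dot w v; pose w' := w + (- a) *: v.
have w'v : dot w' v = 0 by rewrite dotC dotDr dotZr vv (dotC v w) mulr1 subrr.
have w'w' : dot w' w' = 1 - a ^+ 2.
  transitivity (dot w' (w + (- a) *: v)); first by [].
  rewrite dotDr dotZr w'v mulr0 addr0 dotC dotDr dotZr ww -/a.
  by rewrite expr2 mulNr.
have we : w = a *: v + w' by rewrite /w' scaleNr addrC subrK.
have [b hb] : exists b : R, b ^+ 2 = 1 - a ^+ 2 /\ (b = 0 -> w' = 0).
  have ge0 : 0 <= 1 - a ^+ 2.
    by rewrite -w'w'; apply: sumr_ge0 => i _; rewrite -expr2 sqr_ge0.
  exists (Num.sqrt (1 - a ^+ 2)); split; first exact: sqr_sqrtr.
  move=> s0; have : dot w' w' = 0 by rewrite w'w' -(sqr_sqrtr ge0) s0 expr0n.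
  move=> /psumr_eq0P h; apply/rowP => i; rewrite [RHS]mxE.
  have h0 j : predT j -> 0 <= w' 0 j * w' 0 j by rewrite -expr2 sqr_ge0.
  have /eqP := h h0 i isT.
  by rewrite mulf_eq0 orbb => /eqP.
have [t ht] : exists t, cis t = a +i* b.
  apply: cis_surj; rewrite conjcE; apply: complex_ext; rewrite ?cReM ?cImM /=.
    by case: hb; nra.
  by ring.
have ca : cos t = a by have := congr1 (@complex.Re R) ht.
have sb : sin t = b by have := congr1 (@complex.Im R) ht.
case: hb => b2 b0; have [eb|nb] := eqVneq b 0.
  exists u0, t => //; split => //; rewrite ca sb eb scale0r addr0.
  by rewrite {1}we (b0 eb) addr0.
exists (b^-1 *: w'), t.
  split.
  - rewrite dotZr dotC dotZr w'w' -b2; field; exact: nb.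
  - by rewrite dotC dotZr dotC w'v mulr0.
  - by rewrite ca sb scalerA divff// scale1r.
by move=> x xw xv _; rewrite dotZr /w' dotDr dotZr xw xv mulr0 addr0 mulr0.
Qed.

End Plane.

Lemma orthogonal_det N (J : nat -> 'M[C]_N) X : cliff true J 0 X ->
  \det X = 1 \/ \det X = -1.
Proof.
move=> [hU _ _ /(_ isT) hr]; rewrite (tau_fixed hr) det_map_mx /=.
set B := map_mx _ X; have BB : B *m B^T = 1%:M.
  apply: (@map_mx_inj _ _ (real_complex R)); rewrite map_mxM map_mx1 /= -adj_real.
  by rewrite -(tau_fixed hr) unitary_adj.
have /eqP : \det B ^+ 2 = 1 by rewrite expr2 -{2}det_tr -det_mulmx BB det1.
by rewrite sqrf_eq1 => /orP[] /eqP ->; [left|right]; rewrite ?rmorph1 ?rmorphN1.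
Qed.

Lemma orthogonal_det_component N (J : nat -> 'M[C]_N) X Y :
  component (cliff true J 0) X Y -> \det Y = \det X.
Proof.
move=> h; have e : complex.Re (\det Y) = complex.Re (\det X).
  apply: (integer_valued_is_cst (f := fun Z => complex.Re (\det Z)) _ _ h).
    exact: (@continuous_cRe _ _ (fun Z : 'M[R[i]^o]_N => \det (Z : 'M[R[i]]_N) : R[i]^o)
      (@continuous_det _ _)).
  by move=> Z /orthogonal_det [] ->; [exists 1|exists (-1)].
apply: complex_ext => //.
have [->|->] := orthogonal_det (component_sub h);
  by have [->|->] := orthogonal_det (component_mem h); rewrite ?cImN /= ?oppr0.
Qed.

Lemma SO_cliff N (J : nat -> 'M[C]_N) :
  @SO R N = [set X | cliff true J 0 X /\ \det X = 1].
Proof.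
apply/seteqP; split=> [_ [A [AA dA] <-]|X [[hU _ _ /(_ isT) hr] dX]].
  split; last by rewrite det_map_mx dA rmorph1.
  split.
  - by apply/unitary_adjP; rewrite adj_real -map_mxM AA map_mx1.
  - by rewrite ltnn.
  - by move=> i; rewrite ltn0 andbF.
  - by move=> _; exact: tau_real.
exists (map_mx (@complex.Re R) X); last by rewrite -tau_fixed.
split.
  apply: (@map_mx_inj _ _ (real_complex R)); rewrite map_mxM map_mx1 /= -adj_real.
  by rewrite -(tau_fixed hr) unitary_adj.
have := dX; rewrite {1}(tau_fixed hr) det_map_mx /= => /(congr1 (@complex.Re R)).
exact.
Qed.

Section Connected.
Variables (N : nat) (J : nat -> 'M[C]_N.+1).
Local Notation O := (cliff true J 0).

Lemma orthogonal_row_dot (A : 'M[C]_N.+1) (i j : 'I_N.+1) : O A ->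
  dot (map_mx (@complex.Re R) (row i A)) (map_mx (@complex.Re R) (row j A)) = (i == j)%:R.
Proof.
move=> [hU _ _ /(_ isT) hr].
have := unitary_adj hU; rewrite {1 2}(tau_fixed hr) adj_real -map_mxM => /matrixP/(_ i j).
rewrite !mxE => /(congr1 (@complex.Re R)) /=.
have -> : complex.Re ((i == j)%:R : C) = (i == j)%:R by case: (i == j).
move=> <-; apply: eq_bigr => l _; rewrite !mxE.
by [].
Qed.

(* If the rows of A before the k-th are those of the identity, a rotation in
   the plane of the k-th row and the k-th basis vector carries A to a matrix
   with one more such row; det A = 1 settles the last row. *)
Lemma SO_connected_rows m : forall (k : nat) (A : 'M[C]_N.+1), (k + m)%N = N ->
  O A -> \det A = 1 ->
  (forall i : 'I_N.+1, (i < k)%N -> row i A = rc (delta_mx 0 i)) ->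
  component O 1%:M A.
Proof.
elim: m => [|m IH] k A km hA dA hrow.
  rewrite addn0 in km.
  have Aij (i j : 'I_N.+1) : (i < N)%N -> A i j = (j == i)%:R.
    move=> iN; have ik : (i < k)%N by rewrite km.
    have /rowP/(_ j) := hrow i ik.
    by rewrite !mxE /= => ->; rewrite rmorph_nat.
  have Amax (j : 'I_N.+1) : (j < N)%N -> A ord_max j = 0.
    move=> jN; have [hU _ _ _] := hA; have := unitary_adj hU.
    move=> /matrixP/(_ ord_max j); rewrite !mxE adj.unlock (bigD1 j)//= big1 ?addr0.
      rewrite !mxE (Aij j j jN) eqxx rmorph1 mulr1 => ->.
      by rewrite -val_eqE /= gtn_eqF.
    by move=> l /negbTE lj; rewrite !mxE (Aij j l jN) lj rmorph0 mulr0.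
  have off i j : i != j -> A i j = 0.
    move=> ij; have [iN|Ni] := ltnP i N; first by rewrite Aij// eq_sym (negbTE ij).
    have -> : i = ord_max by apply/val_inj/eqP; rewrite eqn_leq Ni -ltnS ltn_ord.
    rewrite Amax// ltn_neqAle -ltnS ltn_ord andbT; apply: contra ij => /eqP jN.
    by apply/eqP/val_inj => /=; apply/eqP; rewrite jN eqn_leq Ni -ltnS ltn_ord.
  have hd : A ord_max ord_max = 1.
    rewrite -dA det_trig; last first.
      by apply/is_trig_mxP => i j ij; apply: off; rewrite neq_ltn ij.
    rewrite (bigD1 ord_max)//= big1 ?mulr1// => i im.
    rewrite Aij ?eqxx// ltn_neqAle -ltnS ltn_ord andbT.
    by apply: contra im => /eqP e; apply/eqP/val_inj.
  have -> : A = 1%:M.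
    apply/matrixP => i j; rewrite mxE; have [->|ij] := eqVneq i j; last by rewrite off.
    have [jN|Nj] := ltnP j N; first by rewrite Aij// eqxx.
    have -> // : j = ord_max by apply/val_inj/eqP; rewrite eqn_leq Nj -ltnS ltn_ord.
  apply: component_refl; split; [exact: unitary1|by rewrite ltnn| |].
    by move=> i; rewrite ltn0 andbF.
  by rewrite /tau map_mx1.
have kN : (k < N)%N by rewrite -km addnS ltnS leq_addr.
pose i0 : 'I_N.+1 := Ordinal (ltnW kN : (k < N.+1)%N).
(* This basis vector is the substitute direction u0 of [plane_angle]; like the row w, it is
   orthogonal to the rows already in place. *)
pose i1 : 'I_N.+1 := Ordinal (kN : (k.+1 < N.+1)%N).
pose w := map_mx (@complex.Re R) (row i0 A).
have we : row i0 A = rc w.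
  have [_ _ _ /(_ isT) hr] := hA; rewrite {1}(tau_fixed hr).
  by apply/rowP => j; rewrite !mxE.
have ww : dot w w = 1 by rewrite orthogonal_row_dot// eqxx.
have iw (i : 'I_N.+1) : (i < k)%N -> dot (delta_mx 0 i) w = 0.
  move=> ik; have -> : delta_mx 0 i = map_mx (@complex.Re R) (row i A).
    by rewrite hrow//; apply/rowP => j; rewrite !mxE.
  by rewrite orthogonal_row_dot// -val_eqE /= ltn_eqF.
have dd (i j : 'I_N.+1) : dot (delta_mx 0 i) (delta_mx 0 j) = (i == j)%:R.
  by rewrite dot_delta mxE eqxx.
have [u [t [uu uv wt] hu]] : exists u, exists2 t, [/\ dot u u = 1,
    dot u (delta_mx 0 i0) = 0 & w = cos t *: delta_mx 0 i0 + sin t *: u] &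
    forall x, dot x w = 0 -> dot x (delta_mx 0 i0) = 0 -> dot x (delta_mx 0 i1) = 0 ->
      dot x u = 0.
  by apply: plane_angle; rewrite ?dd ?eqxx// -val_eqE /= gtn_eqF.
have [|Q hQ [th [tB hv hx]]] := plane_rotation uu _ uv; first by rewrite dd eqxx.
have [AU _ _ Ar] := hA.
have hR s : O (A *m rot Q th s).
  split; [exact: unitaryM AU (rot_unitary _ _ hQ)|by rewrite ltnn| |].
    by move=> i; rewrite ltn0 andbF.
  by move=> _; rewrite tauM Ar// rot_tau.
have hc : component O A (A *m rot Q th (- t)).
  rewrite -{1}[A]mulmx1 -(rot0 th hQ).
  apply: (component_curve (c := fun s => A *m rot Q th s)) => // s.
  by exists (A *m (rot Q th s *m rot_gen Q th)); apply: mderivMl; exact: mderiv_rot.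
apply: component_trans (component_sym hc).
apply: (IH k.+1); [by rewrite addSnnS|exact: hR|by rewrite (orthogonal_det_component hc)|].
move=> i; rewrite ltnS leq_eqVlt row_mul => /orP[/eqP ik|ik].
  have -> : i = i0 by exact: val_inj.
  have -> : row i0 A = rc (delta_mx 0 i0) *m rot Q th t.
    by rewrite hv we wt map_mxD !map_mxZ.
  by rewrite -mulmxA -rot_add// subrr rot0// mulmx1.
have id0 : dot (delta_mx 0 i) (delta_mx 0 i0) = 0 by rewrite dd -val_eqE /= ltn_eqF.
have id1 : dot (delta_mx 0 i) (delta_mx 0 i1) = 0.
  by rewrite dd -val_eqE /= ltn_eqF// ltnW.
by rewrite hrow// hx//; apply: hu => //; exact: iw.
Qed.

End Connected.

Lemma SO_component N (J : nat -> 'M[C]_N) : (0 < N)%N ->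
  @SO R N = component (cliff true J 0) 1%:M.
Proof.
case: N J => // N J _; rewrite (SO_cliff J); apply/seteqP; split=> [X [hX dX]|X hX].
  exact: (SO_connected_rows (k := 0%N) (m := N)).
split; first exact: component_sub hX.
by rewrite (orthogonal_det_component hX) det1.
Qed.

End SpecialOrthogonal.

(** * Real points and nested components *)

Section BottChains.
Context {R : realType} {N : nat}.
Local Notation M := 'M[R[i]]_N.
Implicit Types (J : nat -> M) (k : nat).

Lemma cliff_forget J k : cliff true J k `<=` cliff false J k.
Proof. by move=> X []. Qed.

Lemma unitary_component J : @U R N = component (cliff false J 0) 1%:M.
Proof.
apply/seteqP; split=> [X hX|X /component_sub []//].
have [Q hQ [th <- _]] := unitary_log hX; rewrite -(rot0 th hQ).
apply: component_curve => t; first by exists (rot Q th t *m rot_gen Q th); exact: mderiv_rot.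
split; [exact: rot_unitary|by rewrite ltnn|by move=> i; rewrite ltn0 andbF|by []].
Qed.

Lemma cliff_tau J k : (forall i, (0 < i < k)%N -> tau (J i) = J i) ->
  forall X, cliff false J k X -> cliff false J k (tau X).
Proof.
move=> hJ X [x1 x2 x3 _]; split; last by [].
- apply/unitary_adjP; rewrite -conj_adj -tauM unitary_adj//.
  by rewrite /tau map_mx1.
- by move=> k0; rewrite -tauM x2// tauN /tau map_mx1.
- by move=> i hi; rewrite -(hJ i hi) -!tauM x3// tauN.
Qed.

Lemma tau_component J k : (forall i, (0 < i <= k)%N -> tau (J i) = J i) ->
  tau (J k) = J k ->
  @tau R N @` component (cliff false J k) (J k) = component (cliff false J k) (J k).
Proof.
move=> hJ hk; have hJ' i : (0 < i < k)%N -> tau (J i) = J i.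
  by move=> /andP[i0 ik]; apply: hJ; rewrite i0 ltnW.
have h X : component (cliff false J k) (J k) X -> component (cliff false J k) (J k) (tau X).
  by rewrite -{2}hk; apply: component_image; [exact: continuous_tau|exact: cliff_tau].
apply/seteqP; split=> [_ [X hX <-]|X hX]; first exact: h.
by exists (tau X); [exact: h|exact: tauK].
Qed.

Lemma real_component J k : component (cliff true J k) (J k) =
  component (component (cliff false J k) (J k) `&` [set X | tau X = X]) (J k).
Proof.
apply/seteqP; split.
  (* The real part of Cl_k may have points outside the complex component of J_k, so the real
     component is first taken inside itself. *)
  rewrite -{1}component_component; apply: component_mono => X hX; split.
    exact: component_mono (@cliff_forget J k) _ hX.
  by case: (component_sub hX) => _ _ _ /(_ isT).
apply: component_mono => X [/component_sub [x1 x2 x3 _] hX].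
by split=> // _.
Qed.

Lemma cliff_sub_component b J k : J 0%N = 1%:M -> cliff b J k (J k) ->
  component (cliff b J k.+1) (J k.+1) `<=` component (cliff b J k) (J k).
Proof. by move=> J0 hk X /component_sub; exact: cliff_component. Qed.

Lemma anticommuting_component b J k : J 0%N = 1%:M -> (0 < k)%N -> cliff b J k (J k) ->
  [set X | component (cliff b J k) (J k) X /\ X *m J k = - (J k *m X)] = cliff b J k.+1.
Proof.
move=> J0 k0 hk; apply/seteqP; split=> [X [hX e]|X hX].
  apply/cliffS; split=> //; first exact: component_sub hX.
  by case: (component_sub hX) => _ ->.
split; first exact: cliff_component hX.
by move/cliffS: hX => [_ _ ->].
Qed.

End BottChains.

(** * The two Bott chains as components of Cl_k *)

Section Chains.
Context {R : realType} {n : nat}.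
Hypothesis n_ge1 : (1 <= n)%N.
Local Notation M := 'M[R[i]]_(16 * n).
Variables (P Pt : nat -> set M) (J : nat -> M).
Hypotheses (hP : SO_Bott_chain P J) (hPt : U_Bott_chain Pt J).

Lemma chain_base : J 0%N = 1%:M.
Proof. by case: hP => -[]. Qed.

Lemma chain_point k : (k <= 8)%N -> P k (J k).
Proof. by case: hP => _ _ _; apply. Qed.

Lemma SO_chain_cliff k : (k <= 8)%N -> P k = component (cliff true J k) (J k).
Proof.
case: hP => -[P0 J0] P1 PS Pk.
elim: k => [|k IH] hk; first by rewrite P0 J0; apply: SO_component; rewrite muln_gt0.
have {}IH := IH (ltnW hk).
have Jk : cliff true J k (J k).
  by apply: (@component_sub _ _ _ (J k)); rewrite -IH; exact: Pk (ltnW hk).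
(* J_(k+1) lies in P_(k+1) by the choice of base points, so it suffices that P_(k+1) is the
   component of some point. *)
suff [y hy e] : component_of (cliff true J k.+1) (P k.+1).
  by have := Pk _ hk; rewrite e => /component_eq.
have [k0|k0] := posnP k; last first.
  rewrite -(anticommuting_component J0 k0 Jk) -IH.
  by have [] := PS k; rewrite ?k0.
rewrite k0 in Jk IH *.
(* An orthogonal X with X^2 = -1 lies in SO because the arc through X joins it to 1. *)
have -> // : cliff true J 1 = [set X | @SO R (16 * n) X /\ X *m X = - 1%:M].
rewrite -P0 IH; apply/seteqP; split=> [X hX|X [hX e]].
  split; first exact: (cliff_component Jk J0 hX).
  by case: hX => _ ->.
by apply/cliffS; split=> //; exact: component_sub hX.
Qed.

Lemma chain_cliff k : (k <= 8)%N -> cliff true J k (J k).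
Proof.
move=> hk; apply: (@component_sub _ _ _ (J k)); rewrite -SO_chain_cliff//.
exact: chain_point.
Qed.

Lemma chain_csys m : (m <= 8)%N -> csys J m.
Proof.
move=> hm i /andP[_ im]; apply: cliff_forget; apply: chain_cliff.
exact: leq_trans im hm.
Qed.

Lemma U_chain_cliff k : (k <= 8)%N -> Pt k = component (cliff false J k) (J k).
Proof.
case: hPt => Pt0 PtS; have J0 := chain_base.
elim: k => [|k IH] hk; first by rewrite Pt0 J0; exact: unitary_component.
have {}IH := IH (ltnW hk).
have Jk : cliff false J k (J k) := cliff_forget (chain_cliff (ltnW hk)).
have JS : cliff false J k.+1 (J k.+1) := cliff_forget (chain_cliff hk).
have [|hs [d hd hmax]] := PtS k hk; first by rewrite IH; exact: component_refl.
(* That -J_k is a pole is contained in the s-centriole hypothesis; it is used again for the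
   component of J_(k+1), which competes for the top dimension. *)
rewrite IH in hs hmax; have hp : pole _ _ _ := let: And3 h _ _ := hs in h.
have [y hy e] := s_centriole_component Jk J0 hs; rewrite e in hd *.
apply: component_eq; have [ko|ke] := boolP (odd k).
  apply: (@even_component _ _ J k.+1 _ _ (chain_csys (ltnW hk)) _ _ hy JS) => //.
  by rewrite /= negbK.
(* k is even and at most 7, so that J_(k+2) still belongs to the chain. *)
have hk8 : (k.+2 <= 8)%N.
  by rewrite ltn_neqAle hk andbT; apply: contraNneq ke => -[->].
apply: (odd_component ke _ _ hy hd) => [||d' hd'].
- exact: chain_csys (ltnW hk).
- exact: chain_csys.
- by apply: hmax hd'; exact: component_s_centriole.
Qed.

End Chains.

(** * The ladder of the two chains and its path space squares *)

Theorem theorem3p4 (R : realType) (n : nat) (n_ge1 : (1 <= n)%N)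
    (P Pt : nat -> set 'M[R[i]]_(16 * n)) (J : nat -> 'M[R[i]]_(16 * n))
    (hP : SO_Bott_chain P J) (hPt : U_Bott_chain Pt J) :
  [/\ forall k, (k <= 8)%N ->
        [/\ @tau R (16 * n) @` Pt k = Pt k,
            P k = component (Pt k `&` [set X | tau X = X]) (J k) &
            P k `<=` Pt k],
      forall k, (k <= 7)%N ->
        exists (h : P k.+1 `<=` P k) (ht : Pt k.+1 `<=` Pt k)
               (v : P k `<=` Pt k) (v' : P k.+1 `<=` Pt k.+1),
          subfun v \o subfun h = subfun ht \o subfun v' &
      forall l, (l <= 7)%N ->
        exists (v : P l.+1 `<=` Pt l.+1)
               (w : Omega (P l) (J l) (- J l) `<=` Omega (Pt l) (J l) (- J l))
               (j : P l.+1 -> Omega (P l) (J l) (- J l))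
               (jt : Pt l.+1 -> Omega (Pt l) (J l) (- J l)),
          [/\ canonical_map j, canonical_map jt &
              jt \o subfun v = subfun w \o j]].
Proof.
have J0 := chain_base hP.
have eP k : (k <= 8)%N -> _ := SO_chain_cliff n_ge1 hP (k := k).
have ePt k : (k <= 8)%N -> _ := U_chain_cliff n_ge1 hP hPt (k := k).
have cJ k : (k <= 8)%N -> _ := chain_cliff n_ge1 hP (k := k).
have tJ k : (k <= 8)%N -> tau (J k) = J k.
  by move=> /cJ [_ _ _ /(_ isT)].
have sub k : (k <= 8)%N -> P k `<=` Pt k.
  move=> hk; rewrite eP// ePt//; apply: component_mono; exact: cliff_forget.
split=> [k hk|k hk|l hl].
- split; [rewrite ePt//; apply: tau_component => [i /andP[_ ik]|]|rewrite eP// ePt//|exact: sub].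
  + by apply: tJ; exact: leq_trans ik hk.
  + exact: tJ.
  + exact: real_component.
- have hk8 := leqW hk : (k <= 8)%N.
  have h : P k.+1 `<=` P k.
    by rewrite !eP//; apply: cliff_sub_component => //; exact: cJ.
  have ht : Pt k.+1 `<=` Pt k.
    by rewrite !ePt//; apply: cliff_sub_component => //; apply: cliff_forget; exact: cJ.
  exists h, ht, (sub k hk8), (sub k.+1 hk); apply/funext => x.
  exact: val_inj.
- have hl8 := leqW hl : (l <= 8)%N.
  have Jl := cJ l hl8; have Jl' := cliff_forget Jl.
  have v := sub l.+1 hl.
  have w : Omega (P l) (J l) (- J l) `<=` Omega (Pt l) (J l) (- J l).
    by move=> g [g1 g2 g3 g4]; split=> // t; apply: sub.
  have cP x : P l.+1 x -> cliff true J l.+1 x by rewrite eP// => /component_sub.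
  have cPt x : Pt l.+1 x -> cliff false J l.+1 x by rewrite ePt// => /component_sub.
  have hj (x : P l.+1) : Omega (P l) (J l) (- J l) (restrict01 (arc (J l) (sval x))).
    by rewrite eP//; apply: arc_Omega => //; exact/cP/set_valP.
  have hjt (x : Pt l.+1) : Omega (Pt l) (J l) (- J l) (restrict01 (arc (J l) (sval x))).
    by rewrite ePt//; apply: arc_Omega => //; exact/cPt/set_valP.
  exists v, w, (fun x => SigSub (mem_set (hj x))), (fun x => SigSub (mem_set (hjt x))).
  split.
  + move=> x; rewrite /= eP//; apply: shortest_with_midpoint => //; exact/cP/set_valP.
  + move=> x; rewrite /= ePt//; apply: shortest_with_midpoint => //; exact/cPt/set_valP.
  + apply/funext => x; exact: val_inj.
Qed.
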